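(* Let $A$ be a diagonal parabolic operator on $H$, let $B\in(D_{-s}(A))^m$ with $s\in[0,1]$, put $\gamma=\min(1-s,\tfrac12)$, and let $\mathcal F$ be a map from $D_\gamma(A)$ to $D_{-1/2}(A)$ for which there exist $\eta,\kappa_0>0$ and a non-decreasing function $\Phi:\mathbb R_{\ge0}\to\mathbb R_{\ge0}$, continuous at $0$ with $\Phi(0)=0$, such that for all $u,v\in D_\gamma(A)$ with $\|u\|_H,\|v\|_H\le\eta$, $$\|\mathcal F(u)\|_{D_{-1/2}(A)}\le\Phi(\|u\|_H)\,\|u\|_{D_\gamma(A)},$$ $$\|\mathcal F(u)-\mathcal F(v)\|_{D_{-1/2}(A)}\le \kappa_0\big(\|u\|_{D_\gamma(A)}+\|v\|_{D_\gamma(A)}\big)\|u-v\|_H+\kappa_0\,\Phi(\|u\|_H+\|v\|_H)\,\|u-v\|_{D_\gamma(A)}.$$ Let $\lambda>0$ and suppose that $B$ is $F_\lambda$-admissible. For almost every $\mu\ge\lambda+c_A$, if $(T,K)$ is a parabolic $F$-equivalence between $(A,B)$ and $D_\mu=(A_L-\mu)P_L+A_HP_H$, then the following holds. There exists $\delta>0$ such that for every $u_0\in H$ with $\|u_0\|_H\le\delta$ there exists a unique solution $u\in C^0_b([0,+\infty);H)\cap L^2((0,+\infty);D_\gamma(A))$ of $$\partial_tu=(A+BK)u+\mathcal F(u),\qquad u(0)=u_0 .$$ In addition, with $C=\|T\|_{\mathcal L(H)}\|T^{-1}\|_{\mathcal L(H)}$, one has $$\|u(t)\|_H\le Ce^{-\lambda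 t}\|u_0\|_H\qquad\text{for all }t\ge0.$$
   Context: Operator. $H$ is an infinite-dimensional complex Hilbert space. An unbounded operator $A$ on $H$ is diagonal parabolic if: (A1) there is an orthonormal Hilbert basis $(e_n)_{n\ge1}$ of $H$ made of eigenvectors, $Ae_n=\lambda_ne_n$, and $D(A)=\{x\in H: Ax\in H\}$, where $Ax=\sum_n\lambda_nx_ne_n$, $x_n=\langle x,e_n\rangle_H$; (A2) $(\mathrm{Re}\,\lambda_n)_{n\ge1}$ is non-increasing and tends to $-\infty$; (A3) there is $C>0$ with $|\mathrm{Re}\,\lambda_n|\ge C|\mathrm{Im}\,\lambda_n|$ for all $n$. Put $c_A=\max(0,\max_n\mathrm{Re}\,\lambda_n)$. For $r\in\mathbb R$, $D_r(A)=D((-A+\delta_0)^r)$ (with $\delta_0\ge0$ such that $-A+\delta_0$ is invertible; completed if $r<0$), with norm equivalent to $\|\sum x_ne_n\|_{D_r(A)}^2=\sum(1+|\lambda_n|^2)^r|x_n|^2$. Thus $D_0(A)=H$, $D_1(A)=D(A)$, and $D_{-r}(A)$ is identified with the dual of $D_r(A)$ with pivot $H$; $D(A)'=D_{-1}(A)$, with pairing $\langle x,y\rangle=\sum x_n\overline{y_n}$. $A$ extends to an element of $\mathcal L(H,D(A)')$. Solutions are understood in the mild sense. Frequencies. $L_\lambda=\mathrm{span}\{e_n:\mathrm{Re}\,\lambda_n\ge-\lambda\}$ (finite-dimensional); $H_\lambda$ (resp. $D(A)'_\lambda$) is the closed span in $H$ (resp. $D(A)'$) of $\{e_n:\mathrm{Re}\,\lambda_n<-\lambda\}$;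 $P_L,P_H$ are the orthogonal projections onto $L_\lambda$ and $H_\lambda$ (also onto $L_\lambda$, $D(A)'_\lambda$ in $D(A)'$); $A_L=AP_L$, $A_H=AP_H$. $m(\lambda)$ is the greatest multiplicity of an eigenvalue of $A$ in $L_\lambda$. Admissibility. One can partition $(e_n)_{n\ge1}$ into $m(\lambda)$ sequences $(e_n^j)_{n\ge1}$, $1\le j\le m(\lambda)$, with integers $N_j(\lambda)\ge1$, such that with $L^j_\lambda=\mathrm{span}(e^j_n)_{1\le n\le N_j(\lambda)}$ and $\mathcal H^j=\overline{\mathrm{span}(e_n^j)_{n\ge1}}^H$ one has $L_\lambda=\bigoplus_jL^j_\lambda$, $H=\bigoplus_j\mathcal H^j$, the eigenvalues of $A$ on $L_\lambda^j$ are simple, and $A$ induces a diagonal parabolic operator $A_j$ on $\mathcal H^j$; $D(A_j)'$ (dual with pivot $\mathcal H^j$) is viewed as a subspace of $D(A)'$. $B=(B_1,\dots,B_m)\in(D(A)')^m$ is $F_\lambda$-admissible if $m\ge m(\lambda)$ and, for such a partition, for all $j\in\{1,\dots,m(\lambda)\}$: $B_j\in D(A_j)'$ and $\langle B_j,e^j_n\rangle_{D(A)',D(A)}\neq0$ for all $n\in\{1,\dots,N_j(\lambda)\}$. $B$ is identified with the map $z\in\mathbb C^m\mapsto\sum_jz_jB_j\in D(A)'$. $F$-equivalence. $\mathcal L_H(D(A)')=\{M\in\mathcal L(D(A)'): M_{|H}\in\mathcal L(H)\}$ and $\mathcal{GL}_H(D(A)')$ is its group of invertible elements, i.e. those $M$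 with $M\in\mathcal{GL}(D(A)')$ and $M_{|H}\in\mathcal{GL}(H)$. $(T,K)\in\mathcal{GL}_H(D(A)')\times\mathcal L(H,\mathbb C^m)$ is a parabolic $F$-equivalence between $(A,B)$ and an operator $D$ (with domain $D(A)$) if $T(A+BK)=DT$ in $\mathcal L(H,D(A)')$, $TB=B$ in $D(A)'$ (i.e. $TB_j=B_j$ for all $j$), and $K\in\mathcal L(L_\lambda,\mathbb C^m)$, i.e. $K$ vanishes on $H_\lambda$. *)

(* Defs.v *)
From HB Require Import structures.
From mathcomp Require Import all_boot all_order all_algebra.
From mathcomp Require Import sesquilinear.
From mathcomp Require Import complex.
From mathcomp Require Import all_classical all_reals all_analysis.

Set Implicit Arguments.
Unset Strict Implicit.
Unset Printing Implicit Defensive.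

Import Order.TTheory GRing.Theory Num.Def Num.Theory.
Import numFieldNormedType.Exports.

Local Open Scope classical_set_scope.
Local Open Scope ring_scope.
Local Open Scope complex_scope.

(* The inner product is linear in its first argument and conjugate-linear in
   the second one. *)
Record hilbertType (R : realType) := Hilbert {
  hsort :> completeNormedModType R[i] ;
  hdot : {dot hsort for (@conjC R[i])} ;
  hdot_norm : forall x : hsort, `|x| ^+ 2 = hdot x x
}.

(* Norms of MathComp complex numbers and of normed spaces over R[i] take their
   values in R[i]; these are their real-valued versions. *)
Definition cabs (R : realType) (z : R[i]) : R := complex.Re `|z|.
Definition hnorm (R : realType) (H : hilbertType R) (x : H) : R :=
  complex.Re `|x|.

Section LinearAlgebra.
Variables (R : realType) (H : hilbertType R).

Definition lin_span (S : set H) : set H :=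
  [set x | exists (k : nat) (c : 'I_k -> R[i]) (v : 'I_k -> H),
     (forall i, S (v i)) /\ x = \sum_(i < k) c i *: v i].

Definition lin_indep (k : nat) (v : 'I_k -> H) : Prop :=
  forall c : 'I_k -> R[i],
    \sum_(i < k) c i *: v i = 0 -> forall i, c i = 0.

Definition direct_sum (k : nat) (V : set H) (W : 'I_k -> set H) : Prop :=
  (V = [set x | exists w : 'I_k -> H,
                  (forall j, W j (w j)) /\ x = \sum_(j < k) w j]) /\
  (forall w : 'I_k -> H, (forall j, W j (w j)) ->
     \sum_(j < k) w j = 0 -> forall j, w j = 0).

End LinearAlgebra.

Definition parabolic_spectrum (R : realType) (lam : nat -> R[i]) : Prop :=
  [/\ nonincreasing_seq (fun n => complex.Re (lam n)),
      complex.Re (lam n) @[n --> \oo] --> -oo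
    & exists2 C : R, 0 < C &
        forall n, C * `|complex.Im (lam n)| <= `|complex.Re (lam n)| ].

(* The operator with eigenpairs (eigval n, eigvec n). Indices start at 0. *)
Record diagParabolic (R : realType) (H : hilbertType R) := DiagParabolic {
  eigvec : nat -> H ;
  eigval : nat -> R[i] ;
  eigvec_orthonormal : forall n k, hdot H (eigvec n) (eigvec k) = (n == k)%:R ;
  eigvec_total : closure (lin_span (range eigvec)) = [set: H] ;
  eigval_parabolic : parabolic_spectrum eigval
}.

(* All the spaces D_r(A) are realized as weighted l^2 spaces of coefficient
   sequences (x_n) with respect to the basis (e_n); x in H is identified with
   the sequence (<x, e_n>), so that D_0(A) is H with its norm, and D_{-r}(A) is
   the dual of D_r(A) with pivot space H. *)
Section Scale.
Variables (R : realType) (lam : nat -> R[i]) (r : R).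

Definition sqnormD (x : nat -> R[i]) : \bar R :=
  (\sum_(0 <= n <oo) (((1 + cabs (lam n) ^+ 2) `^ r * cabs (x n) ^+ 2)%:E))%E.

Definition spaceD : set (nat -> R[i]) := [set x | (sqnormD x < +oo)%E].

Definition normD (x : nat -> R[i]) : R := Num.sqrt (fine (sqnormD x)).

End Scale.

Section Operator.
Variables (R : realType) (H : hilbertType R) (A : diagParabolic H).
Local Notation lam := (eigval A).
Local Notation e := (eigvec A).
Local Notation seqC := (nat -> R[i]).

Definition hcoord (x : H) : seqC := fun n => hdot H x (e n).

Definition D_ (r : R) : set seqC := spaceD lam r.
Definition normD_ (r : R) (x : seqC) : R := normD lam r x.

Definition op (x : seqC) : seqC := fun n => lam n * x n.

Definition pairing (x y : seqC) : R[i] :=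
  limn (series (fun n => x n * conjC (y n) : R[i]^o)).

Definition c_ : R := Num.max 0 (sup (range (fun n => complex.Re (lam n)))).

Section Frequencies.
Variable l : R.

Definition low : set H :=
  lin_span [set e n | n in [set n | - l <= complex.Re (lam n)]].

Definition high : set H :=
  closure (lin_span [set e n | n in [set n | complex.Re (lam n) < - l]]).

(* The orthogonal projections, on coefficients, hence also on D(A)'. *)
Definition P_L (x : seqC) : seqC :=
  fun n => if - l <= complex.Re (lam n) then x n else 0.
Definition P_H (x : seqC) : seqC :=
  fun n => if complex.Re (lam n) < - l then x n else 0.

Definition A_L (x : seqC) : seqC := op (P_L x).
Definition A_H (x : seqC) : seqC := op (P_H x).

Definition op_mu (mu : R) (x : seqC) : seqC :=
  (A_L (P_L x) - mu%:C *: P_L x) + A_H (P_H x).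

Definition eigenspace (z : R[i]) : set H :=
  [set x | op (hcoord x) = hcoord (z *: x)].

Definition mult_ge (k : nat) : Prop :=
  exists (z : R[i]) (v : 'I_k -> H),
    lin_indep v /\ forall i, (eigenspace z `&` low) (v i).

(* k = m(l); this gives m(l) = 0 when L_l = {0}. *)
Definition is_max_mult (k : nat) : Prop :=
  mult_ge k /\ forall k', mult_ge k' -> (k' <= k)%N.

Definition simple_on (V : set H) : Prop :=
  forall z x y, (eigenspace z `&` V) x -> (eigenspace z `&` V) y ->
    x != 0 -> exists c : R[i], y = c *: x.

(* The j-th sequence of the partition is (e (sigma j n))_n, A_j is the operator
   with these eigenvectors, and D(A_j)' consists of the elements of D(A)' whose
   coefficients outside the range of sigma j vanish. *)
Definition F_admissible (m : nat) (B : 'I_m -> seqC) : Prop :=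
  (forall j, D_ (-1) (B j)) /\
  exists (ml : nat) (ml_le_m : (ml <= m)%N),
    is_max_mult ml /\
    exists (sigma : 'I_ml -> nat -> nat) (N : 'I_ml -> nat),
      let Lj j := lin_span [set e (sigma j n) | n in [set n | (n < N j)%N]] in
      let Hj j := closure (lin_span (range (fun n => e (sigma j n)))) in
      let lamj j n := lam (sigma j n) in
      let Bj j := B (widen_ord ml_le_m j) in
      [/\ bijective (fun p : 'I_ml * nat => sigma p.1 p.2),
          (forall j, (0 < N j)%N),
          direct_sum low Lj,
          direct_sum setT Hj &
          forall j,
            [/\ simple_on (Lj j),
                parabolic_spectrum (lamj j),
                spaceD (lamj j) (-1) (fun n => Bj j (sigma j n)),
                (forall k, ~ range (sigma j) k -> Bj j k = 0) &
                forall n, (n < N j)%N ->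
                  pairing (Bj j) (hcoord (e (sigma j n))) <> 0]].

End Frequencies.

(* Only the values of T on the set D_r are relevant. *)
Definition bounded_linear_on (r : R) (T : seqC -> seqC) : Prop :=
  [/\ (forall x, D_ r x -> D_ r (T x)),
      (forall (a : R[i]) x y, D_ r x -> D_ r y ->
         T (a *: x + y) = a *: T x + T y) &
      exists M : R, forall x, D_ r x -> normD_ r (T x) <= M * normD_ r x].

Definition L_H (T : seqC -> seqC) : Prop :=
  bounded_linear_on (-1) T /\ bounded_linear_on 0 T.

(* The inverse of T : D(A)' -> D(A)'; its value is irrelevant outside D(A)'. *)
Definition opinv (T : seqC -> seqC) (y : seqC) : seqC :=
  xget 0 [set x | D_ (-1) x /\ T x = y].

Definition GL_H (T : seqC -> seqC) : Prop :=
  [/\ L_H T, set_bij (D_ (-1)) (D_ (-1)) T, set_bij (D_ 0) (D_ 0) T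
    & L_H (opinv T)].

Definition opnorm_H (T : seqC -> seqC) : R :=
  sup [set normD_ 0 (T x) | x in [set x | D_ 0 x /\ normD_ 0 x <= 1]].

Definition input (m : nat) (B : 'I_m -> seqC) (z : 'rV[R[i]]_m) : seqC :=
  \sum_(j < m) z 0 j *: B j.

Definition F_equivalence (l : R) (m : nat) (B : 'I_m -> seqC)
    (D : seqC -> seqC) (T : seqC -> seqC) (K : {linear H -> 'rV[R[i]]_m}) :
    Prop :=
  [/\ GL_H T,
      (exists M : R, forall x j, cabs (K x 0 j) <= M * hnorm x),
      (forall x : H, T (op (hcoord x) + input B (K x)) = D (T (hcoord x))),
      (forall j, T (B j) = B j) &
      (forall x, high l x -> K x = 0)].

Definition cexp (z : R[i]) : R[i] :=
  (expR (complex.Re z))%:C * (cos (complex.Im z) +i* sin (complex.Im z)).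

Definition semigroup (t : R) (x : seqC) : seqC :=
  fun n => cexp (t%:C * lam n) * x n.

Local Notation leb := (@lebesgue_measure R).

(* D(A)' is separable, so that strong measurability amounts to measurability of
   the coefficients; the Bochner integral is then determined by them. *)
Definition bochner_integrable (I : set R) (f : R -> seqC) : Prop :=
  [/\ (forall t, I t -> D_ (-1) (f t)),
      (forall n, measurable_fun I (fun t => complex.Re (f t n))),
      (forall n, measurable_fun I (fun t => complex.Im (f t n))) &
      (\int[leb]_(t in I) (normD_ (-1) (f t))%:E < +oo)%E].

Definition bochner (I : set R) (f : R -> seqC) : seqC :=
  fun n => (\int[leb]_(t in I) complex.Re (f t n)) +i*
           (\int[leb]_(t in I) complex.Im (f t n)).

(* Mild solution of u' = A u + (B K u + F u), u(0) = u0: Duhamel's formula holds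
   in D(A)'. The function f is a representative of t |-> F (u t), which is
   defined for almost every t only, as F is a map on D_gam(A). *)
Definition mild_solution (m : nat) (B : 'I_m -> seqC)
    (K : {linear H -> 'rV[R[i]]_m}) (gam : R) (F : H -> seqC)
    (u0 : H) (u : R -> H) : Prop :=
  u 0 = u0 /\
  exists f : R -> seqC,
    [/\ {ae leb, forall t, 0 < t -> D_ gam (hcoord (u t)) /\ f t = F (u t)},
        (forall t, 0 <= t -> bochner_integrable `[0, t] f) &
        forall t, 0 <= t ->
          hcoord (u t) = semigroup t (hcoord u0) +
            bochner `[0, t]
              (fun s => semigroup (t - s) (input B (K (u s)) + f s))].

Definition in_Cb (u : R -> H) : Prop :=
  {within `[0, +oo[, continuous u} /\
  exists M : R, forall t, 0 <= t -> hnorm (u t) <= M.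

(* For u continuous with values in H, measurability of u as a map with values in
   D_gam(A) is automatic. *)
Definition in_L2 (gam : R) (u : R -> H) : Prop :=
  let I : set R := `]0, +oo[%classic in
  (\int[leb]_(t in I) sqnormD lam gam (hcoord (u t)) < +oo)%E.

End Operator.

(* Main.v *)
(* The inverse [S = opinv T] conjugates the closed-loop operator [A + BK] to the
   diagonal operator [D_mu], whose spectrum has real part less than [- lambda]
   as soon as [lambda + c_A < mu]. For almost every [mu] no [lam k] equals
   [lam n - mu]. Then the [n]-th coordinate of [T x] (and of [S x]) depends only
   on the finitely many low-frequency coordinates of [x] and on those with
   eigenvalue [lam n]. Hence [T] is bounded on [D_(-1/2)(A)] and [S] on
   [D_gam(A)], and Duhamel's formula for [A + BK], read coordinatewise, is carried
   to Duhamel's formula for [D_mu] by finite sums.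

   In the unknown [w = T u] the equation becomes [w' = D_mu w + T (F (S w))], and
   summing scalar energy estimates over the coordinates gives
     [e^(2 lambda t) |w(t)|^2 + c \int e^(2 lambda s) |w|_(1/2)^2
        <= |w(0)|^2 + c^-1 \int e^(2 lambda s) |T F (S w)|_(-1/2)^2].
   For small data this makes the Duhamel map a contraction, and absorbing the
   superlinear right-hand side gives [|w(t)| <= e^(- lambda t) |w(0)|] without
   loss, whence the constant [|T| |S|]. An arbitrary solution obeys the same
   estimate as long as it is small; by continuity it remains small forever, so
   it is the fixed point of the contraction. *)

Require Import Defs.
From HB Require Import structures.
From mathcomp Require Import all_boot all_order all_algebra.
From mathcomp Require Import sesquilinear.
From mathcomp Require Import complex.
From mathcomp Require Import all_classical all_reals all_analysis.
From mathcomp Require Import measurable_realfun.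
From mathcomp Require Import ring lra.

Set Implicit Arguments.
Unset Strict Implicit.
Unset Printing Implicit Defensive.

Import Order.TTheory GRing.Theory Num.Def Num.Theory.
Import numFieldNormedType.Exports.

Local Open Scope classical_set_scope.
Local Open Scope ring_scope.

Local Notation leb := lebesgue_measure.
Local Notation "''itg' t h" := (leb.-integrable `[0, t] (EFin \o h))
  (at level 10, t at level 9, h at level 9).

(** * Real and complex integrals *)

(** The maps [T] and [S] are given as bounded on H and on D(A)', whereas [F] is defined on D_gam
    with values in D_(-1/2). On high-frequency inputs both maps preserve each eigenvalue, and the
    weights of the scale depend on the eigenvalue alone, so there they commute with the weights and
    the bound on H transfers to every D_r with r >= -1. On low frequencies only the regularity of
    finitely many columns matters. A low column [v = S e_k] satisfies [(d_k - A) v = B K v], with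
    [d_k] the shifted eigenvalue, so it lies in D_(1-s) when B lies in D_(-s): hence [gam <= 1 - s].
    The bound [gam <= 1/2] matches the dissipation, which controls D_(1/2) because in a sector the
    gap grows like the modulus of the eigenvalue. Mild solutions need not be differentiable in time,
    so the energy estimate is derived from Duhamel's formula itself, by Young's inequality under the
    integral. Besides the resonances, the value [lambda + c_A] of mu is discarded, so that the gap
    is strict and leaves a dissipation constant [c > 0] that absorbs the nonlinearity. *)

Lemma EFin_Rintegral (R : realType) (D : set (measurableTypeR R)) (h : R -> R) :
  measurable D -> leb.-integrable D (EFin \o h) ->
  (\int[leb]_(x in D) (h x)%:E)%E = (\int[leb]_(x in D) h x)%:E.
Proof. by move=> mD hi; rewrite /Rintegral fineK// integrable_fin_num. Qed.

Lemma itgS (R : realType) (a b c d : R) (h : R -> R) : c <= a -> b <= d ->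
  leb.-integrable `[c, d] (EFin \o h) -> leb.-integrable `[a, b] (EFin \o h).
Proof.
move=> ca bd; apply: integrableS => //.
by apply/subset_itv; rewrite bnd_simp.
Qed.

(** Fubini on the triangle [s <= r <= t]. It replaces the Leibniz rule for primitives of merely
    integrable functions, which need not be differentiable everywhere. *)
Lemma Rintegral_triangle (R : realType) (p h : R -> R) (t : R) :
  'itg t p -> 'itg t h ->
  \int[leb]_(r in `[0, t]) (p r * \int[leb]_(s in `[0, r]) h s) =
  \int[leb]_(s in `[0, t]) (h s * \int[leb]_(r in `[s, t]) p r).
Proof.
move=> ip ih; pose I : set R := `[0, t]%classic.
have mI : measurable (I : set (measurableTypeR R)) by exact: measurable_itv.
rewrite -/I in ip ih *.
pose g := p \_ I; pose k := h \_ I.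
have ig : leb.-integrable setT (EFin \o g).
  by rewrite -restrict_EFin; apply/(integrable_mkcond _ mI).
have ik : leb.-integrable setT (EFin \o k).
  by rewrite -restrict_EFin; apply/(integrable_mkcond _ mI).
have mg : measurable_fun setT g by move/measurable_int/measurable_EFinP : ig.
have mk : measurable_fun setT k by move/measurable_int/measurable_EFinP : ik.
(* With [p] and [h] extended by zero, the integrand lives on the whole plane and its modulus is at
   most [|g x| |k y|], whence its integrability. *)
pose f (z : measurableTypeR R * measurableTypeR R) :=
  (if z.2 <= z.1 then g z.1 * k z.2 else 0)%:E.
have mf : measurable_fun setT f.
  apply/measurable_EFinP; apply: measurable_fun_ifT => //.
    by apply: measurable_fun_ler; [exact: measurable_snd|exact: measurable_fst].
  by apply: measurable_funM; apply: measurableT_comp => //.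
have fi : (leb \x leb)%E.-integrable setT f.
  apply/integrable12ltyP => //.
  apply: (@le_lt_trans _ _ (\int[leb]_x (`|g x|%:E * \int[leb]_y `|k y|%:E)))%E.
    apply: ge0_le_integral => //.
    - by move=> x _; exact: integral_ge0.
    - have mf' : measurable_fun setT (abse \o f) by exact: measurableT_comp.
      by have /= := measurable_fun_fubini_tonelli_F (m2 := leb) _ mf'; apply.
    - by apply: emeasurable_funM => //; apply/measurable_EFinP; apply: measurableT_comp.
    - move=> x _; rewrite -ge0_integralZl//; last first.
        by apply/measurable_EFinP; apply: measurableT_comp.
      apply: ge0_le_integral => //.
      + apply: measurableT_comp => //.
        exact: (measurableT_comp mf (pair1_measurable x)).
      + apply/measurable_EFinP; apply: measurable_funM => //.
        by apply: measurableT_comp.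
      + move=> y _; rewrite /f /= -EFinM lee_fin -normrM.
        by case: ifP => // _; rewrite normr0.
  have ik2 : (\int[leb]_y `|k y|%:E < +oo)%E by case/integrableP : ik.
  have ik0 : (0 <= \int[leb]_y `|k y|%:E)%E by exact: integral_ge0.
  rewrite ge0_integralZr//; last by apply/measurable_EFinP; apply: measurableT_comp.
  by apply: lte_mul_pinfty => //; rewrite ?integral_ge0//;
    case/integrableP : ig => // _ igo; rewrite ge0_fin_numE// integral_ge0.
have inI (x y : R) : I x -> (y <= x) && (y \in I) = (y \in [set` `[0, x]%R]).
  rewrite /I !mem_setE !in_itv/= => /andP[x0 xt]; apply/idP/idP.
    by move=> /andP[yx /andP[-> _]].
  by move=> /andP[-> yx]; rewrite yx/= (le_trans yx).
have inI' (x y : R) : I y -> (y <= x) && (x \in I) = (x \in [set` `[y, t]%R]).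
  rewrite /I !mem_setE !in_itv/= => /andP[+ _]; rewrite bnd_simp => y0; apply/idP/idP.
    by move=> /andP[-> /andP[_ ->]].
  by move=> /andP[yx ->]; rewrite yx/= (le_trans y0).
have E1 x : (\int[leb]_y f (x, y) =
    (((fun r => p r * \int[leb]_(s in `[0%R, r]) h s) \_ I) x)%:E)%E.
  rewrite patchE; case: ifPn => [|xI]; last first.
    rewrite (_ : (fun y => f (x, y)) = cst 0%E) ?integral0//.
    by apply/funext => y; rewrite /f/= /g patchE (negPf xI) mul0r if_same.
  move=> /set_mem xI; have ihx : leb.-integrable `[0, x] (EFin \o h).
    by apply: itgS ih => //; move: xI; rewrite /I/= in_itv/= => /andP[].
  rewrite EFinM -EFin_Rintegral// -integralZl// integral_mkcond.
  apply: eq_integral => y _; rewrite /f/= patchE /g patchE mem_set//.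
  rewrite -inI//; case: ifP => //= _; rewrite /k patchE.
  by case: ifP => //= _; rewrite mulr0.
have E2 y : (\int[leb]_x f (x, y) =
    (((fun s => h s * \int[leb]_(r in `[s, t]) p r) \_ I) y)%:E)%E.
  rewrite patchE; case: ifPn => [|yI]; last first.
    rewrite (_ : (fun x => f (x, y)) = cst 0%E) ?integral0//.
    by apply/funext => x; rewrite /f/= /k patchE (negPf yI) mulr0 if_same.
  move=> /set_mem yI; have ihx : leb.-integrable `[y, t] (EFin \o p).
    by apply: itgS ip => //; move: yI; rewrite /I/= in_itv/= => /andP[].
  rewrite EFinM -EFin_Rintegral// -integralZl// [RHS]integral_mkcond.
  apply: eq_integral => x _; rewrite /f/= [RHS]patchE /k patchE mem_set//.
  rewrite -inI'//; case: ifP => //= _; rewrite /g patchE.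
  by case: ifP => //= _; rewrite ?mul0r//mulrC.
have := Fubini fi.
under eq_integral do rewrite E1.
under [RHS]eq_integral do rewrite E2.
by move=> /(congr1 fine) E; rewrite [LHS]Rintegral_mkcond [RHS]Rintegral_mkcond.
Qed.

Lemma itgD (R : realType) (D : set (measurableTypeR R)) (f g : R -> R) : measurable D ->
  leb.-integrable D (EFin \o f) -> leb.-integrable D (EFin \o g) ->
  leb.-integrable D (EFin \o (fun x => f x + g x)).
Proof. by move=> mD fi gi; apply: (eq_integrable mD) (integrableD mD fi gi). Qed.

Lemma itgB (R : realType) (D : set (measurableTypeR R)) (f g : R -> R) : measurable D ->
  leb.-integrable D (EFin \o f) -> leb.-integrable D (EFin \o g) ->
  leb.-integrable D (EFin \o (fun x => f x - g x)).
Proof. by move=> mD fi gi; apply: (eq_integrable mD) (integrableB mD fi gi). Qed.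

Lemma itgZ (R : realType) (D : set (measurableTypeR R)) (a : R) (f : R -> R) : measurable D ->
  leb.-integrable D (EFin \o f) -> leb.-integrable D (EFin \o (fun x => a * f x)).
Proof. by move=> mD fi; apply: (eq_integrable mD) (integrableZl mD a fi). Qed.

Lemma itg_cont (R : realType) (a b : R) (f : R -> R) :
  {within `[a, b], continuous f} -> leb.-integrable `[a, b] (EFin \o f).
Proof. exact: (continuous_compact_integrable (@segment_compact _ a b)). Qed.

Lemma itg_contM (R : realType) (a b : R) (f g : R -> R) :
  {within `[a, b], continuous f} -> leb.-integrable `[a, b] (EFin \o g) ->
  leb.-integrable `[a, b] (EFin \o (fun x => f x * g x)).
Proof.
move=> cf ig; have mf : measurable_fun (`[a, b]%classic : set R) f.
  by have /measurable_int/measurable_EFinP := itg_cont cf.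
have mI : measurable (`[a, b]%classic : set (measurableTypeR R)) by [].
apply: (eq_integrable mI) (@integrableMr _ _ _ _ _ mI f _ mf _ ig) => //.
have := compact_bounded (continuous_compact cf (@segment_compact _ a b)).
case=> M [Mr HM]; exists M; split=> // x Mx y /= yab.
by apply: HM => //; exists y.
Qed.

Lemma within_cont (R : realType) (D : set R) (f : R -> R) :
  continuous f -> {within D, continuous f}.
Proof. exact: continuous_subspaceT. Qed.

Lemma within_contM (R : realType) (D : set R) (f g : R -> R) :
  {within D, continuous f} -> {within D, continuous g} ->
  {within D, continuous (fun x => f x * g x)}.
Proof. by move=> cf cg x; apply: continuousM; [exact: cf|exact: cg]. Qed.

Lemma within_contD (R : realType) (D : set R) (f g : R -> R) :
  {within D, continuous f} -> {within D, continuous g} ->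
  {within D, continuous (fun x => f x + g x)}.
Proof. by move=> cf cg x; apply: continuousD; [exact: cf|exact: cg]. Qed.

Lemma within_contB (R : realType) (D : set R) (f g : R -> R) :
  {within D, continuous f} -> {within D, continuous g} ->
  {within D, continuous (fun x => f x - g x)}.
Proof. by move=> cf cg x; apply: continuousB; [exact: cf|exact: cg]. Qed.

Lemma within_int (R : realType) (t : R) (h : R -> R) : 0 <= t -> 'itg t h ->
  {within `[0, t], continuous (fun r => \int[leb]_(s in `[0, r]) h s)}.
Proof. by move=> t0 ih; exact: (parameterized_integral_continuous t0 ih). Qed.

Lemma Rintegral_deriv (R : realType) (phi p : R -> R) (s t : R) : s <= t ->
  (forall x : R, is_derive x (1 : R) phi (p x)) -> continuous p ->
  \int[leb]_(r in `[s, t]) p r = phi t - phi s.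
Proof.
move=> + dphi cp; rewrite le_eqVlt => /predU1P[<-|st].
  by rewrite set_itv1 Rintegral_set1 subrr.
have cphi : continuous phi.
  by move=> x; apply: differentiable_continuous; apply/derivable1_diffP; exact: ex_derive.
rewrite /Rintegral (@continuous_FTC2 _ p phi)//.
- exact: within_cont.
- split=> [x _||]; first exact: ex_derive.
  + by apply: cvg_at_right_filter; exact: cphi.
  + by apply: cvg_at_left_filter; exact: cphi.
- by move=> x _; rewrite derive1E derive_val.
Qed.

(** Only [phi] is differentiated: writing [phi t - phi s] as the integral of [p] over [[s, t]]
    reduces the formula to Fubini on the triangle. *)
Lemma Rintegral_prod_rule (R : realType) (phi p h : R -> R) (c t : R) : 0 <= t ->
  (forall x : R, is_derive x (1 : R) phi (p x)) -> continuous p -> 'itg t h ->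
  phi t * (c + \int[leb]_(s in `[0, t]) h s) = phi 0 * c +
  \int[leb]_(r in `[0, t]) (p r * (c + \int[leb]_(s in `[0, r]) h s) + phi r * h r).
Proof.
move=> t0 dphi cp ih.
have cphi : continuous phi.
  by move=> x; apply: differentiable_continuous; apply/derivable1_diffP; exact: ex_derive.
have ip : 'itg t p by apply: itg_cont; exact: within_cont.
have ipH : 'itg t (fun r => p r * \int[leb]_(s in `[0, r]) h s).
  by apply: itg_cont; apply: within_contM; [exact: within_cont|exact: within_int].
have iph : 'itg t (fun r => phi r * h r).
  by apply: itg_contM => //; exact: within_cont.
have ipc : 'itg t (fun r => p r * c) by apply: itg_contM => //; [exact: within_cont|
  by apply: itg_cont; apply: within_cont => x; exact: cvg_cst].
rewrite RintegralD//; last first.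
  by under [X in EFin \o X]eq_fun do rewrite mulrDr; exact: itgD.
have -> : \int[leb]_(x in `[0, t]) (p x * (c + \int[leb]_(s in `[0, x]) h s)) =
    \int[leb]_(x in `[0, t]) (p x * c) +
    \int[leb]_(x in `[0, t]) (p x * \int[leb]_(s in `[0, x]) h s).
  by rewrite -RintegralD//; apply: eq_Rintegral => x _; rewrite mulrDr.
rewrite Rintegral_triangle// RintegralZr//.
rewrite (Rintegral_deriv t0 dphi cp).
have -> : \int[leb]_(s in `[0, t]) (h s * \int[leb]_(r in `[s, t]) p r) =
    \int[leb]_(s in `[0, t]) (phi t * h s - phi s * h s).
  apply: eq_Rintegral => s; rewrite inE/= in_itv/= => /andP[_ st].
  by rewrite (Rintegral_deriv st dphi cp) mulrC mulrBl.
rewrite RintegralB//; last exact: itgZ.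
by rewrite RintegralZl//; ring.
Qed.

(** * Complex-valued functions of time through their real and imaginary parts *)

Section complex_parts.
Variable R : realType.
Implicit Types z w : R[i].
Local Notation Re := complex.Re.
Local Notation Im := complex.Im.

Lemma cReD z w : Re (z + w) = Re z + Re w. Proof. by case: z w => [? ?] []. Qed.
Lemma cImD z w : Im (z + w) = Im z + Im w. Proof. by case: z w => [? ?] []. Qed.
Lemma cReN z : Re (- z) = - Re z. Proof. by case: z. Qed.
Lemma cImN z : Im (- z) = - Im z. Proof. by case: z. Qed.
Lemma cReM z w : Re (z * w) = Re z * Re w - Im z * Im w.
Proof. by case: z w => [? ?] []. Qed.
Lemma cImM z w : Im (z * w) = Re z * Im w + Im z * Re w.
Proof. by case: z w => [? ?] [? ?] /=. Qed.

Definition cpartE := (cReD, cImD, cReN, cImN, cReM, cImM).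

Lemma ceqP z w : Re z = Re w -> Im z = Im w -> z = w.
Proof. by case: z w => [? ?] [? ?] /= -> ->. Qed.

Definition csq z : R := Re z ^+ 2 + Im z ^+ 2.

Lemma csq_ge0 z : 0 <= csq z. Proof. by rewrite addr_ge0 ?sqr_ge0. Qed.

Lemma cabs_sqr z : cabs z ^+ 2 = csq z.
Proof.
by rewrite /cabs normc_def /= sqr_sqrtr// addr_ge0 ?sqr_ge0.
Qed.

Lemma csqM z w : csq (z * w) = csq z * csq w.
Proof. by rewrite /csq !cpartE; ring. Qed.

Lemma csqN z : csq (- z) = csq z.
Proof. by rewrite /csq !cpartE; ring. Qed.

Lemma csq0 : csq 0 = 0. Proof. by rewrite /csq /=; ring. Qed.

Lemma csq_eq0 z : csq z = 0 -> z = 0.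
Proof.
move=> /eqP; rewrite paddr_eq0 ?sqr_ge0// !sqrf_eq0 => /andP[/eqP a /eqP b].
exact: ceqP.
Qed.

Lemma csq_real (r : R) : csq (r%:C)%C = r ^+ 2.
Proof. by rewrite /csq/=; ring. Qed.

Lemma csqD_le z w : csq (z + w) <= 2 * csq z + 2 * csq w.
Proof.
rewrite /csq !cpartE; have := sqr_ge0 (Re z - Re w); have := sqr_ge0 (Im z - Im w).
by nra.
Qed.

Lemma cexp_Re z : Re (cexp z) = expR (Re z) * cos (Im z).
Proof. by rewrite /cexp cReM /=; ring. Qed.

Lemma cexp_Im z : Im (cexp z) = expR (Re z) * sin (Im z).
Proof. by rewrite /cexp cImM /=; ring. Qed.

Lemma cexpD z w : cexp (z + w) = cexp z * cexp w.
Proof.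
apply: ceqP.
  by rewrite [RHS]cReM !cexp_Re !cexp_Im cReD cImD expRD cosD; ring.
by rewrite [RHS]cImM !cexp_Re !cexp_Im cReD cImD expRD sinD; ring.
Qed.

Lemma cexp0 : cexp (0 : R[i]) = 1.
Proof. by apply: ceqP; rewrite ?cexp_Re ?cexp_Im /= expR0 ?cos0 ?sin0; ring. Qed.

Lemma csq_cexp z : csq (cexp z) = expR (2 * Re z).
Proof.
rewrite /csq cexp_Re cexp_Im !exprMn -mulrDr cos2Dsin2 mulr1.
by rewrite -expRM_natl.
Qed.

Lemma cexp_rD (t s : R) z : cexp ((t - s)%:C%C * z) = cexp (t%:C%C * z) * cexp (- (s%:C%C * z)).
Proof. by rewrite -cexpD; congr cexp; apply: ceqP; rewrite !cpartE/=; ring. Qed.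

Lemma cexpNK z : cexp (- z) * cexp z = 1.
Proof. by rewrite -cexpD addNr cexp0. Qed.

Lemma cexpKN z w : cexp z * (cexp (- z) * w) = w.
Proof. by rewrite mulrA -cexpD addrN cexp0 mul1r. Qed.

(** The shape matches [bochner], so that a coordinate of a Bochner integral is convertible to a
    [cint]. *)
Definition cint (D : set R) (f : R -> R[i]) : R[i] :=
  Complex (\int[leb]_(t in D) Re (f t)) (\int[leb]_(t in D) Im (f t)).

Definition citg (D : set R) (f : R -> R[i]) : Prop :=
  leb.-integrable D (EFin \o (fun t => Re (f t))) /\
  leb.-integrable D (EFin \o (fun t => Im (f t))).

Definition ccont (D : set R) (f : R -> R[i]) : Prop :=
  {within D, continuous (fun t => Re (f t))} /\
  {within D, continuous (fun t => Im (f t))}.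

Lemma eq_cint (D : set R) (f g : R -> R[i]) : {in D, f =1 g} -> cint D f = cint D g.
Proof. by move=> fg; congr Complex; apply: eq_Rintegral => x xD; rewrite fg. Qed.

Lemma eq_citg (D : set (measurableTypeR R)) (f g : R -> R[i]) : measurable D ->
  {in D, f =1 g} -> citg D f -> citg D g.
Proof.
move=> mD fg [f1 f2]; split; [apply: (eq_integrable mD) f1|apply: (eq_integrable mD) f2];
  by move=> x xD /=; rewrite fg.
Qed.

Lemma ccontM (D : set R) f g : ccont D f -> ccont D g -> ccont D (fun t => f t * g t).
Proof.
move=> [f1 f2] [g1 g2]; split.
- by under eq_fun do rewrite cReM; apply: within_contB; exact: within_contM.
- by under eq_fun do rewrite cImM; apply: within_contD; exact: within_contM.
Qed.

Lemma ccontD (D : set R) f g : ccont D f -> ccont D g -> ccont D (fun t => f t + g t).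
Proof.
move=> [f1 f2] [g1 g2]; split.
- by under eq_fun do rewrite cReD; exact: within_contD.
- by under eq_fun do rewrite cImD; exact: within_contD.
Qed.

Lemma ccont_cst (D : set R) z : ccont D (fun=> z).
Proof. by split; apply: within_cont => x; exact: cvg_cst. Qed.

Lemma ccont_sum (D : set R) n (f : 'I_n -> R -> R[i]) :
  (forall i, ccont D (f i)) -> ccont D (fun t => \sum_(i < n) f i t).
Proof.
elim: n f => [|n IH] f cf.
  by under eq_fun do rewrite big_ord0; exact: ccont_cst.
under eq_fun do rewrite big_ord_recr /=.
by apply: ccontD => //; exact: IH.
Qed.

Lemma eq_ccont (a b : R) f g : (forall t, a <= t <= b -> f t = g t) ->
  ccont `[a, b] f -> ccont `[a, b] g.
Proof.
move=> fg [c1 c2].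
have E t : t \in (`[a, b]%classic : set R) -> f t = g t.
  by rewrite inE /= in_itv /=; exact: fg.
by split; [apply: subspace_eq_continuous c1|apply: subspace_eq_continuous c2] => t tT;
  exact: congr1 (E t tT).
Qed.

Lemma ccont_of_csq (T : R) (f : R -> R[i]) :
  (forall t eps : R, 0 <= t <= T -> 0 < eps ->
    \forall s \near t, 0 <= s <= T -> csq (f t - f s) <= eps) ->
  ccont `[0, T] f.
Proof.
move=> h.
have P (p : R[i] -> R) : (forall x y, (p x - p y) ^+ 2 <= csq (x - y)) ->
    {within `[0, T], continuous (fun t => p (f t))}.
  move=> pl; apply/subspace_continuousP => t; rewrite /= in_itv/= => tT.
  apply/cvgrPdist_lt => eps eps0.
  have e2 : 0 < (eps / 2) ^+ 2 by rewrite exprn_gt0// divr_gt0.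
  apply: filterS (h t _ tT e2) => s /= hs; rewrite in_itv/= => /hs {}hs.
  suff : `|p (f t) - p (f s)| <= eps / 2 by move=> /le_lt_trans; apply; lra.
  rewrite -(@ler_pXn2r _ 2)// ?nnegrE ?(ltW (divr_gt0 _ _))// real_normK ?num_real//.
  exact: le_trans (pl _ _) hs.
split; apply: P => x y; rewrite /csq !cpartE; first by rewrite lerDl sqr_ge0.
by rewrite lerDr sqr_ge0.
Qed.

Lemma ccont_cexp (D : set R) z : ccont D (fun t => cexp (t%:C%C * z)).
Proof.
have H1 : continuous (fun x : R => expR (x * Re z) * cos (x * Im z)).
  by move=> x; apply: differentiable_continuous; apply/derivable1_diffP; exact: ex_derive.
have H2 : continuous (fun x : R => expR (x * Re z) * sin (x * Im z)).
  by move=> x; apply: differentiable_continuous; apply/derivable1_diffP; exact: ex_derive.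
split; apply: within_cont.
  by under eq_fun do rewrite cexp_Re cReM cImM/= !mul0r subr0 addr0.
by under eq_fun do rewrite cexp_Im cReM cImM/= !mul0r subr0 addr0.
Qed.

Lemma citg_cont (a b : R) f : ccont `[a, b] f -> citg `[a, b] f.
Proof. by move=> [f1 f2]; split; exact: itg_cont. Qed.

Lemma citgD (D : set (measurableTypeR R)) f g : measurable D ->
  citg D f -> citg D g -> citg D (fun t => f t + g t).
Proof.
move=> mD [f1 f2] [g1 g2]; split.
- by under [X in EFin \o X]eq_fun do rewrite cReD; exact: itgD.
- by under [X in EFin \o X]eq_fun do rewrite cImD; exact: itgD.
Qed.

Lemma citg_contM (a b : R) f g : ccont `[a, b] f -> citg `[a, b] g ->
  citg `[a, b] (fun t => f t * g t).
Proof.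
move=> [f1 f2] [g1 g2]; split.
- by under [X in EFin \o X]eq_fun do rewrite cReM; apply: itgB => //; exact: itg_contM.
- by under [X in EFin \o X]eq_fun do rewrite cImM; apply: itgD => //; exact: itg_contM.
Qed.

Lemma citgZ (D : set (measurableTypeR R)) z f : measurable D ->
  citg D f -> citg D (fun t => z * f t).
Proof.
move=> mD [f1 f2]; split.
- by under [X in EFin \o X]eq_fun do rewrite cReM; apply: itgB => //; exact: itgZ.
- by under [X in EFin \o X]eq_fun do rewrite cImM; apply: itgD => //; exact: itgZ.
Qed.

Lemma citg_sum (D : set (measurableTypeR R)) n (f : 'I_n -> R -> R[i]) : measurable D ->
  (forall i, citg D (f i)) -> citg D (fun t => \sum_(i < n) f i t).
Proof.
move=> mD; elim: n f => [|n IH] f cf.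
  by split; under [X in EFin \o X]eq_fun do rewrite big_ord0; exact: integrable0.
apply: eq_citg mD _ (citgD mD (IH _ (fun i => cf (widen_ord (leqnSn n) i))) (cf ord_max)).
by move=> t _; rewrite big_ord_recr.
Qed.

Lemma citgS (a b c d : R) f : c <= a -> b <= d ->
  citg `[c, d] f -> citg `[a, b] f.
Proof. by move=> ca bd [f1 f2]; split; [exact: itgS f1|exact: itgS f2]. Qed.

Lemma cintD (D : set (measurableTypeR R)) f g : measurable D ->
  citg D f -> citg D g -> cint D (fun t => f t + g t) = cint D f + cint D g.
Proof.
move=> mD [f1 f2] [g1 g2]; apply: ceqP => /=; rewrite -RintegralD//;
  by apply: eq_Rintegral => t _; rewrite cpartE.
Qed.

Lemma cintZ (D : set (measurableTypeR R)) z f : measurable D ->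
  citg D f -> cint D (fun t => z * f t) = z * cint D f.
Proof.
move=> mD [f1 f2]; apply: ceqP => /=.
  rewrite cReM /= -(RintegralZl _ mD f1) -(RintegralZl _ mD f2) -RintegralB//;
    [|exact: itgZ|exact: itgZ].
  by apply: eq_Rintegral => t _; rewrite cpartE.
rewrite cImM /= -(RintegralZl _ mD f1) -(RintegralZl _ mD f2) -RintegralD//;
  [|exact: itgZ|exact: itgZ].
by apply: eq_Rintegral => t _; rewrite cpartE.
Qed.

Lemma cint_sum (D : set (measurableTypeR R)) n (f : 'I_n -> R -> R[i]) : measurable D ->
  (forall i, citg D (f i)) ->
  cint D (fun t => \sum_(i < n) f i t) = \sum_(i < n) cint D (f i).
Proof.
move=> mD; elim: n f => [|n IH] f cf.
  rewrite big_ord0; apply: ceqP => /=;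
  by rewrite (eq_Rintegral leb (g := fun=> 0)) ?Rintegral_cst ?mul0r// => x _; rewrite big_ord0.
rewrite big_ord_recr /= -IH// -cintD//; last exact: citg_sum.
by apply: eq_cint => t _; rewrite big_ord_recr.
Qed.

Lemma ccont_int (t : R) h : 0 <= t -> citg `[0, t] h ->
  ccont `[0, t] (fun r => cint `[0, r] h).
Proof. by move=> t0 [h1 h2]; split; exact: within_int. Qed.

Lemma cint_prod_rule (phi p h : R -> R[i]) (c : R[i]) (t : R) : 0 <= t ->
  (forall x : R, is_derive x (1 : R) (fun s => Re (phi s)) (Re (p x))) ->
  (forall x : R, is_derive x (1 : R) (fun s => Im (phi s)) (Im (p x))) ->
  continuous (fun s => Re (p s)) -> continuous (fun s => Im (p s)) ->
  citg `[0, t] h ->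
  phi t * (c + cint `[0, t] h) = phi 0 * c +
  cint `[0, t] (fun r => p r * (c + cint `[0, r] h) + phi r * h r).
Proof.
move=> t0 d1 d2 c1 c2 [h1 h2].
have cR : continuous (fun s => Re (phi s)).
  by move=> x; apply: differentiable_continuous; apply/derivable1_diffP; exact: ex_derive.
have cI : continuous (fun s => Im (phi s)).
  by move=> x; apply: differentiable_continuous; apply/derivable1_diffP; exact: ex_derive.
have P11 := Rintegral_prod_rule (Re c) t0 d1 c1 h1.
have P12 := Rintegral_prod_rule (Im c) t0 d1 c1 h2.
have P21 := Rintegral_prod_rule (Re c) t0 d2 c2 h1.
have P22 := Rintegral_prod_rule (Im c) t0 d2 c2 h2.
have I (q ph g : R -> R) (k : R) : continuous q -> continuous ph -> 'itg t g ->
    'itg t (fun r => q r * (k + \int[leb]_(s in `[0, r]) g s) + ph r * g r).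
  move=> cq cph ig; apply: itgD => //.
    apply: itg_cont; apply: within_contM; first exact: within_cont.
    by apply: within_contD; [apply: within_cont => x; exact: cvg_cst|exact: within_int].
  by apply: itg_contM => //; exact: within_cont.
apply: ceqP; rewrite !cpartE /=.
- rewrite P11 P22 opprD addrACA; congr (_ + _).
  rewrite -RintegralB//; [|exact: I|exact: I].
  by apply: eq_Rintegral => x _; rewrite !cpartE /=; ring.
- rewrite P12 P21 addrACA; congr (_ + _).
  rewrite -RintegralD//; [|exact: I|exact: I].
  by apply: eq_Rintegral => x _; rewrite !cpartE /=; ring.
Qed.

(** The product rule for [phi t = cexp (t d)], whose derivative is [d phi]. It serves with [d] to
    differentiate Duhamel's formula and with [- d] as an integrating factor. *)
Lemma cexp_prod_rule (d : R[i]) (h : R -> R[i]) (c : R[i]) (t : R) : 0 <= t ->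
  citg `[0, t] h ->
  cexp (t%:C%C * d) * (c + cint `[0, t] h) = c +
  cint `[0, t] (fun r => d * (cexp (r%:C%C * d) * (c + cint `[0, r] h)) +
                         cexp (r%:C%C * d) * h r).
Proof.
move=> t0 ih.
have ER (x : R) : Re (cexp (x%:C%C * d)) = expR (x * Re d) * cos (x * Im d).
  by rewrite cexp_Re cReM cImM/= !mul0r subr0 addr0.
have EI (x : R) : Im (cexp (x%:C%C * d)) = expR (x * Re d) * sin (x * Im d).
  by rewrite cexp_Im cReM cImM/= !mul0r subr0 addr0.
have [c1 c2] : ccont setT (fun t : R => d * cexp (t%:C%C * d)).
  by apply: ccontM; [exact: ccont_cst|exact: ccont_cexp].
have d1 (x : R) : is_derive x (1 : R) (fun s : R => Re (cexp (s%:C%C * d)))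
    (Re (d * cexp (x%:C%C * d))).
  under eq_fun do rewrite ER; rewrite cReM ER EI.
  by apply: is_derive_eq; rewrite /GRing.scale/=; ring.
have d2 (x : R) : is_derive x (1 : R) (fun s : R => Im (cexp (s%:C%C * d)))
    (Im (d * cexp (x%:C%C * d))).
  under eq_fun do rewrite EI; rewrite cImM ER EI.
  by apply: is_derive_eq; rewrite /GRing.scale/=; ring.
have c1' : continuous (fun s : R => Re (d * cexp (s%:C%C * d))).
  by apply/continuous_subspace_setT.
have c2' : continuous (fun s : R => Im (d * cexp (s%:C%C * d))).
  by apply/continuous_subspace_setT.
have := cint_prod_rule c t0 d1 d2 c1' c2' ih => ->.
rewrite (_ : (0%:C)%C * d = 0) ?cexp0 ?mul1r; last first.
  by apply: ceqP; rewrite !cpartE/=; ring.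
by congr (_ + _); apply: eq_cint => x _; rewrite mulrA.
Qed.

End complex_parts.

(** * Duhamel's formula *)

Section duhamel.
#[local] Opaque cexp.
Variable R : realType.
Implicit Types (d z : R[i]) (h y : R -> R[i]).
Local Notation Re := complex.Re.
Local Notation Im := complex.Im.

Definition duhamel d z h (t : R) : R[i] :=
  cexp (t%:C%C * d) * z + cint `[0, t] (fun s => cexp ((t - s)%:C%C * d) * h s).

Lemma citg_cexpM d h (t : R) : citg `[0, t] h ->
  citg `[0, t] (fun s => cexp (- (s%:C%C * d)) * h s).
Proof.
move=> ih; apply: citg_contM => //.
have -> : (fun s : R => cexp (- (s%:C%C * d))) = (fun s : R => cexp (s%:C%C * - d)).
  by apply/funext => s; rewrite mulrN.
exact: ccont_cexp.
Qed.

Lemma duhamelE d z h (t : R) : citg `[0, t] h ->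
  duhamel d z h t =
  cexp (t%:C%C * d) * (z + cint `[0, t] (fun s => cexp (- (s%:C%C * d)) * h s)).
Proof.
move=> ih; rewrite /duhamel mulrDr; congr (_ + _).
rewrite -cintZ//; last exact: citg_cexpM.
by apply: eq_cint => s _; rewrite cexp_rD mulrA.
Qed.

Lemma duhamel0 d z h : duhamel d z h 0 = z.
Proof.
rewrite /duhamel set_itv1 (_ : (0%:C)%C * d = 0) ?cexp0 ?mul1r; last first.
  by apply: ceqP; rewrite !cpartE/=; ring.
rewrite (_ : cint _ _ = 0) ?addr0//.
by apply: ceqP; rewrite /= Rintegral_set1.
Qed.

Lemma duhamel_cont d z h (t : R) : 0 <= t -> citg `[0, t] h ->
  ccont `[0, t] (duhamel d z h).
Proof.
move=> t0 ih.
have cc : ccont `[0, t] (fun r => cexp (r%:C%C * d) *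
    (z + cint `[0, r] (fun s => cexp (- (s%:C%C * d)) * h s))).
  apply: ccontM; first exact: ccont_cexp.
  apply: ccontD; first exact: ccont_cst.
  by apply: ccont_int => //; exact: citg_cexpM.
apply: eq_ccont cc => r /andP[r0 rt]; rewrite duhamelE//.
exact: citgS ih.
Qed.

(** With its converse below, this allows passing to an integrated equation free of the semigroup, to
    which a linear map can be applied coordinate by coordinate. *)
Lemma duhamel_weak d z h (t : R) : 0 <= t -> citg `[0, t] h ->
  duhamel d z h t = z + cint `[0, t] (fun r => d * duhamel d z h r + h r).
Proof.
move=> t0 ih; rewrite duhamelE// cexp_prod_rule//; last exact: citg_cexpM.
congr (_ + _); apply: eq_cint => r; rewrite inE/= in_itv/= => /andP[r0 rt].
rewrite duhamelE//; last exact: citgS ih.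
by rewrite cexpKN.
Qed.

(** Multiply by the integrating factor [cexp (- t d)]: in the product rule the terms [- d y] and
    [d y] cancel and only the forcing remains. *)
Lemma weak_duhamel d z h y (t : R) : 0 <= t -> citg `[0, t] h -> citg `[0, t] y ->
  (forall r : R, 0 <= r <= t -> y r = z + cint `[0, r] (fun s => d * y s + h s)) ->
  y t = duhamel d z h t.
Proof.
move=> t0 ih iy weak.
have iyh : citg `[0, t] (fun s => d * y s + h s).
  by apply: citgD => //; exact: citgZ.
rewrite duhamelE//; have := cexp_prod_rule (- d) z t0 iyh.
rewrite -weak ?t0 ?lexx// => E.
rewrite -[LHS]mul1r -(cexpNK (t%:C%C * d)) mulrAC mulrC -mulrN E.
congr (_ * (_ + _)); apply: eq_cint => r; rewrite inE/= in_itv/= => rt.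
by rewrite -weak// mulrN; ring.
Qed.

Lemma young_cdot (z w : R[i]) (b : R) : 0 < b ->
  2 * (Re z * Re w + Im z * Im w) <= b * csq z + b^-1 * csq w.
Proof.
move=> b0; rewrite -subr_ge0.
suff -> : b * csq z + b^-1 * csq w - 2 * (Re z * Re w + Im z * Im w) =
   b^-1 * ((b * Re z - Re w) ^+ 2 + (b * Im z - Im w) ^+ 2).
  by rewrite mulr_ge0 ?invr_ge0 ?(ltW b0)// addr_ge0 ?sqr_ge0.
by rewrite /csq; field; rewrite gt_eqF.
Qed.

(** This mass complements the weight [exp (- a t)] of the initial datum: together the Young weights
    of Duhamel's formula add up to 1. *)
Lemma Rintegral_dexp (a t : R) : 0 <= t ->
  \int[leb]_(s in `[0, t]) (a * expR (- a * (t - s))) = 1 - expR (- a * t).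
Proof.
move=> t0.
have dphi (x : R) : is_derive x (1 : R) (fun s : R => expR (- a * (t - s)))
    (a * expR (- a * (t - x))).
  by apply: is_derive_eq; rewrite /GRing.scale/=; ring.
rewrite (Rintegral_deriv t0 dphi); first by rewrite subrr mulr0 expR0 subr0.
by move=> x; apply: differentiable_continuous; apply/derivable1_diffP; exact: ex_derive.
Qed.

(** * Energy estimate for a single coordinate *)

Section energy.
Variables (d z : R[i]) (h : R -> R[i]) (l a T : R).
Hypothesis a_def : Re d = - (a + l).
Hypothesis a_gt0 : 0 < a.
Hypothesis T_ge0 : 0 <= T.
Hypothesis h_itg : citg `[0, T] h.
Let g s := expR (2 * l * s) * csq (h s).
Hypothesis g_itg : 'itg T g.
Let y := duhamel d z h.

Let k s := expR (a * s) * (a^-1 * g s).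
Let Z r := expR (- a * r) * (csq z + \int[leb]_(s in `[0, r]) k s).

Let k_itg : 'itg T k.
Proof.
apply: itg_contM; last exact: itgZ.
apply: within_cont => x; apply: differentiable_continuous; apply/derivable1_diffP; exact: ex_derive.
Qed.

(* Young's inequality under the integral sign is Jensen's inequality for the
   weights of the Duhamel formula: it bounds the square of the solution by the
   solution of the scalar equation [Z' = - a Z + g / a]. *)
Lemma duhamel_sqr_le r : 0 <= r <= T -> expR (2 * l * r) * csq (y r) <= Z r.
Proof.
move=> /andP[r0 rT].
have ihr : citg `[0, r] h by exact: citgS h_itg.
have igr : 'itg r g by exact: itgS g_itg.
have ikr : 'itg r k by exact: itgS k_itg.
set X := y r; set E := expR (2 * l * r) * csq X.
(* Pairing [X] with its own Duhamel formula, [X] being held constant under the integral, prepares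
   Young's inequality for each value of [s]. *)
have XE : csq X = (Re X * Re (cexp (r%:C%C * d) * z) + Im X * Im (cexp (r%:C%C * d) * z)) +
   \int[leb]_(s in `[0, r]) (Re X * Re (cexp ((r - s)%:C%C * d) * h s) +
      Im X * Im (cexp ((r - s)%:C%C * d) * h s)).
  have [j1 j2] : citg `[0, r] (fun s => cexp ((r - s)%:C%C * d) * h s).
    apply: eq_citg (citgZ (cexp (r%:C%C * d)) _ (citg_cexpM d ihr)) => //.
    by move=> s _; rewrite mulrA -cexp_rD.
  rewrite RintegralD//; [|exact: itgZ|exact: itgZ].
  rewrite !RintegralZl// /csq {1 2}/X /y /duhamel cReD cImD /=.
  by rewrite !expr2 -/(y r) -/X; ring.
have csqy (u : R) w : csq (cexp (u%:C%C * d) * w) = expR (- 2 * (a + l) * u) * csq w.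
  by rewrite csqM csq_cexp; congr (expR _ * _); rewrite cReM/= a_def; ring.
have Y0 : 2 * (expR (2 * l * r) * (Re X * Re (cexp (r%:C%C * d) * z) +
     Im X * Im (cexp (r%:C%C * d) * z))) <= expR (- a * r) * (E + csq z).
  have := young_cdot X (cexp (r%:C%C * d) * z) (expR_gt0 (- a * r)).
  rewrite csqy -expRN.
  have -> : expR (- (- a * r)) * (expR (- 2 * (a + l) * r) * csq z) =
      expR (- (- a * r) + - 2 * (a + l) * r) * csq z by rewrite mulrA -expRD.
  move=> /(ler_wpM2l (expR_ge0 (2 * l * r))) => H.
  rewrite mulrCA; apply: le_trans H _.
  have -> : expR (- a * r) * (E + csq z) = expR (2 * l * r) * (expR (- a * r) * csq X) +
     expR (2 * l * r + (- (- a * r) + - 2 * (a + l) * r)) * csq z.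
    have -> : 2 * l * r + (- (- a * r) + - 2 * (a + l) * r) = - a * r by ring.
    by rewrite /E; ring.
  rewrite (expRD (2 * l * r)); move: (expR (- (- a * r) + _)) => q.
  by rewrite le_eqVlt; apply/orP; left; apply/eqP; ring.
have Y1 s : `[0, r]%classic s -> 2 * (expR (2 * l * r) *
   (Re X * Re (cexp ((r - s)%:C%C * d) * h s) + Im X * Im (cexp ((r - s)%:C%C * d) * h s)))
   <= E * (a * expR (- a * (r - s))) + expR (- a * r) * k s.
  move=> _; have b0 : 0 < a * expR (- a * (r - s)) by rewrite mulr_gt0 ?expR_gt0.
  have := young_cdot X (cexp ((r - s)%:C%C * d) * h s) b0.
  rewrite csqy invfM -expRN => /(ler_wpM2l (expR_ge0 (2 * l * r))) => H.
  rewrite mulrCA; apply: le_trans H _; rewrite /E mulrDr lerD//.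
    by rewrite le_eqVlt; apply/orP; left; apply/eqP; ring.
  rewrite le_eqVlt; apply/orP; left; apply/eqP; rewrite /k /g.
  transitivity (a^-1 * csq (h s) * (expR (2 * l * r) * (expR (- (- a * (r - s))) * expR (- 2 * (a + l) * (r - s))))); first by ring.
  transitivity (a^-1 * csq (h s) * (expR (- a * r) * (expR (a * s) * expR (2 * l * s)))); last by ring.
  by rewrite -!expRD; congr (_ * expR _); ring.
have ie : 'itg r (fun s => a * expR (- a * (r - s))).
  apply: itg_cont; apply: within_cont => x.
  apply: differentiable_continuous; apply/derivable1_diffP; exact: ex_derive.
have Y2 : 2 * (expR (2 * l * r) * \int[leb]_(s in `[0, r])
   (Re X * Re (cexp ((r - s)%:C%C * d) * h s) + Im X * Im (cexp ((r - s)%:C%C * d) * h s)))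
   <= E * (1 - expR (- a * r)) + expR (- a * r) * \int[leb]_(s in `[0, r]) k s.
  have [j1 j2] : citg `[0, r] (fun s => cexp ((r - s)%:C%C * d) * h s).
    apply: eq_citg (citgZ (cexp (r%:C%C * d)) _ (citg_cexpM d ihr)) => //.
    by move=> s _; rewrite mulrA -cexp_rD.
  rewrite -Rintegral_dexp// -!RintegralZl//; last 2 first.
  - by apply: itgZ => //; apply: itgD => //; exact: itgZ.
  - by apply: itgD => //; exact: itgZ.
  rewrite -RintegralD//; [|exact: itgZ|exact: itgZ].
  apply: le_Rintegral => //.
  - by apply: itgZ => //; apply: itgZ => //; apply: itgD => //; exact: itgZ.
  - by apply: itgD => //; exact: itgZ.
have := congr1 (fun v => 2 * (expR (2 * l * r) * v)) XE; rewrite /= -/E => E2.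
rewrite mulrDr [RHS]mulrDr in E2.
(* The Young weights [exp (- a r)] for the datum and [a exp (- a (r - s))] for the forcing have
   total mass 1, so exactly one copy of [E] appears on the right. *)
suff : 2 * E <= E + Z r by lra.
rewrite E2; apply: le_trans (lerD Y0 Y2) _.
by rewrite /Z le_eqVlt; apply/orP; left; apply/eqP; ring.
Qed.

Let y_cont : ccont `[0, T] y. Proof. exact: duhamel_cont. Qed.

Lemma duhamel_energy_itg : 'itg T (fun r => expR (2 * l * r) * csq (y r)).
Proof.
have [c1 c2] := y_cont; apply: itg_cont; apply: within_contM.
  apply: within_cont => x; apply: differentiable_continuous; apply/derivable1_diffP; exact: ex_derive.
by apply: within_contD; exact: within_contM.
Qed.

(** The estimate is an equality for the majorant [Z], by integrating its equation over [[0, T]]; the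
    left side only decreases when [Z] is replaced by the weighted square of [y]. *)
Lemma duhamel_energy :
  expR (2 * l * T) * csq (y T) + a * \int[leb]_(r in `[0, T]) (expR (2 * l * r) * csq (y r))
  <= csq z + a^-1 * \int[leb]_(r in `[0, T]) g r.
Proof.
have iZ : 'itg T Z.
  apply: itg_cont; apply: within_contM.
    apply: within_cont => x; apply: differentiable_continuous; apply/derivable1_diffP; exact: ex_derive.
  by apply: within_contD; [apply: within_cont => x; exact: cvg_cst|exact: within_int].
have ZE : Z T + a * \int[leb]_(r in `[0, T]) Z r = csq z + a^-1 * \int[leb]_(r in `[0, T]) g r.
  have dphi (x : R) : is_derive x (1 : R) (fun s : R => expR (- a * s)) (- a * expR (- a * x)).
    by apply: is_derive_eq; rewrite /GRing.scale/=; ring.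
  have cp : continuous (fun x : R => - a * expR (- a * x)).
    by move=> x; apply: differentiable_continuous; apply/derivable1_diffP; exact: ex_derive.
  rewrite {1}/Z (Rintegral_prod_rule _ T_ge0 dphi cp k_itg) mulr0 expR0 mul1r -addrA; congr (_ + _).
  rewrite -!RintegralZl// -RintegralD//; last exact: itgZ.
  - apply: eq_Rintegral => r _; rewrite /Z /k.
    transitivity (expR (- a * r) * expR (a * r) * (a^-1 * g r)); first by ring.
    by rewrite -expRD mulNr addNr expR0 mul1r.
  - have -> : (fun r => - a * expR (- a * r) * (csq z + \int[leb]_(s in `[0, r]) k s) +
        expR (- a * r) * k r) = (fun r => (- a) * Z r + a^-1 * g r).
      apply/funext => r; have -> : expR (- a * r) * k r = a^-1 * g r.
        rewrite /k mulrA -expRD (_ : - a * r + a * r = 0) ?expR0 ?mul1r//.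
        by ring.
      by rewrite /Z; ring.
    by apply: itgD => //; exact: itgZ.
rewrite -ZE lerD ?duhamel_sqr_le ?T_ge0 ?lexx// (ler_wpM2l (ltW a_gt0))//.
apply: le_Rintegral => //; first exact: duhamel_energy_itg.
by move=> x /=; rewrite in_itv/= => xT; exact: duhamel_sqr_le.
Qed.

End energy.
End duhamel.

(** * Weighted sequence spaces *)

Section spaces.
Variables (R : realType) (lam : nat -> R[i]).
Local Notation Re := complex.Re.
Local Notation Im := complex.Im.
Local Notation seqC := (nat -> R[i]).
Implicit Types (x y : seqC) (r : R).

Definition wt r n : R := (1 + cabs (lam n) ^+ 2) `^ r.

Lemma wt_base_ge1 n : 1 <= 1 + cabs (lam n) ^+ 2.
Proof. by rewrite lerDl sqr_ge0. Qed.

Lemma wt_gt0 r n : 0 < wt r n.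
Proof. by rewrite powR_gt0// (lt_le_trans ltr01)// wt_base_ge1. Qed.

Lemma wt_ge0 r n : 0 <= wt r n. Proof. exact/ltW/wt_gt0. Qed.

Lemma wt0 n : wt 0 n = 1. Proof. by rewrite /wt powRr0. Qed.

Lemma wtD r r' n : wt (r + r') n = wt r n * wt r' n.
Proof.
rewrite /wt powRD//; apply/implyP => _.
by rewrite gt_eqF// (lt_le_trans ltr01)// wt_base_ge1.
Qed.

Lemma wtN r n : wt (- r) n = (wt r n)^-1.
Proof. by rewrite /wt powRN. Qed.

Lemma wt_le r r' n : r <= r' -> wt r n <= wt r' n.
Proof. by move=> rr; apply: ler_powR => //; exact: wt_base_ge1. Qed.

Local Notation sq := (sqnormD lam).

Lemma sqnormDE r x : sq r x = (\sum_(0 <= n <oo) (wt r n * csq (x n))%:E)%E.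
Proof. by apply: eq_eseriesr => n _; rewrite /wt -(cabs_sqr (x n)). Qed.

Lemma sqterm_ge0 r x n : 0 <= wt r n * csq (x n).
Proof. by rewrite mulr_ge0 ?wt_ge0 ?csq_ge0. Qed.

Lemma sq_ge0 r x : (0 <= sq r x)%E.
Proof. by rewrite sqnormDE; apply: nneseries_ge0 => n _ _; rewrite lee_fin sqterm_ge0. Qed.

Lemma sq_partial r x N : ((\sum_(n < N) wt r n * csq (x n))%:E <= sq r x)%E.
Proof.
rewrite sqnormDE -sumEFin -(big_mkord xpredT (fun n => (wt r n * csq (x n))%:E)).
by apply: nneseries_lim_ge => n _ _; rewrite lee_fin sqterm_ge0.
Qed.

Lemma sq_leP r x (M : R) :
  (forall N, \sum_(n < N) wt r n * csq (x n) <= M) -> (sq r x <= M%:E)%E.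
Proof.
move=> H; rewrite sqnormDE; apply: lime_le.
  by apply: is_cvg_nneseries => n _ _; rewrite lee_fin sqterm_ge0.
by near=> N; rewrite big_mkord sumEFin lee_fin.
Unshelve. all: by end_near. Qed.

Lemma sq_coord r x n : ((wt r n * csq (x n))%:E <= sq r x)%E.
Proof.
apply: le_trans (sq_partial r x n.+1); rewrite lee_fin big_ord_recr/= lerDr.
by apply: sumr_ge0 => k _; exact: sqterm_ge0.
Qed.

Lemma sq_le r x y : (forall n, csq (x n) <= csq (y n)) -> (sq r x <= sq r y)%E.
Proof.
move=> xy; rewrite !sqnormDE; apply: lee_nneseries => n _.
  by rewrite lee_fin sqterm_ge0.
by rewrite lee_fin ler_wpM2l ?wt_ge0.
Qed.

Lemma sq_mono r r' x : r <= r' -> (sq r x <= sq r' x)%E.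
Proof.
move=> rr; rewrite !sqnormDE; apply: lee_nneseries => n _.
  by rewrite lee_fin sqterm_ge0.
by rewrite lee_fin ler_wpM2r ?csq_ge0// wt_le.
Qed.

Lemma sq_le_expR r x (l t : R) : 0 <= l -> 0 <= t ->
  (sq r x <= (expR (2 * l * t))%:E * sq r x)%E.
Proof.
move=> l0 t0; rewrite -[X in (X <= _)%E]mul1e; apply: lee_wpmul2r; first exact: sq_ge0.
by rewrite lee_fin -expR0 ler_expR !mulr_ge0.
Qed.

Lemma sqZ r (c : R[i]) x : sq r (c *: x) = ((csq c)%:E * sq r x)%E.
Proof.
rewrite !sqnormDE -nneseriesZl; last by move=> n _; rewrite lee_fin sqterm_ge0.
apply: eq_eseriesr => n _; rewrite -EFinM; congr EFin.
by rewrite (_ : (c *: x) n = c * x n)// csqM; ring.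
Qed.

Lemma sqDr r x y : (sq r (x + y)%R <= 2%:E * sq r x + 2%:E * sq r y)%E.
Proof.
rewrite !sqnormDE -!nneseriesZl; [|by move=> n _; rewrite lee_fin sqterm_ge0..].
rewrite -nneseriesD; [|by move=> n _ _; rewrite -EFinM lee_fin mulr_ge0// sqterm_ge0..].
apply: lee_nneseries => n _; first by rewrite lee_fin sqterm_ge0.
rewrite -!EFinM -EFinD lee_fin; have := ler_wpM2l (wt_ge0 r n) (csqD_le (x n) (y n)).
by rewrite (_ : (x + y) n = x n + y n)//; lra.
Qed.

Lemma sqN r x : sq r (- x) = sq r x.
Proof. by rewrite !sqnormDE; apply: eq_eseriesr => n _; rewrite (_ : (- x) n = - x n)// csqN. Qed.

Lemma sqBr r x y : (sq r (x - y)%R <= 2%:E * sq r x + 2%:E * sq r y)%E.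
Proof. by rewrite -(sqN r y) sqDr. Qed.

Lemma sq0 r : sq r 0 = 0%E.
Proof. by rewrite sqnormDE eseries0// => n _ _; rewrite /= csq0 mulr0. Qed.

Lemma sq_eq0 r x : sq r x = 0%E -> x = 0.
Proof.
move=> x0; apply/funext => n; apply: csq_eq0.
have := sq_coord r x n; rewrite x0 lee_fin pmulr_rle0 ?wt_gt0// => h.
by apply/eqP; rewrite eq_le h csq_ge0.
Qed.

Definition seqtrunc N x : seqC := fun n => if (n < N)%N then x n else 0.

Lemma sq_seqtrunc_le r N x : (sq r (seqtrunc N x) <= sq r x)%E.
Proof. by apply: sq_le => n; rewrite /seqtrunc; case: ifP => // _; rewrite csq0 csq_ge0. Qed.

Lemma sq_seqtruncE r N x : sq r (seqtrunc N x) = (\sum_(n < N) wt r n * csq (x n))%:E.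
Proof.
apply/eqP; rewrite eq_le; apply/andP; split.
  apply: sq_leP => M; have [MN|/ltnW NM] := leqP M N.
    rewrite (big_ord_widen _ (fun n => wt r n * csq (seqtrunc N x n)) MN) big_mkcond/=.
    apply: ler_sum => n _; case: ifP => _; last exact: sqterm_ge0.
    by rewrite /seqtrunc ltn_ord.
  rewrite (big_ord_widen _ (fun n => wt r n * csq (x n)) NM) [leRHS]big_mkcond/=.
  by apply: ler_sum => n _; rewrite /seqtrunc; case: ifP => // _; rewrite csq0 mulr0.
apply: le_trans (sq_partial r _ N); rewrite lee_fin; apply: ler_sum => n _.
by rewrite /seqtrunc ltn_ord.
Qed.

Lemma sq_tail_cvg r x : (sq r x < +oo)%E -> sq r (x - seqtrunc N x) @[N --> \oo] --> 0%E.
Proof.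
move=> xoo; rewrite sqnormDE in xoo.
have H k : xpredT k -> (0 <= (wt r k * csq (x k))%:E)%E by rewrite lee_fin sqterm_ge0.
have := nneseries_tail_cvg xoo H.
apply: cvg_trans; apply: near_eq_cvg; near=> N.
rewrite sqnormDE (nneseries_split 0 N)/=; last by move=> k _; rewrite lee_fin sqterm_ge0.
rewrite add0n big1_seq ?add0e; last first.
  move=> n /=; rewrite mem_index_iota => /= nN.
  by rewrite (_ : (x - seqtrunc N x) n = 0) ?csq0 ?mulr0// /GRing.add/= /GRing.opp/= /seqtrunc nN subrr.
rewrite [LHS]eseries_cond [RHS]eseries_cond; apply: eq_eseriesr => n /= nN.
rewrite (_ : (x - seqtrunc N x) n = x n)//.
by rewrite (_ : (x - seqtrunc N x) n = x n - seqtrunc N x n)// /seqtrunc ltnNge nN/= subr0.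
Unshelve. all: by end_near. Qed.

Lemma sq_tail_small r x (eps : R) : (sq r x < +oo)%E -> 0 < eps ->
  exists N0, forall N, (N0 <= N)%N -> (sq r (x - seqtrunc N x)%R <= eps%:E)%E.
Proof.
move=> xoo eps0; have /fine_cvgP [fin cv] := sq_tail_cvg xoo.
move/cvgrPdist_lt: cv => /(_ _ eps0) cv.
have [N0 _ HN] := filterI fin cv; exists N0 => N /HN [] /= finN.
rewrite sub0r normrN ger0_norm ?fine_ge0 ?sq_ge0// => /ltW.
by rewrite -lee_fin fineK.
Qed.

Lemma normD_sqr r x : (sq r x < +oo)%E -> (normD lam r x ^+ 2)%:E = sq r x.
Proof.
move=> xoo; rewrite /normD sqr_sqrtr ?fine_ge0 ?sq_ge0// fineK//.
by rewrite ge0_fin_numE// sq_ge0.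
Qed.

Lemma normD_ge0 r x : 0 <= normD lam r x. Proof. exact: sqrtr_ge0. Qed.

(** An isometry from D_(r + 2 r') to D_r; with [r = 0] it carries bounds on H to the other spaces of
    the scale. *)
Definition wmul r x : seqC := fun n => ((wt r n)%:C)%C * x n.

Lemma sq_wmul r r' x : sq r (wmul r' x) = sq (r + 2 * r') x.
Proof.
rewrite !sqnormDE; apply: eq_eseriesr => n _; congr EFin.
by rewrite /wmul csqM csq_real wtD mulr_natl mulr2n wtD expr2 mulrA.
Qed.

Definition cmeas (D : set R) (f : R -> R[i]) : Prop :=
  measurable_fun D (fun s => Re (f s)) /\ measurable_fun D (fun s => Im (f s)).

Lemma cmeas_csq (D : set R) f : cmeas D f -> measurable_fun D (fun s => csq (f s)).
Proof.
by move=> [f1 f2]; apply: measurable_funD; exact: measurable_funX.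
Qed.

Lemma cmeas_ccont (a b : R) f : ccont `[a, b] f -> cmeas `[a, b] f.
Proof. by move=> /citg_cont [/measurable_int/measurable_EFinP f1 /measurable_int/measurable_EFinP f2]. Qed.

Lemma cmeasD (D : set R) f g : cmeas D f -> cmeas D g -> cmeas D (fun s => f s + g s).
Proof.
move=> [f1 f2] [g1 g2]; split.
- by under eq_fun do rewrite cReD; exact: measurable_funD.
- by under eq_fun do rewrite cImD; exact: measurable_funD.
Qed.

Lemma cmeasM (D : set R) f g : cmeas D f -> cmeas D g -> cmeas D (fun s => f s * g s).
Proof.
move=> [f1 f2] [g1 g2]; split.
- by under eq_fun do rewrite cReM; apply: measurable_funB; exact: measurable_funM.
- by under eq_fun do rewrite cImM; apply: measurable_funD; exact: measurable_funM.
Qed.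

Lemma cmeas_cst (D : set R) z : cmeas D (fun=> z).
Proof. by split; exact: measurable_cst. Qed.

Lemma cmeasN (D : set R) f : cmeas D f -> cmeas D (fun s => - f s).
Proof.
move=> /(cmeasM (cmeas_cst D (-1))) [f1 f2].
by split; [move: f1|move: f2]; under eq_fun do rewrite mulN1r.
Qed.

Lemma cmeas_sum (D : set R) n (f : 'I_n -> R -> R[i]) :
  (forall i, cmeas D (f i)) -> cmeas D (fun t => \sum_(i < n) f i t).
Proof.
elim: n f => [|n IH] f cf.
  by under eq_fun do rewrite big_ord0; exact: cmeas_cst.
under eq_fun do rewrite big_ord_recr /=.
by apply: cmeasD => //; exact: IH.
Qed.

Lemma measurable_sq (D : set R) r (g : R -> seqC) :
  (forall n, cmeas D (g^~ n)) -> measurable_fun D (fun s => sq r (g s)).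
Proof.
move=> mg; under eq_fun do rewrite sqnormDE.
apply: ge0_emeasurable_sum => [n s _ _|n _]; first by rewrite lee_fin sqterm_ge0.
by apply/measurable_EFinP; apply: measurable_funM => //; exact: cmeas_csq.
Qed.

(** The squared norm of [exp (l s) g] in L^2(0, T; D_r). *)
Definition wint (l r T : R) (g : R -> seqC) : \bar R :=
  (\int[leb]_(s in `[0%R, T]) ((expR (2 * l * s))%:E * sq r (g s)))%E.

Lemma expR_lin_meas (D : set R) (k : R) : measurable_fun D (fun s : R => expR (k * s)).
Proof. by apply: measurableT_comp => //; exact: measurable_funM. Qed.

Lemma measurable_wint (l r T : R) (g : R -> seqC) :
  (forall n, cmeas `[0, T] (g^~ n)) ->
  measurable_fun (`[0, T]%classic : set R) (fun s => (expR (2 * l * s))%:E * sq r (g s))%E.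
Proof.
move=> mg; apply: emeasurable_funM; last exact: measurable_sq.
by apply/measurable_EFinP; exact: expR_lin_meas.
Qed.

(** By Tonelli the time integral passes inside the sum, so that estimates for single coordinates can
    be added up. *)
Lemma wintE (l r T : R) (g : R -> seqC) : (forall n, cmeas `[0, T] (g^~ n)) ->
  wint l r T g = (\sum_(0 <= n <oo) ((wt r n)%:E *
    \int[leb]_(s in `[0%R, T]) (expR (2 * l * s) * csq (g s n))%:E))%E.
Proof.
move=> mg; have mterm n : measurable_fun (`[0, T]%classic : set R)
    (fun s => (expR (2 * l * s) * csq (g s n))%:E).
  by apply/measurable_EFinP; apply: measurable_funM;
    [exact: expR_lin_meas|exact: cmeas_csq].
transitivity (\int[leb]_(s in `[0%R, T])
   (\sum_(0 <= n <oo) ((wt r n)%:E * (expR (2 * l * s) * csq (g s n))%:E)))%E.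
  apply: eq_integral => s _; rewrite sqnormDE -nneseriesZl; last first.
    by move=> n _; rewrite lee_fin sqterm_ge0.
  by apply: eq_eseriesr => n _; rewrite -!EFinM; congr EFin; ring.
rewrite integral_nneseries//.
- apply: eq_eseriesr => n _; rewrite ge0_integralZl_EFin ?wt_ge0//; last exact: mterm.
  by move=> s _; rewrite lee_fin mulr_ge0 ?expR_ge0 ?csq_ge0.
- by move=> n; apply: measurable_funeM; exact: mterm.
- by move=> n s _; rewrite -EFinM lee_fin mulr_ge0 ?wt_ge0// mulr_ge0 ?expR_ge0 ?csq_ge0.
Qed.

Lemma wint_ge0 l r T g : (0 <= wint l r T g)%E.
Proof. by apply: integral_ge0 => s _; rewrite mule_ge0 ?sq_ge0// lee_fin expR_ge0. Qed.

(** On a bounded interval square integrability is enough, by [|u| <= 1 + u^2]; the exponential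
    weight is at least 1 because [l >= 0]. *)
Lemma citg_of_sqr (l T : R) (f : R -> R[i]) : 0 <= l -> cmeas `[0, T] f ->
  'itg T (fun s => expR (2 * l * s) * csq (f s)) -> citg `[0, T] f.
Proof.
move=> l0 [f1 f2] fi.
have i1 : 'itg T (fun s => 1 + expR (2 * l * s) * csq (f s)).
  apply: itgD => //; apply: itg_cont; apply: within_cont => x; exact: cvg_cst.
have B s (u : R) : `[0, T]%classic s -> u ^+ 2 <= csq (f s) ->
    (`|u%:E| <= `|(1 + expR (2 * l * s) * csq (f s))%:E|)%E.
  rewrite /= in_itv/= => /andP[s0 _] uf.
  have e1 : 1 <= expR (2 * l * s) by rewrite -expR0 ler_expR !mulr_ge0.
  rewrite lee_fin [leRHS]ger0_norm; last first.
    by rewrite addr_ge0// mulr_ge0 ?csq_ge0// expR_ge0.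
  have : csq (f s) <= expR (2 * l * s) * csq (f s) by rewrite ler_peMl ?csq_ge0.
  have := sqr_ge0 (`|u| - 1); rewrite sqrrB1 real_normK ?num_real//.
  have := normr_ge0 u; lra.
split; apply: le_integrable i1 => //; try exact/measurable_EFinP;
  move=> s sT; apply: B => //; rewrite /csq; [rewrite lerDl|rewrite lerDr]; exact: sqr_ge0.
Qed.

Definition system_duhamel (d z : seqC) (g : R -> seqC) (t : R) : seqC :=
  fun n => duhamel (d n) (z n) (g^~ n) t.

(** * Energy estimate for a diagonal system *)

Section system_energy.
Variables (d z : seqC) (g : R -> seqC) (l c T : R).
Hypothesis d_le : forall n, Re (d n) <= - (l + c * wt (1 / 2) n).
Hypothesis l_ge0 : 0 <= l.
Hypothesis c_gt0 : 0 < c.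
Hypothesis T_ge0 : 0 <= T.
Hypothesis g_meas : forall n, cmeas `[0, T] (g^~ n).

Lemma wint_itg (l' r : R) n : (wint l' r T g < +oo)%E ->
  'itg T (fun s => expR (2 * l' * s) * csq (g s n)).
Proof.
move=> goo; have mm : measurable_fun (`[0, T]%classic : set R)
    (fun s => expR (2 * l' * s) * csq (g s n)).
  by apply: measurable_funM; [exact: expR_lin_meas|exact: cmeas_csq].
apply/integrableP; split; first exact/measurable_EFinP.
apply: le_lt_trans (_ : _ <= ((wt r n)^-1)%:E * wint l' r T g)%E _; last first.
  by rewrite lte_mul_pinfty// lee_fin invr_ge0 wt_ge0.
rewrite /wint -ge0_integralZl_EFin ?invr_ge0 ?wt_ge0//; last 2 first.
- by move=> s _; rewrite mule_ge0 ?sq_ge0// lee_fin expR_ge0.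
- exact: measurable_wint.
apply: ge0_le_integral => //.
- by apply: measurableT_comp => //; exact/measurable_EFinP.
- by apply: emeasurable_funM => //; exact: measurable_wint.
move=> s _; rewrite /comp gee0_abs; last first.
  by rewrite lee_fin mulr_ge0 ?expR_ge0 ?csq_ge0.
rewrite muleCA EFinM; apply: lee_wpmul2l; first by rewrite lee_fin expR_ge0.
rewrite -[leLHS]mul1e -(@mulVf _ (wt r n)) ?gt_eqF ?wt_gt0// EFinM -muleA.
by apply: lee_wpmul2l; [rewrite lee_fin invr_ge0 wt_ge0|exact: sq_coord].
Qed.

Lemma citg_wint (r : R) n : (wint l r T g < +oo)%E -> citg `[0, T] (g^~ n).
Proof. by move=> goo; apply: (citg_of_sqr l_ge0) => //; exact: wint_itg goo. Qed.

(** In coordinate [n] the scalar estimate has [a = - Re (d n) - l], at least [c] times the weight of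
    D_(1/2). So [a] produces the D_(1/2) norm on the left, and [1 / a] leaves only the D_(-1/2) norm
    of the forcing on the right. *)
Lemma system_energy :
  ((expR (2 * l * T))%:E * sq 0 (system_duhamel d z g T) +
   c%:E * wint l (1 / 2) T (system_duhamel d z g)
   <= sq 0 z + (c^-1)%:E * wint l (- (1 / 2)) T g)%E.
Proof.
(* A forcing of infinite norm makes the right-hand side infinite. *)
have [goo|] := ltP (wint l (- (1 / 2)) T g) +oo%E; last first.
  rewrite leye_eq => /eqP ->; rewrite gt0_muley ?lte_fin ?invr_gt0//.
  by rewrite addey ?leey// -ltNye (lt_le_trans _ (sq_ge0 _ _)).
pose y := system_duhamel d z g.
have ig n := wint_itg n goo.
have cg n := citg_wint n goo.
have a0 n : 0 < - Re (d n) - l.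
  have := d_le n; have := mulr_gt0 c_gt0 (wt_gt0 (1 / 2) n); lra.
have ca n : c * wt (1 / 2) n <= - Re (d n) - l by have := d_le n; lra.
have my n : cmeas `[0, T] (y^~ n).
  by apply: cmeas_ccont; apply: duhamel_cont.
have E n : expR (2 * l * T) * csq (y T n) + c * wt (1 / 2) n *
    \int[leb]_(s in `[0, T]) (expR (2 * l * s) * csq (y s n)) <=
    csq (z n) + c^-1 * wt (- (1 / 2)) n *
    \int[leb]_(s in `[0, T]) (expR (2 * l * s) * csq (g s n)).
  have a_def : Re (d n) = - ((- Re (d n) - l) + l) by ring.
  have := duhamel_energy (z n) a_def (a0 n) T_ge0 (cg n) (ig n).
  rewrite -/(y T n); move=> H.
  have i0 (f : R -> R[i]) : 0 <= \int[leb]_(s in `[0, T]) (expR (2 * l * s) * csq (f s)).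
    by apply: Rintegral_ge0 => s _; rewrite mulr_ge0 ?expR_ge0 ?csq_ge0.
  have h1 := ler_wpM2r (i0 (y^~ n)) (ca n).
  have h2 : (- Re (d n) - l)^-1 <= c^-1 * wt (- (1 / 2)) n.
    by rewrite wtN -invfM lef_pV2 ?posrE ?mulr_gt0 ?wt_gt0.
  have h3 := ler_wpM2r (i0 (g^~ n)) h2.
  apply: le_trans (lerD (lexx _) h1) _; apply: le_trans H _.
  by rewrite lerD2l.
have iy n : 'itg T (fun s => expR (2 * l * s) * csq (y s n)).
  exact: duhamel_energy_itg.
rewrite -/y (wintE _ _ my) (wintE _ _ g_meas) !sqnormDE.
rewrite -!nneseriesZl; last 3 first.
- move=> n _; rewrite mule_ge0 ?lee_fin ?wt_ge0//.
  by apply: integral_ge0 => s _; rewrite lee_fin mulr_ge0 ?expR_ge0 ?csq_ge0.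
- move=> n _; rewrite mule_ge0 ?lee_fin ?wt_ge0//.
  by apply: integral_ge0 => s _; rewrite lee_fin mulr_ge0 ?expR_ge0 ?csq_ge0.
- by move=> n _; rewrite lee_fin sqterm_ge0.
have p0 (k r : R) (f : R -> seqC) n : 0 <= k -> (0 <= k%:E * ((wt r n)%:E *
   \int[leb]_(s in `[0%R, T]) (expR (2 * l * s) * csq (f s n))%:E))%E.
  move=> k0; rewrite !mule_ge0 ?lee_fin ?wt_ge0//.
  by apply: integral_ge0 => s _; rewrite lee_fin mulr_ge0 ?expR_ge0 ?csq_ge0.
rewrite -!nneseriesD; last 4 first.
- by move=> n _ _; rewrite lee_fin sqterm_ge0.
- by move=> n _ _; apply: p0; rewrite invr_ge0 ltW.
- by move=> n _ _; rewrite -EFinM lee_fin mulr_ge0 ?expR_ge0 ?sqterm_ge0.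
- by move=> n _ _; apply: p0; rewrite ltW.
apply: lee_nneseries => n _.
  by move=> _; rewrite adde_ge0 ?p0 ?(ltW c_gt0)// mule_ge0// lee_fin ?expR_ge0 ?sqterm_ge0.
rewrite !EFin_Rintegral//.
rewrite -!EFinM -!EFinD lee_fin !wt0 !mul1r !mulrA.
by have := E n; rewrite !mul1r.
Qed.

End system_energy.
End spaces.

(** * Coordinates in the Hilbert space *)

Section hilbert.
Variables (R : realType) (H : hilbertType R) (A : diagParabolic H).
Local Notation lam := (eigval A).
Local Notation e := (eigvec A).
Local Notation seqC := (nat -> R[i]).
Local Notation Re := complex.Re.
Implicit Types (x y : H).

Lemma norm_hnorm x : `|x| = (hnorm x)%:C%C.
Proof. by rewrite /hnorm RRe_real// ger0_real. Qed.

Lemma Re_gt0 (z : R[i]) : 0 < z -> 0 < Re z.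
Proof. by rewrite ltcE => /andP[]. Qed.

Lemma hnorm_ge0 x : 0 <= hnorm x.
Proof. by rewrite -ler0c -norm_hnorm. Qed.

Lemma hnormD x y : hnorm (x + y) <= hnorm x + hnorm y.
Proof. by have := ler_normD x y; rewrite !norm_hnorm -rmorphD lecR. Qed.

Lemma hnormN x : hnorm (- x) = hnorm x.
Proof. by rewrite /hnorm normrN. Qed.

Lemma hnorm_sqr x : ((hnorm x ^+ 2)%:C)%C = hdot H x x.
Proof. by rewrite -hdot_norm norm_hnorm rmorphXn. Qed.

Lemma hnorm_eq0 x : hnorm x = 0 -> x = 0.
Proof. by move=> x0; apply/eqP; rewrite -normr_eq0 norm_hnorm x0. Qed.

Lemma hdotDl x y z : hdot H (x + y) z = hdot H x z + hdot H y z.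
Proof. exact: linearDl. Qed.
Lemma hdotZl a x z : hdot H (a *: x) z = a * hdot H x z.
Proof. exact: linearZl_LR. Qed.
Lemma hdotNl x z : hdot H (- x) z = - hdot H x z.
Proof. exact: linearNl. Qed.
Lemma hdotC x y : hdot H x y = conjC (hdot H y x).
Proof. by rewrite (hermC (hdot H)) expr0 mul1r. Qed.
Lemma hdotDr x y z : hdot H z (x + y) = hdot H z x + hdot H z y.
Proof. exact: linearDr. Qed.
Lemma pythagoras x y : hdot H x y = 0 -> hnorm (x + y) ^+ 2 = hnorm x ^+ 2 + hnorm y ^+ 2.
Proof.
move=> xy; apply: (@complexI R); rewrite rmorphD /= !hnorm_sqr.
by rewrite hdotDl !hdotDr xy (hdotC y x) xy rmorph0 addr0 add0r.
Qed.

Lemma hcoordD x y : hcoord A (x + y) = hcoord A x + hcoord A y.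
Proof. by apply/funext => n; exact: hdotDl. Qed.
Lemma hcoordN x : hcoord A (- x) = - hcoord A x.
Proof. by apply/funext => n; exact: hdotNl. Qed.
Lemma hcoordB x y : hcoord A (x - y) = hcoord A x - hcoord A y.
Proof. by rewrite hcoordD hcoordN. Qed.
Lemma hcoordZ a x : hcoord A (a *: x) = a *: hcoord A x.
Proof. by apply/funext => n; exact: hdotZl. Qed.
Lemma hcoord0 : hcoord A 0 = 0.
Proof. by apply/funext => n; exact: linear0l. Qed.
Lemma hcoord_sum I (r : seq I) (P : pred I) (F : I -> H) :
  hcoord A (\sum_(i <- r | P i) F i) = \sum_(i <- r | P i) hcoord A (F i).
Proof. by elim/big_rec2: _ => [|i x y _ <-]; rewrite ?hcoord0 ?hcoordD. Qed.

Lemma hcoord_eigvec k n : hcoord A (e k) n = (k == n)%:R.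
Proof. exact: eigvec_orthonormal. Qed.

Definition fourier N (c : seqC) : H := \sum_(k < N) c k *: e k.

Lemma hcoord_fourier N c : hcoord A (fourier N c) = seqtrunc N c.
Proof.
apply/funext => n; rewrite /fourier hcoord_sum fct_sumE /seqtrunc.
rewrite (eq_bigr (fun k : 'I_N => c k * ((k : nat) == n)%:R)); last first.
  by move=> k _; rewrite hcoordZ -(hcoord_eigvec k n).
case: ifPn => [nN|]; last first.
  rewrite -leqNgt => Nn; rewrite big1// => k _.
  by rewrite (_ : (_ == n) = false) ?mulr0//; apply/eqP => kn; have := ltn_ord k; rewrite kn ltnNge Nn.
rewrite (bigD1 (Ordinal nN))//= eqxx mulr1 big1 ?addr0// => k kn.
rewrite (_ : (_ == n) = false) ?mulr0//; apply/eqP => kn'; move/eqP: kn; apply.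
exact/val_inj.
Qed.

Lemma hdot_fourier x N c : (forall k, (k < N)%N -> hcoord A x k = 0) ->
  hdot H x (fourier N c) = 0.
Proof.
move=> x0; rewrite hdotC /fourier (_ : hdot H _ x = \sum_(k < N) c k * hdot H (e k) x).
  rewrite big1 ?rmorph0// => k _.
  by rewrite hdotC [hdot H x _](x0 k)// rmorph0 mulr0.
by elim/big_rec2: _ => [|k u v _ <-]; rewrite ?linear0l// hdotDl hdotZl.
Qed.

Lemma hnorm_scale_eigvec a n : hnorm (a *: e n) ^+ 2 = csq a.
Proof.
rewrite /hnorm normrZ normc_def norm_hnorm -rmorphM /= exprMn sqr_sqrtr ?addr_ge0 ?sqr_ge0//.
rewrite (_ : hnorm (e n) ^+ 2 = 1) ?mulr1//.
by apply: (@complexI R); rewrite hnorm_sqr eigvec_orthonormal eqxx.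
Qed.

Lemma hnorm_fourier N c : hnorm (fourier N c) ^+ 2 = \sum_(k < N) csq (c k).
Proof.
elim: N => [|N IH]; first by rewrite /fourier !big_ord0 /hnorm normr0 /= expr0n.
rewrite /fourier !big_ord_recr/= -/(fourier N c) addrC pythagoras; last first.
  apply: hdot_fourier => k kN; rewrite hcoordZ (_ : (_ *: _) k = c N * hcoord A (e N) k)//.
  by rewrite hcoord_eigvec gtn_eqF ?mulr0.
by rewrite IH addrC hnorm_scale_eigvec.
Qed.

Lemma hnorm_split x N : hnorm x ^+ 2 =
  hnorm (x - fourier N (hcoord A x)) ^+ 2 + \sum_(k < N) csq (hcoord A x k).
Proof.
rewrite -hnorm_fourier -pythagoras ?subrK//.
apply: hdot_fourier => k kN; rewrite hcoordB hcoord_fourier.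
by rewrite (_ : (_ - _) k = hcoord A x k - seqtrunc N (hcoord A x) k)// /seqtrunc kN subrr.
Qed.

Lemma fourier_best x N c :
  hnorm (x - fourier N (hcoord A x)) <= hnorm (x - fourier N c).
Proof.
rewrite -(@ler_pXn2r _ 2)// ?nnegrE ?hnorm_ge0//.
set u := x - _; rewrite (_ : x - fourier N c = u + fourier N (hcoord A x - c)).
  rewrite [leRHS]pythagoras; first by rewrite lerDl sqr_ge0.
  apply: hdot_fourier => k kN.
  rewrite hcoordB hcoord_fourier.
  by rewrite (_ : (_ - _) k = hcoord A x k - seqtrunc N (hcoord A x) k)// /seqtrunc kN subrr.
rewrite /u (_ : fourier N (hcoord A x - c) = fourier N (hcoord A x) - fourier N c).
  by rewrite addrA subrK.
rewrite /fourier -sumrB; apply: eq_bigr => k _.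
by rewrite -scalerBl.
Qed.

Lemma lin_span_fourier y : lin_span (range e) y -> exists N c, y = fourier N c.
Proof.
move=> [k [a [v [ve ->]]]].
elim: k a v ve => [|k IH] a v ve.
  by exists 0%N, 0; rewrite /fourier !big_ord0.
have [N [c E]] := IH (fun i => a (widen_ord (leqnSn k) i))
  (fun i => v (widen_ord (leqnSn k) i)) (fun i => ve _).
rewrite big_ord_recr/= E; have [n _ <-] := ve ord_max.
exists (maxn N n.+1), (seqtrunc N c + (fun j => if j == n then a ord_max else 0)).
rewrite /fourier; under [RHS]eq_bigr do rewrite scalerDl.
rewrite big_split/=; congr (_ + _).
  rewrite (big_ord_widen _ (fun j => c j *: e j) (leq_maxl N n.+1)) big_mkcond/=.
  by apply: eq_bigr => j _; rewrite /seqtrunc; case: ifP => //; rewrite scale0r.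
have nM : (n < maxn N n.+1)%N by rewrite leq_max ltnSn orbT.
rewrite (bigD1 (Ordinal nM))//= eqxx big1 ?addr0// => j jn.
case: eqP => [jn'|]; last by rewrite scale0r.
by move/eqP: jn; case; apply/val_inj.
Qed.

Lemma fourier_dense x (eps : R) : 0 < eps -> exists N c, hnorm (x - fourier N c) < eps.
Proof.
move=> eps0; have : closure (lin_span (range e)) x by rewrite eigvec_total.
move=> /(_ (ball x (eps%:C)%C)) [|y [/lin_span_fourier [N [c ->]]]].
  by apply: nbhsx_ballx; rewrite ltcR.
by rewrite -ball_normE /= norm_hnorm ltcR; exists N, c.
Qed.

(** A finite combination close to [x], padded with zeros, competes with all later Fourier sums,
    which are the best approximations. *)
Lemma fourier_cvg x (eps : R) : 0 < eps -> exists N0, forall N, (N0 <= N)%N ->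
  hnorm (x - fourier N (hcoord A x)) < eps.
Proof.
move=> eps0; have [N0 [c xc]] := fourier_dense x eps0.
exists N0 => N N0N; apply: le_lt_trans xc.
rewrite (_ : fourier N0 c = fourier N (seqtrunc N0 c)); first exact: fourier_best.
rewrite /fourier (big_ord_widen _ (fun j => c j *: e j) N0N) big_mkcond/=.
by apply: eq_bigr => j _; rewrite /seqtrunc; case: ifP => //; rewrite scale0r.
Qed.

Lemma parseval x : sqnormD lam 0 (hcoord A x) = (hnorm x ^+ 2)%:E.
Proof.
apply/eqP; rewrite eq_le; apply/andP; split.
  apply: sq_leP => N; rewrite (hnorm_split x N) -[leLHS]add0r lerD ?sqr_ge0//.
  by apply: ler_sum => k _; rewrite wt0 mul1r.
apply/lee_addgt0Pr => eps eps0.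
have s0 : 0 < Num.sqrt eps by rewrite sqrtr_gt0.
have [N hN] := fourier_cvg x s0; have h := hN _ (leqnn N).
apply: (@le_trans _ _ ((\sum_(k < N) wt lam 0 k * csq (hcoord A x k))%:E + eps%:E)%E).
  rewrite -EFinD lee_fin (hnorm_split x N) addrC lerD//.
    by apply: ler_sum => k _; rewrite wt0 mul1r.
  by rewrite -[leRHS]sqr_sqrtr ?(ltW eps0)// ler_pXn2r ?nnegrE ?hnorm_ge0 ?(ltW s0)// ltW.
by apply: leeD => //; exact: sq_partial.
Qed.

Lemma hcoord_inj x y : hcoord A x = hcoord A y -> x = y.
Proof.
move=> xy; apply/eqP; rewrite -subr_eq0; apply/eqP/hnorm_eq0/eqP.
rewrite -sqrf_eq0 -eqe -parseval hcoordB xy subrr.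
by apply/eqP; exact: sq0.
Qed.

Lemma D0_hcoord x : D_ A 0 (hcoord A x).
Proof. by rewrite /D_ /spaceD /= parseval ltry. Qed.

Lemma csq_hcoord_le x n : csq (hcoord A x n) <= hnorm x ^+ 2.
Proof. by rewrite -lee_fin -parseval (le_trans _ (sq_coord lam 0 _ n))// wt0 mul1r. Qed.

Lemma riesz_fischer (c : seqC) : D_ A 0 c -> exists x, hcoord A x = c.
Proof.
move=> c0; pose u N := fourier N c.
have small (eps : R) : 0 < eps -> exists N0, forall N, (N0 <= N)%N ->
    hnorm (u N0 - u N) < eps.
  move=> eps0; have e20 : 0 < (eps / 2) ^+ 2 by rewrite exprn_gt0// divr_gt0.
  have [N0 HN0] := sq_tail_small c0 e20; exists N0 => N N0N.
  apply: (@le_lt_trans _ _ (eps / 2)); last by rewrite ltr_pdivrMr// ltr_pMr// ltr1n.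
  rewrite -(@ler_pXn2r _ 2)// ?nnegrE ?hnorm_ge0 ?divr_ge0 ?(ltW eps0)//.
  rewrite -lee_fin -parseval; apply: le_trans (HN0 _ (leqnn N0)).
  apply: sq_le => n; rewrite hcoordB !hcoord_fourier.
  rewrite (_ : (seqtrunc N0 c - _) n = seqtrunc N0 c n - seqtrunc N c n)//.
  rewrite (_ : (c - _) n = c n - seqtrunc N0 c n)// /seqtrunc.
  have [nN0|N0n] := ltnP n N0.
    by rewrite (leq_trans nN0 N0N) !subrr csq0.
  by rewrite sub0r subr0 csqN; case: ifP => // _; rewrite csq0 csq_ge0.
have cu : cvg (u @ \oo).
  apply: cauchy_cvg; apply: cauchy_exP => eps eps0.
  have [N0 HN] := small _ (Re_gt0 eps0).
  exists (u N0); exists N0 => // N /= N0N; rewrite -ball_normE /= norm_hnorm.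
  by rewrite (_ : eps = ((Re eps)%:C)%C) ?ltcR ?HN// RRe_real// gtr0_real.
exists (lim (u @ \oo)); apply/funext => n.
apply/eqP; rewrite -subr_eq0; apply/eqP/csq_eq0/eqP; rewrite eq_le csq_ge0 andbT.
apply/ler_addgt0Pr => eps eps0; rewrite add0r.
have s0 : 0 < Num.sqrt eps by rewrite sqrtr_gt0.
have /cvgrPdist_lt /(_ ((Num.sqrt eps)%:C)%C) [|N1 _ HN1] := cu; first by rewrite ltcR.
pose N := maxn N1 n.+1.
have := HN1 N (leq_maxl _ _); rewrite /= norm_hnorm ltcR => h.
rewrite (_ : hcoord A (lim (u @ \oo)) n - c n = hcoord A (lim (u @ \oo) - u N) n).
  apply: le_trans (csq_hcoord_le _ _) _.
  by rewrite -[leRHS]sqr_sqrtr ?(ltW eps0)// ler_pXn2r ?nnegrE ?hnorm_ge0 ?(ltW s0)// ltW.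
rewrite hcoordB hcoord_fourier; congr (_ - _).
by rewrite /seqtrunc leq_max ltnSn orbT.
Qed.

(** The inverse of [hcoord] on D_0; the value 0 elsewhere is only a default. *)
Definition toH (c : seqC) : H := xget 0 [set x | hcoord A x = c].

Lemma toHK c : D_ A 0 c -> hcoord A (toH c) = c.
Proof. by move=> /riesz_fischer [x xc]; rewrite /toH; case: xgetP => [y _ ->//|/(_ x)]. Qed.

Lemma hcoordK x : toH (hcoord A x) = x.
Proof. by apply: hcoord_inj; rewrite toHK//; exact: D0_hcoord. Qed.

Lemma in_closed_span (P : set nat) x : (exists n, P n) ->
  (forall n, ~ P n -> hcoord A x n = 0) -> closure (lin_span [set e n | n in P]) x.
Proof.
move=> [n0 Pn0] x0 B /nbhs_ballP [r /= r0 Br].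
have [N HN] := fourier_cvg x (Re_gt0 r0).
exists (fourier N (hcoord A x)); split; last first.
  apply: Br; rewrite -ball_normE /= norm_hnorm.
  by rewrite (_ : r = ((Re r)%:C)%C) ?ltcR ?HN// RRe_real// gtr0_real.
(* Indices outside [P] carry a zero coefficient; [n0] fills their slot with some vector of the
   family. *)
exists N, (fun i : 'I_N => hcoord A x i), (fun i : 'I_N => e (if `[< P i >] then i : nat else n0)).
split=> [i|]; first by case: asboolP => Pi; [exists i|exists n0].
rewrite /fourier; apply: eq_bigr => i _; case: asboolP => // nPi.
by rewrite x0// !scale0r.
Qed.

End hilbert.

(** * Block structure of parabolic F-equivalences *)

Section block.
Variables (R : realType) (lam : nat -> R[i]).
Local Notation Re := complex.Re.
Local Notation Im := complex.Im.
Local Notation seqC := (nat -> R[i]).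
Local Notation sq := (sqnormD lam).
Local Notation D := (spaceD lam).
Implicit Types (x y : seqC).

Lemma spaceDD r x y : D r x -> D r y -> D r (x + y).
Proof.
move=> xr yr; apply: le_lt_trans (sqDr lam r x y) _.
by apply: lte_add_pinfty; rewrite lte_mul_pinfty.
Qed.

Lemma spaceDZ r a x : D r x -> D r (a *: x).
Proof.
by move=> xr; rewrite /spaceD /= sqZ lte_mul_pinfty// lee_fin csq_ge0.
Qed.

Lemma spaceD0 r : D r 0. Proof. by rewrite /spaceD /= sq0. Qed.

Lemma spaceDN r x : D r x -> D r (- x).
Proof. by rewrite /spaceD/= sqN. Qed.

Lemma spaceDB r x y : D r x -> D r y -> D r (x - y).
Proof. by move=> xr yr; apply: spaceDD => //; exact: spaceDN. Qed.

Lemma spaceD_sum r n (f : 'I_n -> seqC) : (forall i, D r (f i)) -> D r (\sum_(i < n) f i).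
Proof. by move=> fr; elim/big_rec: _ => [|i x _ xr]; [exact: spaceD0|exact: spaceDD]. Qed.

Lemma spaceD_mono r r' x : r <= r' -> D r' x -> D r x.
Proof. by move=> rr; apply: le_lt_trans; exact: sq_mono. Qed.

Lemma spaceD_le r x y : (forall n, csq (x n) <= csq (y n)) -> D r y -> D r x.
Proof. by move=> xy; apply: le_lt_trans; exact: sq_le. Qed.

Lemma spaceD_seqtrunc r N x : D r (seqtrunc N x).
Proof. by rewrite /spaceD /= sq_seqtruncE ltry. Qed.

Definition unitseq k : seqC := fun n => (n == k)%:R.

Lemma spaceD_unitseq r k : D r (unitseq k).
Proof.
apply: spaceD_le (spaceD_seqtrunc r k.+1 (fun=> 1)) => n.
by rewrite /unitseq /seqtrunc; case: eqP => [->|_]; rewrite ?ltnSn// csq0 csq_ge0.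
Qed.

Lemma seqtrunc_sum N x : seqtrunc N x = \sum_(k < N) x k *: unitseq k.
Proof.
apply/funext => n; rewrite fct_sumE /seqtrunc.
have E (k : 'I_N) : (x k *: unitseq k) n = x k * (n == k :> nat)%:R by [].
case: ifPn => [nN|].
  rewrite (bigD1 (Ordinal nN))// E /= eqxx mulr1 big1 ?addr0// => k kn.
  rewrite E (_ : (_ == _) = false) ?mulr0//; apply/eqP => nk; move/eqP: kn; apply.
  exact/val_inj.
rewrite -leqNgt => Nn; rewrite big1// => k _.
by rewrite E gtn_eqF ?mulr0// (leq_trans (ltn_ord k)).
Qed.

Lemma finite_positive_lbound (P : nat -> Prop) (f : nat -> R) (K : nat) :
  (forall k, P k -> 0 < f k) -> (forall k, (K <= k)%N -> P k -> 1 <= f k) ->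
  exists2 c : R, 0 < c & forall k, P k -> c <= f k.
Proof.
move=> fpos fK; have [c c0 cP] : exists2 c : R, 0 < c & forall k, (k < K)%N -> P k -> c <= f k.
  elim: K {fK} => [|K [c c0 cP]]; first by exists 1.
  have [PK|nPK] := pselect (P K).
    exists (Num.min c (f K)); first by rewrite lt_min c0 fpos.
    move=> k; rewrite ltnS leq_eqVlt => /predU1P[->|kK Pk].
      by rewrite ge_min lexx orbT.
    by rewrite ge_min cP.
  by exists c => // k; rewrite ltnS leq_eqVlt => /predU1P[->//|]; exact: cP.
exists (Num.min c 1); first by rewrite lt_min c0 ltr01.
move=> k Pk; have [kK|Kk] := ltnP k K; first by rewrite ge_min cP.
by rewrite ge_min fK ?orbT.
Qed.

Hypothesis lam_par : parabolic_spectrum lam.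

Lemma Re_lam_lt (M : R) : exists K, forall k, (K <= k)%N -> Re (lam k) < M.
Proof.
case: lam_par => _ + _ => /cvgrNyPlt /(_ M) [K _ HK].
by exists K => k Kk; exact: HK.
Qed.

(** This makes the resolvent [(A - z)^-1], off the eigenvalue [z], gain one full order on the scale.
    Only finitely many eigenvalues lie to the right of [Re z - 1], so those different from [z] stay
    at a positive distance from it. *)
Lemma lam_shift_lbound (z : R[i]) : exists2 c : R, 0 < c &
  forall k, lam k != z -> c * wt lam 1 k <= csq (lam k - z).
Proof.
have [K HK] := Re_lam_lt (Re z - 1).
have [||c0 c00 Hc0] := @finite_positive_lbound (fun k => lam k != z)
    (fun k => csq (lam k - z)) K.
- move=> k kz; rewrite lt_def csq_ge0 andbT; apply/eqP => /csq_eq0 /eqP.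
  by rewrite subr_eq0 (negPf kz).
- move=> k Kk _; have := HK _ Kk => h.
  rewrite /csq cReD cReN; have := sqr_ge0 (Im (lam k - z)); nra.
(* With [c0] the lower bound of [|lam k - z|^2], one has [1 + |lam k|^2 <= (1 + 2 |z|^2) + 2 |lam k
   - z|^2 <= ((1 + 2 |z|^2) / c0 + 2) |lam k - z|^2]. *)
have p0 : 0 < (1 + 2 * csq z) / c0 + 2.
  by rewrite addr_gt0// divr_gt0// ltr_pwDl// mulr_ge0// csq_ge0.
exists ((1 + 2 * csq z) / c0 + 2)^-1; first by rewrite invr_gt0.
move=> k kz; rewrite ler_pdivrMl//.
have h1 : wt lam 1 k = 1 + csq (lam k).
  by rewrite /wt powRr1 ?cabs_sqr// addr_ge0// csq_ge0.
rewrite h1; have := csqD_le (lam k - z) z; rewrite subrK => h2.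
rewrite mulrDl; have := Hc0 k kz => h3.
have h4 : 1 + 2 * csq z <= (1 + 2 * csq z) / c0 * csq (lam k - z).
  by rewrite mulrAC ler_pdivlMr// ler_wpM2l// addr_ge0// mulr_ge0// csq_ge0.
lra.
Qed.

Variable l : R.
Definition lowb n := - l <= Re (lam n).

Lemma low_initial : exists N0, forall n, lowb n = (n < N0)%N.
Proof.
have [K HK] := Re_lam_lt (- l).
have ex : exists n, ~~ lowb n by exists K; rewrite /lowb -ltNge HK.
case: (ex_minnP ex) => N0 hN0 min; exists N0 => n.
apply/idP/idP => [ln|nN0]; last by apply/negPn/negP => /min; rewrite leqNgt nN0.
rewrite ltnNge; apply/negP => N0n; move: hN0; rewrite /lowb -ltNge => h.
case: lam_par => dec _ _; have := dec _ _ N0n => /=; move: ln; rewrite /lowb; lra.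
Qed.

(** * Operators that preserve eigenvalues up to finitely many low frequencies *)

Section operator.
Variable X : seqC -> seqC.
Hypothesis X_D : forall y, D (-1) y -> D (-1) (X y).
Hypothesis X_lin : forall a x y, D (-1) x -> D (-1) y -> X (a *: x + y) = a *: X x + X y.
Hypothesis X_local : forall n y, D (-1) y ->
  (forall k, y k != 0 -> ~~ lowb k /\ lam k <> lam n) -> X y n = 0.

Lemma blockD x y : D (-1) x -> D (-1) y -> X (x + y) = X x + X y.
Proof. by move=> xD yD; rewrite -[x]scale1r X_lin// !scale1r. Qed.

Lemma block0 : X 0 = 0.
Proof.
have := blockD (spaceD0 (-1)) (spaceD0 (-1)); rewrite addr0 => /eqP.
by rewrite -subr_eq0 opprD addrA subrr sub0r oppr_eq0 => /eqP.
Qed.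

Lemma blockZ a x : D (-1) x -> X (a *: x) = a *: X x.
Proof. by move=> xD; rewrite -[a *: x]addr0 X_lin ?block0 ?addr0//; exact: spaceD0. Qed.

Lemma blockB x y : D (-1) x -> D (-1) y -> X (x - y) = X x - X y.
Proof.
by move=> xD yD; rewrite -scaleN1r addrC X_lin// scaleN1r addrC.
Qed.

Lemma block_sum n (f : 'I_n -> seqC) : (forall i, D (-1) (f i)) ->
  X (\sum_(i < n) f i) = \sum_(i < n) X (f i).
Proof.
elim: n f => [|n IH] f fD; first by rewrite !big_ord0 block0.
by rewrite !big_ord_recr/= blockD ?IH//; exact: spaceD_sum.
Qed.

(** Beyond some index every frequency is high and has real part less than that of [lam n], so
    locality discards it. Finite rows are what allows [X] to pass through time integrals and
    limits. *)
Lemma block_row n : exists M, forall y, D (-1) y ->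
  X y n = \sum_(k < M) y k * X (unitseq k) n.
Proof.
have [K HK] := Re_lam_lt (Num.min (- l) (Re (lam n))).
exists K => y yD; have -> : y = (y - seqtrunc K y) + seqtrunc K y by rewrite subrK.
have tD : D (-1) (seqtrunc K y) by exact: spaceD_seqtrunc.
rewrite blockD//; last exact: spaceDB.
rewrite (_ : (_ + _) n = X (y - seqtrunc K y) n + X (seqtrunc K y) n)// X_local ?add0r; last 2 first.
- exact: spaceDB.
- move=> k; rewrite (_ : (_ - _) k = y k - seqtrunc K y k)// /seqtrunc.
  have [kK|Kk _] := ltnP k K; first by rewrite subrr eqxx.
  have := HK _ Kk; rewrite lt_min => /andP[h1 h2]; split; first by rewrite /lowb -ltNge.
  by move=> E; rewrite E ltxx in h2.
rewrite {1}seqtrunc_sum block_sum => [|i]; last by apply: spaceDZ; exact: spaceD_unitseq.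
rewrite fct_sumE; apply: eq_bigr => k _.
rewrite blockZ; last exact: spaceD_unitseq.
by rewrite subrK.
Qed.

Hypothesis X_D0 : forall y, D 0 y -> D 0 (X y).
Variable C : R.
Hypothesis X_bnd0 : forall y, D 0 y -> (sq 0 (X y) <= C%:E * sq 0 y)%E.

(** On such inputs [X] links only equal eigenvalues, and the weight is a function of the eigenvalue,
    so [X] commutes with [wmul] and the bound on D_0 transfers with the same constant. *)
Lemma block_high_bound r y : -1 <= r -> D r y -> (forall k, y k != 0 -> ~~ lowb k) ->
  (sq r (X y) <= C%:E * sq r y)%E.
Proof.
move=> r1 yr hy; have yD : D (-1) y by exact: spaceD_mono yr.
have wy0 : D 0 (wmul lam (r / 2) y).
  by rewrite /spaceD/= sq_wmul (_ : 0 + _ = r)//; field.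
have wyD : D (-1) (wmul lam (r / 2) y) by exact: spaceD_mono wy0.
have E : wmul lam (r / 2) (X y) = X (wmul lam (r / 2) y).
  apply/funext => n; set u := wmul lam _ y in wy0 wyD *.
  pose c : R[i] := (wt lam (r / 2) n)%:C%C.
  have cyD : D (-1) (c *: y) by exact: spaceDZ.
  have E1 : X (u - c *: y) = X u - c *: X y by rewrite (blockB wyD cyD) (blockZ c yD).
  (* Freezing the weight at index [n]: the difference vanishes wherever the eigenvalue is [lam n],
     so locality applies to it. *)
  have H : X (u - c *: y) n = 0.
    apply: X_local => [|k]; first exact: spaceDB.
    rewrite (_ : (u - c *: y) k = ((wt lam (r / 2) k)%:C%C - c) * y k); last first.
      by rewrite mulrBl.
    rewrite mulf_eq0 negb_or => /andP[wk yk]; split; first exact: hy.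
    by move=> lkn; move: wk; rewrite /c /wt lkn subrr eqxx.
  rewrite E1 in H; apply/esym/eqP; rewrite -subr_eq0; apply/eqP; exact: H.
have h0 z : sq r z = sq 0 (wmul lam (r / 2) z).
  by rewrite sq_wmul (_ : 0 + _ = r)//; field.
by rewrite !h0 E X_bnd0.
Qed.

Lemma sum_bound r N (v : nat -> seqC) : (forall k, (k < N)%N -> D r (v k)) ->
  exists2 C' : R, 0 <= C' & forall y : seqC, (sq r (\sum_(k < N) y k *: v k)%R <= C'%:E * sq r y)%E.
Proof.
elim: N => [|N IH] vD.
  by exists 0 => // y; rewrite big_ord0 sq0 mul0e.
have [k kN|C' C'0 HC'] := IH; first by apply: vD; exact: ltnW.
pose q := fine (sq r (v N)); have qE : sq r (v N) = q%:E.
  by rewrite /q fineK// ge0_fin_numE ?sq_ge0//; exact: vD.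
have q0 : 0 <= q by rewrite fine_ge0// sq_ge0.
exists (2 * C' + 2 * (q / wt lam r N)).
  by rewrite addr_ge0 ?mulr_ge0// invr_ge0 wt_ge0.
move=> y; rewrite big_ord_recr/=; apply: le_trans (sqDr _ _ _ _) _.
rewrite sqZ qE [in leRHS]EFinD [leRHS]ge0_muleDl ?lee_fin ?mulr_ge0 ?invr_ge0 ?wt_ge0//.
apply: leeD; first by rewrite EFinM -muleA; apply: lee_wpmul2l.
rewrite EFinM -muleA; apply: lee_wpmul2l => //.
have := sq_coord lam r y N; rewrite -EFinM; case: (sq r y) (sq_ge0 lam r y) => [t|_ _|//].
  rewrite -EFinM !lee_fin => t0 h; rewrite mulrC -mulrA ler_wpM2l//.
  by rewrite ler_pdivlMl ?wt_gt0.
(* Here [y] has infinite norm: either the coefficient [q] is zero and so is the left side, or the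
   right side is infinite. *)
have [->|qn0] := eqVneq q 0; first by rewrite mul0r mul0e mulr0.
by rewrite gt0_muley ?leey// lte_fin divr_gt0 ?wt_gt0// lt_def qn0.
Qed.

Hypothesis C_ge0 : 0 <= C.

(** Split off the low frequencies: the rest keeps the bound on D_0, and the finite-rank part only
    needs its columns in D_r. The regularity of these columns is thus what limits [r] from above. *)
Lemma block_bound r : -1 <= r -> (forall k, lowb k -> D r (X (unitseq k))) ->
  exists2 C' : R, 0 <= C' & forall y, D r y -> (sq r (X y) <= C'%:E * sq r y)%E.
Proof.
move=> r1 XD; have [N0 HN0] := low_initial.
have [k kN|C1 C10 HC1] := @sum_bound r N0 (fun k => X (unitseq k)).
  by apply: XD; rewrite HN0.
exists (2 * C1 + 2 * C); first by rewrite addr_ge0// mulr_ge0.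
move=> y yr; have yD : D (-1) y by exact: spaceD_mono yr.
pose h := y - seqtrunc N0 y.
have tr : D r (seqtrunc N0 y) by exact: spaceD_seqtrunc.
have hr : D r h by exact: spaceDB.
have hle n : csq (h n) <= csq (y n).
  rewrite (_ : h n = y n - seqtrunc N0 y n)// /seqtrunc.
  by case: ifP => _; rewrite ?subrr ?subr0// csq0 csq_ge0.
have -> : X y = \sum_(k < N0) y k *: X (unitseq k) + X h.
  rewrite -[y in LHS](subrK (seqtrunc N0 y)) -/h addrC blockD; last 2 first.
  - exact: spaceD_mono tr.
  - exact: spaceD_mono hr.
  rewrite seqtrunc_sum block_sum => [|i]; last by apply: spaceDZ; exact: spaceD_unitseq.
  by congr (_ + _); apply: eq_bigr => k _; rewrite blockZ//; exact: spaceD_unitseq.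
apply: le_trans (sqDr _ _ _ _) _.
rewrite [in leRHS]EFinD [leRHS]ge0_muleDl ?lee_fin ?mulr_ge0//; apply: leeD.
  by rewrite EFinM -muleA; apply: lee_wpmul2l.
rewrite EFinM -muleA; apply: lee_wpmul2l => //.
apply: le_trans (block_high_bound r1 hr _) _.
  move=> k; rewrite (_ : h k = y k - seqtrunc N0 y k)// /seqtrunc HN0.
  by case: ifP => // _; rewrite subrr eqxx.
by apply: lee_wpmul2l => //; exact: sq_le.
Qed.

End operator.
End block.

(** * Locality and regularity of a parabolic F-equivalence and of its inverse *)

Section equivalence.
Variables (R : realType) (H : hilbertType R) (A : diagParabolic H).
Variables (l mu : R) (m : nat) (B : 'I_m -> nat -> R[i]).
Variables (T : (nat -> R[i]) -> nat -> R[i]) (K : {linear H -> 'rV[R[i]]_m}).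
Local Notation lam := (eigval A).
Local Notation e := (eigvec A).
Local Notation seqC := (nat -> R[i]).
Local Notation Re := complex.Re.
Local Notation D := (spaceD lam).
Local Notation sq := (sqnormD lam).
Local Notation low := (lowb lam l).
Local Notation S := (opinv A T).
Implicit Types (x y : seqC).

Hypothesis B_D : forall j, D (-1) (B j).
Hypothesis Feq : F_equivalence A l B (op_mu A l mu) T K.
Hypothesis mu_generic : forall n k, lam k <> lam n - (mu%:C)%C.

Let lam_par := eigval_parabolic A.

Definition eigval_mu n : R[i] := lam n - (if low n then (mu%:C)%C else 0).
Local Notation dd := eigval_mu.

Lemma op_muE x : op_mu A l mu x = fun n => dd n * x n.
Proof.
apply/funext => n; rewrite /op_mu /A_L /A_H /op /P_L /P_H /eigval_mu /lowb.
rewrite (_ : (_ + _) n = lam n * (if - l <= Re (lam n) then if - l <= Re (lam n) then x n else 0 else 0)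
  - (mu%:C)%C * (if - l <= Re (lam n) then x n else 0) +
  lam n * (if Re (lam n) < - l then if Re (lam n) < - l then x n else 0 else 0))//.
rewrite ltNge; case E: (- l <= Re (lam n)).
  by rewrite /= mulr0 addr0 mulrBl.
by rewrite /= !mulr0 subr0 add0r subr0.
Qed.

Let TD : L_H A T. Proof. by case: Feq => -[]. Qed.
Let SD : L_H A S. Proof. by case: Feq => -[]. Qed.

Lemma T_Dm y : D (-1) y -> D (-1) (T y). Proof. by case: TD => -[+ _ _] _; apply. Qed.
Lemma S_Dm y : D (-1) y -> D (-1) (S y). Proof. by case: SD => -[+ _ _] _; apply. Qed.
Lemma T_D0 y : D 0 y -> D 0 (T y). Proof. by case: TD => _ [+ _ _]; apply. Qed.
Lemma S_D0 y : D 0 y -> D 0 (S y). Proof. by case: SD => _ [+ _ _]; apply. Qed.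
Lemma T_lin a x y : D (-1) x -> D (-1) y -> T (a *: x + y) = a *: T x + T y.
Proof. by case: TD => -[_ + _] _; apply. Qed.
Lemma S_lin a x y : D (-1) x -> D (-1) y -> S (a *: x + y) = a *: S x + S y.
Proof. by case: SD => -[_ + _] _; apply. Qed.

Lemma TSK y : D (-1) y -> T (S y) = y.
Proof.
case: Feq => -[_ bT _ _] _ _ _ _ yD; have [x xD Txy] := @set_bij_surj _ _ _ _ _ bT y yD.
by rewrite /opinv; case: xgetP => [z _ [_ ->]//|/(_ x) []].
Qed.

Lemma STK x : D (-1) x -> S (T x) = x.
Proof.
move=> xD; case: Feq => -[_ bT _ _] _ _ _ _.
apply: (set_bij_inj bT); rewrite ?inE.
- exact/S_Dm/T_Dm.
- exact: xD.
- by rewrite TSK//; exact: T_Dm.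
Qed.

Lemma D0m y : D 0 y -> D (-1) y.
Proof. by apply: spaceD_mono; rewrite lerN10. Qed.

Lemma op_D y : D 0 y -> D (-1) (op A y).
Proof.
apply: le_lt_trans; rewrite !sqnormDE; apply: lee_nneseries => n _.
  by rewrite lee_fin sqterm_ge0.
rewrite lee_fin /op csqM wt0 mul1r mulrA ler_piMl ?csq_ge0//.
rewrite wtN ler_pdivrMl ?wt_gt0// mulr1 /wt powRr1 ?cabs_sqr ?lerDr//.
by rewrite addr_ge0// csq_ge0.
Qed.

Lemma input_D z : D (-1) (input B z).
Proof. by apply: spaceD_sum => j; exact: spaceDZ. Qed.

Lemma input0 : input B 0 = 0.
Proof. by rewrite /input big1// => j _; rewrite mxE scale0r. Qed.

Lemma T_eq (x : H) : T (op A (hcoord A x) + input B (K x)) = fun n => dd n * T (hcoord A x) n.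
Proof. by case: Feq => _ _ /(_ x) -> _ _; rewrite op_muE. Qed.

Lemma K_high (x : H) : (forall n, low n -> hcoord A x n = 0) -> K x = 0.
Proof.
move=> x0; case: Feq => _ _ _ _; apply; apply: in_closed_span.
  by have [k Hk] := Re_lam_lt lam_par (- l); exists k; exact: Hk.
by move=> n /= /negP; rewrite -leNgt; exact: x0.
Qed.

(** The resolvent gains one order. Where [lam k = z] the coefficient [y k] is zero, so the division
    by zero there returns the wanted value 0. *)
Lemma resolvent_D0 (z : R[i]) y : D (-1) y -> (forall k, y k != 0 -> lam k <> z) ->
  D 0 (fun k => y k / (lam k - z)).
Proof.
move=> yD yz; have [c c0 Hc] := lam_shift_lbound lam_par z.
apply: (@le_lt_trans _ _ ((c^-1)%:E * sq (-1) y)%E); last first.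
  by rewrite lte_mul_pinfty// lee_fin invr_ge0 ltW.
rewrite !sqnormDE -nneseriesZl; last by move=> n _; rewrite lee_fin sqterm_ge0.
apply: lee_nneseries => n _; first by rewrite lee_fin mulr_ge0 ?wt_ge0 ?csq_ge0.
rewrite -EFinM lee_fin wt0 mul1r wtN.
have [->|yn] := eqVneq (y n) 0; first by rewrite mul0r csq0 !mulr0.
have ln : lam n != z by apply/eqP; exact: yz.
have q0 : 0 < csq (lam n - z) by apply: lt_le_trans (Hc n ln); rewrite mulr_gt0 ?wt_gt0.
have -> : csq (y n / (lam n - z)) = csq (y n) / csq (lam n - z).
  by apply: (mulIf (lt0r_neq0 q0)); rewrite mulfVK ?gt_eqF// -csqM mulfVK// subr_eq0.
rewrite mulrA -invfM mulrC ler_wpM2r ?csq_ge0// lef_pV2 ?posrE ?mulr_gt0 ?wt_gt0//.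
exact: Hc.
Qed.

(** Write [y = (A - d_n) x] with [x] of high frequency, so that [K x = 0] and [T A x = D_mu T x];
    then coordinate [n] of [T y] is [(d_n - d_n) (T x)_n]. *)
Lemma T_local n y : D (-1) y ->
  (forall k, y k != 0 -> ~~ low k /\ lam k <> lam n) -> T y n = 0.
Proof.
move=> yD hy.
(* For low [n] the value [dd n] is [lam n - mu], excluded by the choice of [mu]; for high [n] it is
   [lam n], excluded by the support of [y]. *)
have yd k : y k != 0 -> lam k <> dd n.
  by move=> /hy[_ kn]; rewrite /eigval_mu; case: ifP => _; [exact: mu_generic|rewrite subr0].
pose x : seqC := fun k => y k / (lam k - dd n).
have xD : D 0 x by exact: resolvent_D0.
have Kx : K (toH A x) = 0.
  apply: K_high => k lk; rewrite toHK// /x.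
  have [->|/hy []] := eqVneq (y k) 0; first by rewrite mul0r.
  by rewrite lk.
have yE : y = op A x - dd n *: x.
  apply/funext => k; rewrite (_ : (_ - _) k = (lam k - dd n) * x k); last by rewrite mulrBl.
  rewrite /x; have [->|/yd yk] := eqVneq (y k) 0; first by rewrite mul0r mulr0.
  by rewrite mulrCA mulfV ?mulr1// subr_eq0; exact/eqP.
have := T_eq (toH A x); rewrite Kx input0 addr0 toHK// => TE.
rewrite yE (blockB T_lin) ?(blockZ T_lin)//; last 3 first.
- exact: D0m.
- exact: op_D.
- by apply: spaceDZ; exact: D0m.
rewrite TE (_ : (_ - _) n = dd n * T x n - dd n * T x n)//; exact: subrr.
Qed.

Lemma S_eq x : D 0 x ->
  S (fun n => dd n * x n) = op A (S x) + input B (K (toH A (S x))).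
Proof.
move=> xD; have := T_eq (toH A (S x)).
rewrite toHK; last exact: S_D0.
rewrite TSK; last exact: D0m.
move=> <-; rewrite STK//; apply: spaceDD; last exact: input_D.
exact/op_D/S_D0.
Qed.

(** A high eigenvalue never equals [lam n] for a low [n], so locality leaves only the low
    coordinates. Naming the cut-off through [cid] makes one number serve for all [y] and [n]. *)
Lemma T_unitseq_low y n : D (-1) y -> low n ->
  T y n = T (seqtrunc (sval (cid (low_initial lam_par l))) y) n.
Proof.
case: cid => N0 HN0 /= yD ln.
have tD : D (-1) (seqtrunc N0 y) by exact: spaceD_seqtrunc.
rewrite -[y in LHS](subrK (seqtrunc N0 y)) (blockD T_lin)//; last exact: spaceDB.
rewrite (_ : (_ + _) n = T (y - seqtrunc N0 y) n + T (seqtrunc N0 y) n)//.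
rewrite T_local ?add0r//; first exact: spaceDB.
move=> k; rewrite (_ : (_ - _) k = y k - seqtrunc N0 y k)// /seqtrunc -HN0.
case: ifPn => lk; first by rewrite subrr eqxx.
by move=> _; split=> // E; move: ln lk; rewrite /lowb E => ->.
Qed.

(* The low-frequency block of T is a square matrix with a left inverse, the
   low-frequency block of its inverse, hence it is injective. *)
Lemma S_low n v : D (-1) v -> (forall k, low k -> v k = 0) -> low n -> S v n = 0.
Proof.
move=> vD v0; have := T_unitseq_low; case: cid => N0 HN0 /= Tlow.
pose M := \matrix_(i < N0, j < N0) T (unitseq R i) j.
pose X := \matrix_(i < N0, j < N0) S (unitseq R i) j.
have Trow y (j : 'I_N0) : D (-1) y -> T y j = \sum_(k < N0) y k * T (unitseq R k) j.
  move=> yD; rewrite Tlow ?HN0// seqtrunc_sum (block_sum T_lin); last first.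
    by move=> i; apply: spaceDZ; exact: spaceD_unitseq.
  rewrite fct_sumE; apply: eq_bigr => k _.
  by rewrite (blockZ T_lin)//; exact: spaceD_unitseq.
have XM : X *m M = 1%:M.
  apply/matrixP => i j; rewrite !mxE.
  under eq_bigr do rewrite !mxE.
  rewrite -Trow; last by apply: S_Dm; exact: spaceD_unitseq.
  rewrite TSK; last exact: spaceD_unitseq.
  by rewrite /unitseq eq_sym.
have MX := mulmx1C XM.
have y0 : (\row_(k < N0) S v k) *m M = 0.
  apply/rowP => j; rewrite !mxE; under eq_bigr do rewrite !mxE.
  rewrite -Trow; last exact: S_Dm.
  by rewrite TSK// v0// HN0.
rewrite HN0 => nN0; have : \row_(k < N0) S v k = 0.
  by rewrite -[LHS]mulmx1 -MX mulmxA y0 mul0mx.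
by move=> /rowP /(_ (Ordinal nN0)); rewrite !mxE.
Qed.

(** The argument for [T] is mirrored with [v = (D_mu - lam n) x], but the feedback term is now
    [K (S x)]. It vanishes because [S x] has no low coordinates, which is why the low block is
    treated before. *)
Lemma S_local n v : D (-1) v ->
  (forall k, v k != 0 -> ~~ low k /\ lam k <> lam n) -> S v n = 0.
Proof.
move=> vD hv.
have vlow k : low k -> v k = 0.
  by move=> lk; apply/eqP/negPn/negP => /hv []; rewrite lk.
have [ln|nln] := boolP (low n); first exact: S_low.
pose x : seqC := fun k => v k / (lam k - lam n).
have xD : D 0 x by apply: resolvent_D0 => // k /hv[].
have xlow k : low k -> x k = 0 by move=> lk; rewrite /x vlow// mul0r.
have vE : v = (fun k => dd k * x k) - lam n *: x.
  apply/funext => k; rewrite (_ : (_ - _) k = (dd k - lam n) * x k); last by rewrite mulrBl.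
  have [vk|vk] := eqVneq (v k) 0; first by rewrite /x vk mul0r mulr0.
  have [nlk lkn] := hv _ vk.
  by rewrite /x /eigval_mu (negPf nlk) subr0 mulrCA mulfV ?mulr1// subr_eq0; exact/eqP.
have Kx : K (toH A (S x)) = 0.
  apply: K_high => k lk; rewrite toHK; last exact: S_D0.
  by apply: S_low => //; exact: D0m.
have dxD : D (-1) (fun k => dd k * x k).
  have -> : (fun k => dd k * x k) = v + lam n *: x by rewrite {1}vE subrK.
  exact: (spaceDD vD (spaceDZ _ (D0m xD))).
have lxD : D (-1) (lam n *: x) by apply: spaceDZ; exact: D0m.
rewrite vE (blockB S_lin dxD lxD) (blockZ S_lin _ (D0m xD)) S_eq// Kx input0 addr0.
rewrite (_ : (_ - _) n = lam n * S x n - lam n * S x n)//; exact: subrr.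
Qed.

Lemma opnorm_ub (X : seqC -> seqC) z : bounded_linear_on A 0 X -> D 0 z ->
  normD lam 0 z <= 1 -> normD lam 0 (X z) <= opnorm_H A X.
Proof.
move=> [XD Xlin [M HM]] zD z1; apply: ub_le_sup; last by exists z.
exists `|M| => _ [y [yD y1] <-]; apply: le_trans (HM y yD) _.
by rewrite (le_trans (ler_norm _))// normrM ler_piMr// ger0_norm ?normD_ge0.
Qed.

Lemma opnorm_bound (X : seqC -> seqC) : bounded_linear_on A 0 X ->
  forall y, D 0 y -> normD lam 0 (X y) <= opnorm_H A X * normD lam 0 y.
Proof.
move=> bX y yD; have [XD Xlin [M HM]] := bX.
have [y0|y0] := eqVneq (normD lam 0 y) 0.
  by apply: le_trans (HM y yD) _; rewrite /normD_ y0 !mulr0.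
have yp : 0 < normD lam 0 y by rewrite lt_def y0 normD_ge0.
pose a : R[i] := ((normD lam 0 y)^-1%:C)%C.
have nZ (z : seqC) : D 0 z -> normD lam 0 (a *: z) = (normD lam 0 y)^-1 * normD lam 0 z.
  move=> zD; have := normD_sqr (spaceDZ a zD).
  rewrite sqZ -(normD_sqr zD) -EFinM csq_real -exprMn => -[E].
  by apply/eqP; rewrite -(@eqrXn2 _ 2)// ?mulr_ge0 ?invr_ge0 ?normD_ge0// E.
have X0 : X 0 = 0.
  have := Xlin 1 0 0 (spaceD0 lam 0) (spaceD0 lam 0); rewrite scaler0 addr0 scale1r.
  by move=> /eqP; rewrite -subr_eq0 opprD addrA subrr sub0r oppr_eq0 => /eqP.
have aX : X (a *: y) = a *: X y.
  by rewrite -[a *: y]addr0 Xlin ?X0 ?addr0//; exact: spaceD0.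
have : (normD lam 0 y)^-1 * normD lam 0 (X y) <= opnorm_H A X.
  rewrite -nZ; last exact: XD.
  by rewrite -aX; apply: opnorm_ub => //; [exact: spaceDZ|rewrite nZ// mulVf].
by rewrite ler_pdivrMl// mulrC.
Qed.

Lemma opnorm_ge0 X : bounded_linear_on A 0 X -> 0 <= opnorm_H A X.
Proof.
move=> bX; apply: (le_trans (normD_ge0 lam 0 (X 0))); apply: opnorm_ub => //.
  exact: spaceD0.
by rewrite /normD sq0 sqrtr0.
Qed.

Lemma opnorm_sq (X : seqC -> seqC) : bounded_linear_on A 0 X ->
  forall y, D 0 y -> (sq 0 (X y) <= (opnorm_H A X ^+ 2)%:E * sq 0 y)%E.
Proof.
move=> bX y yD; have XyD : D 0 (X y) by case: bX => + _ _; apply.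
rewrite -(normD_sqr XyD) -(normD_sqr yD) -EFinM lee_fin -exprMn.
by rewrite ler_pXn2r ?nnegrE ?normD_ge0 ?mulr_ge0 ?normD_ge0 ?opnorm_ge0 ?opnorm_bound.
Qed.

Lemma T_sq0 y : D 0 y -> (sq 0 (T y) <= (opnorm_H A T ^+ 2)%:E * sq 0 y)%E.
Proof. by case: TD => _ bT; exact: opnorm_sq. Qed.

Lemma S_sq0 y : D 0 y -> (sq 0 (S y) <= (opnorm_H A S ^+ 2)%:E * sq 0 y)%E.
Proof. by case: SD => _ bS; exact: opnorm_sq. Qed.

Lemma T_row n : exists M, forall y, D (-1) y ->
  T y n = \sum_(k < M) y k * T (unitseq R k) n.
Proof. by apply: (block_row lam_par (l := l)) => //; [exact: T_lin|exact: T_local]. Qed.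

Lemma S_row n : exists M, forall y, D (-1) y ->
  S y n = \sum_(k < M) y k * S (unitseq R k) n.
Proof. by apply: (block_row lam_par (l := l)) => //; [exact: S_lin|exact: S_local]. Qed.

(** The columns of [T] are taken in H, whence the restriction [r <= 0]. *)
Lemma T_bound r : -1 <= r -> r <= 0 ->
  exists2 C : R, 0 <= C & forall y, D r y -> (sq r (T y) <= C%:E * sq r y)%E.
Proof.
move=> r1 r0; apply: (block_bound lam_par (l := l) T_lin T_local T_sq0) => //.
  exact: sqr_ge0.
by move=> k _; apply: spaceD_mono r0 _; apply: T_D0; exact: spaceD_unitseq.
Qed.

(** The column [v] solves [(d_k - A) v = B K v] with right-hand side in D_(-s). Since
    [d_k = lam k - mu] is not an eigenvalue of [A], solving gains one order. *)
Lemma S_unitseq_low (s : R) k : (forall j, D (- s) (B j)) -> low k ->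
  D (1 - s) (S (unitseq R k)).
Proof.
move=> Bs lk; set v := S (unitseq R k).
have uD : D 0 (unitseq R k) by exact: spaceD_unitseq.
pose b := input B (K (toH A v)).
have bs : D (- s) b by apply: spaceD_sum => j; exact: spaceDZ.
have E n : b n = (dd k - lam n) * v n.
  have := S_eq uD; rewrite (_ : (fun n => dd n * unitseq R k n) = dd k *: unitseq R k); last first.
    apply/funext => j; rewrite (_ : (_ *: _) j = dd k * unitseq R k j)// /unitseq.
    by case: eqP => [->//|_]; rewrite !mulr0.
  rewrite (blockZ S_lin); last exact: D0m.
  move=> /(congr1 (fun f => f n)); rewrite -/v -/b.
  rewrite (_ : (_ + _) n = lam n * v n + b n)// (_ : (_ *: _) n = dd k * v n)// => h.
  by rewrite mulrBl h addrAC subrr add0r.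
have [c c0 Hc] := lam_shift_lbound lam_par (dd k).
apply: (@le_lt_trans _ _ ((c^-1)%:E * sq (- s) b)%E); last first.
  by rewrite lte_mul_pinfty// lee_fin invr_ge0 ltW.
rewrite !sqnormDE -nneseriesZl; last by move=> n _; rewrite lee_fin sqterm_ge0.
apply: lee_nneseries => n _; first by rewrite lee_fin sqterm_ge0.
rewrite -EFinM lee_fin E csqM ler_pdivlMl// addrC wtD.
rewrite -(csqN (dd k - lam n)) opprB.
have := Hc n _; rewrite /eigval_mu lk => /(_ _) h.
have ne : lam n != lam k - (mu%:C)%C by apply/eqP; exact: mu_generic.
have {}h := h ne.
have := ler_wpM2l (mulr_ge0 (wt_ge0 lam (- s) n) (csq_ge0 (v n))) h; lra.
Qed.

Lemma S_bound r s : (forall j, D (- s) (B j)) -> 0 <= r <= 1 - s ->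
  exists2 C : R, 0 <= C & forall y, D r y -> (sq r (S y) <= C%:E * sq r y)%E.
Proof.
move=> Bs /andP[r0 rs].
apply: (block_bound lam_par (l := l) S_lin S_local S_sq0) => //.
- exact: sqr_ge0.
- by rewrite (le_trans _ r0)// lerN10.
- by move=> k lk; apply: spaceD_mono rs _; exact: S_unitseq_low.
Qed.

(** Turns the feedback into a finite combination of coordinates, continuous in time along any curve
    with continuous coordinates. *)
Lemma K_low : exists N0, forall x : H, K x = \sum_(k < N0) hcoord A x k *: K (e k).
Proof.
have [N0 HN0] := low_initial lam_par l; exists N0 => x.
apply/eqP; rewrite -subr_eq0.
rewrite (_ : \sum_(k < N0) hcoord A x k *: K (e k) = K (fourier A N0 (hcoord A x))); last first.
  by rewrite /fourier linear_sum; apply: eq_bigr => k _; rewrite linearZ.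
rewrite -raddfB; apply/eqP/K_high => n ln; rewrite hcoordB hcoord_fourier.
by rewrite (_ : (_ - _) n = hcoord A x n - seqtrunc N0 (hcoord A x) n)// /seqtrunc -HN0 ln subrr.
Qed.

End equivalence.

(** * Small solutions of diagonal semilinear equations *)

Section fatou.
Variables (R : realType) (lam : nat -> R[i]).
Local Notation Re := complex.Re.
Local Notation Im := complex.Im.
Local Notation seqC := (nat -> R[i]).
Local Notation sq := (sqnormD lam).

Lemma cvg_le_bound (f : nat -> R) (z q : R) : f k @[k --> \oo] --> z ->
  (forall k, f k <= q) -> z <= q.
Proof.
move=> fz fq; rewrite -(cvg_lim (@Rhausdorff R) fz).
by apply: limr_le; [apply/cvg_ex; exists z|near=> k].
Unshelve. all: by end_near. Qed.

Lemma cvg_sum_ord (U : Type) (F : set_system U) (FF : ProperFilter F) N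
    (f : nat -> U -> R) (z : nat -> R) :
  (forall n, f n x @[x --> F] --> z n) ->
  \sum_(n < N) f n x @[x --> F] --> \sum_(n < N) z n.
Proof.
move=> fz; elim: N => [|N IH].
  by rewrite big_ord0; under eq_fun do rewrite big_ord0; exact: cvg_cst.
by rewrite big_ord_recr/=; under eq_fun do rewrite big_ord_recr/=; exact: cvgD.
Qed.

Definition ccvg (u : nat -> R[i]) (z : R[i]) : Prop :=
  Re (u k) @[k --> \oo] --> Re z /\ Im (u k) @[k --> \oo] --> Im z.

Lemma ccvg_csq (u : nat -> R[i]) (z : R[i]) : ccvg u z -> csq (u k) @[k --> \oo] --> csq z.
Proof. by move=> [u1 u2]; apply: cvgD; rewrite /exprz; apply: cvgM. Qed.

Lemma ccvgB (u v : nat -> R[i]) (z w : R[i]) : ccvg u z -> ccvg v w ->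
  ccvg (fun k => u k - v k) (z - w).
Proof.
move=> [u1 u2] [v1 v2]; split; rewrite !cpartE.
  by under eq_fun do rewrite !cpartE; exact: cvgB.
by under eq_fun do rewrite !cpartE; exact: cvgB.
Qed.

Lemma ccvg_cst (z : R[i]) : ccvg (fun=> z) z.
Proof. by split; exact: cvg_cst. Qed.

Lemma ccvg_shift (u : nat -> R[i]) z i : ccvg u z -> ccvg (fun k => u (k + i)%N) z.
Proof.
by move=> [u1 u2]; split;
  [exact: (cvg_comp (addn^~ i) (fun k => Re (u k)) (cvg_addnr i) u1)
  |exact: (cvg_comp (addn^~ i) (fun k => Im (u k)) (cvg_addnr i) u2)].
Qed.

Lemma ccvg_unique (u : nat -> R[i]) z w : ccvg u z -> ccvg u w -> z = w.
Proof. by move=> [u1 u2] [w1 w2]; apply: ceqP; [exact: cvg_unique u1 w1|exact: cvg_unique u2 w2]. Qed.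

Lemma ccvg_csq_small (u : nat -> R[i]) z (q : nat -> R) : q k @[k --> \oo] --> (0 : R) ->
  (forall k, csq (z - u k) <= q k) -> ccvg u z.
Proof.
move=> q0 uq.
have B k : (Re z - Re (u k)) ^+ 2 <= q k /\ (Im z - Im (u k)) ^+ 2 <= q k.
  have := uq k; rewrite /csq !cpartE => h.
  by split; apply: le_trans h; rewrite ?lerDl ?lerDr sqr_ge0.
split; apply/cvgrPdist_lt => eps eps0;
  (have /cvgrPdist_lt /(_ (eps ^+ 2)) := q0; rewrite exprn_gt0// => /(_ isT));
  apply: filterS => k; rewrite sub0r normrN => qk;
  rewrite -(@ltr_pXn2r _ 2)// ?nnegrE ?(ltW eps0)// real_normK ?num_real//;
  by apply: le_lt_trans (le_lt_trans (ler_norm _) qk); case: (B k).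
Qed.

(** Distances are squared throughout, so the ratio 1/4 stands for a contraction factor 1/2. *)
Lemma csq_geometric_cvg (u : nat -> R[i]) (a : R) : 0 <= a ->
  (forall k i, csq (u (k + i)%N - u k) <= a * (4^-1) ^+ k) ->
  exists z, ccvg u z /\ forall k, csq (z - u k) <= a * (4^-1) ^+ k.
Proof.
move=> a0 ua.
have q0 : a * (4^-1) ^+ k @[k --> \oo] --> (0 : R).
  rewrite -[X in _ --> X](mulr0 a); apply: cvgMr; apply: cvg_expr.
  by rewrite ger0_norm ?invr_ge0// invf_lt1// ltr1n.
have C (f : R[i] -> R) : (forall x y, (f x - f y) ^+ 2 <= csq (x - y)) ->
    cvg (f (u k) @[k --> \oo]).
  move=> fl; apply: cauchy_cvg; apply: cauchy_exP => eps eps0.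
  have /cvgrPdist_lt /(_ (eps ^+ 2)) := q0; rewrite exprn_gt0// => /(_ isT) [K _ HK].
  exists (f (u K)); exists K => // k /= Kk; rewrite -ball_normE /=.
  rewrite -(@ltr_pXn2r _ 2)// ?nnegrE ?(ltW eps0)// real_normK ?num_real//.
  have := HK K (leqnn K); rewrite /= sub0r normrN => /(le_lt_trans (ler_norm _)).
  apply: le_lt_trans; apply: le_trans (ua K (k - K)%N); rewrite subnKC//.
  by rewrite -(sqrrN (f (u K) - _)) opprB; exact: fl.
have c1 : cvg (Re (u k) @[k --> \oo]).
  by apply: C => x y; rewrite /csq !cpartE lerDl sqr_ge0.
have c2 : cvg (Im (u k) @[k --> \oo]).
  by apply: C => x y; rewrite /csq !cpartE lerDr sqr_ge0.
exists (Complex (lim (Re (u k) @[k --> \oo])) (lim (Im (u k) @[k --> \oo]))).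
have cu : ccvg u (Complex (lim (Re (u k) @[k --> \oo])) (lim (Im (u k) @[k --> \oo]))).
  by split.
split=> // k; have cB := ccvg_csq (ccvgB (ccvg_shift k cu) (ccvg_cst (u k))).
by apply: (cvg_le_bound cB) => j; rewrite addnC; exact: ua.
Qed.

Lemma sq_liminf r (y : nat -> seqC) (z : seqC) (q : R) :
  (forall n, ccvg (y^~ n) (z n)) -> (forall j, (sq r (y j) <= q%:E)%E) ->
  (sq r z <= q%:E)%E.
Proof.
move=> yz yq; apply: sq_leP => N.
have : \sum_(n < N) wt lam r n * csq (y j n) @[j --> \oo] --> \sum_(n < N) wt lam r n * csq (z n).
  apply: (@cvg_sum_ord _ _ _ N (fun n j => wt lam r n * csq (y j n)) (fun n => wt lam r n * csq (z n))) => n.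
  by apply: cvgMr; exact: ccvg_csq (yz n).
move=> /cvg_le_bound; apply=> j.
by rewrite -lee_fin; apply: le_trans (sq_partial _ _ _ _) _.
Qed.

(** Coordinatewise convergence yields pointwise convergence of finite sums only, so Fatou's lemma is
    applied to those before the sum over all coordinates is taken. *)
Lemma wint_liminf l r T (y : nat -> R -> seqC) (z : R -> seqC) (q : R) :
  (forall j n, cmeas `[0, T] (fun s => y j s n)) -> (forall n, cmeas `[0, T] (z^~ n)) ->
  (forall s, 0 <= s <= T -> forall n, ccvg (fun j => y j s n) (z s n)) ->
  (forall j, (wint lam l r T (y j) <= q%:E)%E) ->
  (wint lam l r T z <= q%:E)%E.
Proof.
move=> my mz yz yq; rewrite wintE//.
apply: lime_le.
  apply: is_cvg_nneseries => n _ _; rewrite mule_ge0 ?lee_fin ?wt_ge0//.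
  by apply: integral_ge0 => s _; rewrite lee_fin mulr_ge0 ?expR_ge0 ?csq_ge0.
near=> N; rewrite big_mkord.
pose h (f : R -> seqC) s := (\sum_(n < N) ((wt lam r n)%:E * (expR (2 * l * s) * csq (f s n))%:E))%E.
have mterm (f : R -> seqC) : (forall n, cmeas `[0, T] (f^~ n)) -> forall n,
    measurable_fun (`[0, T]%classic : set R) (fun s => (expR (2 * l * s) * csq (f s n))%:E).
  move=> mf n; apply/measurable_EFinP; apply: measurable_funM;
    [exact: expR_lin_meas|exact: cmeas_csq].
have h0 f s : (0 <= h f s)%E.
  by apply: sume_ge0 => n _; rewrite mule_ge0 ?lee_fin ?wt_ge0// mulr_ge0 ?expR_ge0 ?csq_ge0.
have hint f : (forall n, cmeas `[0, T] (f^~ n)) -> (\int[leb]_(s in `[0%R, T]) h f s =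
   \sum_(n < N) ((wt lam r n)%:E * \int[leb]_(s in `[0%R, T]) (expR (2 * l * s) * csq (f s n))%:E))%E.
  move=> mf; rewrite ge0_integral_sum//.
  - apply: eq_bigr => n _; rewrite ge0_integralZl_EFin ?wt_ge0//; last exact: mterm.
    by move=> s _; rewrite lee_fin mulr_ge0 ?expR_ge0 ?csq_ge0.
  - by move=> n; apply: measurable_funeM; exact: mterm.
  - by move=> n s _; rewrite -EFinM lee_fin mulr_ge0 ?wt_ge0// mulr_ge0 ?expR_ge0 ?csq_ge0.
have mh f : (forall n, cmeas `[0, T] (f^~ n)) -> measurable_fun (`[0, T]%classic : set R) (h f).
  by move=> mf; apply: emeasurable_sum => n; apply: measurable_funeM; exact: mterm.
rewrite -hint//.
have hq j : (\int[leb]_(s in `[0%R, T]) h (y j) s <= q%:E)%E.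
  apply: le_trans (yq j); rewrite hint; last exact: my.
  rewrite wintE; last exact: my.
  rewrite -(big_mkord xpredT (fun n => (wt lam r n)%:E * \int[leb]_(s in `[0%R, T]) (expR (2 * l * s) * csq (y j s n))%:E)%E).
  apply: nneseries_lim_ge => n _ _; rewrite mule_ge0 ?lee_fin ?wt_ge0//.
  by apply: integral_ge0 => s _; rewrite lee_fin mulr_ge0 ?expR_ge0 ?csq_ge0.
have cvh s : 0 <= s <= T -> h (y j) s @[j --> \oo] --> h z s.
  move=> sT.
  have hE f : h f s = (\sum_(n < N) wt lam r n * (expR (2 * l * s) * csq (f s n)))%:E.
    by rewrite /h -sumEFin; apply: eq_bigr => n _.
  rewrite hE; under eq_fun do rewrite hE; apply: cvg_EFin; first by near=> j.
  apply: (@cvg_sum_ord _ _ _ N (fun n j => wt lam r n * (expR (2 * l * s) * csq (y j s n)))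
    (fun n => wt lam r n * (expR (2 * l * s) * csq (z s n)))) => n.
  by apply: cvgMr; apply: cvgMr; apply: ccvg_csq; exact: yz.
apply: (@le_trans _ _ (\int[leb]_(s in `[0%R, T]) limn_einf (fun j => h (y j) s))%E).
  rewrite le_eqVlt; apply/orP; left; apply/eqP; apply: eq_integral => s.
  rewrite inE/= in_itv/= => sT; apply/esym.
  by rewrite (cvg_limn_einf_sup (cvh s sT)).
have mhy j : measurable_fun (`[0, T]%classic : set R) (h (y j)) by apply: mh; exact: my.
apply: le_trans (fatou leb _ mhy _) _ => //.
rewrite limn_einf_lim; apply: lime_le; first exact: is_cvg_einfs.
near=> k; apply: le_trans (hq k).
by apply: ereal_inf_lbound; exists k => /=.
Unshelve. all: by end_near. Qed.

End fatou.

Lemma ccont_csq_sum (R : realType) (T : R) (u : R -> nat -> R[i]) (a : nat -> R) N t :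
  (forall n, ccont `[0, T] (u^~ n)) -> `[0, T]%classic t ->
  \sum_(n < N) a n * csq (u t n - u s n) @[s --> within `[0, T]%classic (nbhs t)] --> (0 : R).
Proof.
move=> cu tT; rewrite [X in _ --> X](_ : 0 = \sum_(n < N) a n * csq (u t n - u t n)); last first.
  by rewrite big1// => n _; rewrite subrr csq0 mulr0.
have PF : ProperFilter (within `[0, T]%classic (nbhs t)).
  by apply: within_nbhs_proper; exact: subset_closure.
apply: (@cvg_sum_ord _ _ (within `[0, T]%classic (nbhs t)) PF N
  (fun n s => a n * csq (u t n - u s n)) (fun n => a n * csq (u t n - u t n))) => j.
apply: cvgMr; have [c1 c2] := cu j.
have /subspace_continuousP /(_ t tT) d1 := c1.
have /subspace_continuousP /(_ t tT) d2 := c2.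
have P (p : R[i] -> R) : (forall x y, p (x - y) = p x - p y) ->
    p (u s j) @[s --> within `[0, T]%classic (nbhs t)] --> p (u t j) ->
    p (u t j - u s j) ^+ 2 @[s --> within `[0, T]%classic (nbhs t)] --> p (u t j - u t j) ^+ 2.
  move=> pB cp; rewrite pB; under eq_fun do rewrite pB.
  by rewrite expr2; under eq_fun do rewrite expr2; apply: cvgM; apply: cvgB => //; exact: cvg_cst.
by apply: cvgD; apply: P => // x y; rewrite !cpartE.
Qed.

(** * Fixed point and a priori estimate for a semilinear diagonal system *)

Section semilinear.
Variables (R : realType) (lam d : nat -> R[i]).
Local Notation Re := complex.Re.
Local Notation seqC := (nat -> R[i]).
Local Notation sq := (sqnormD lam).
Local Notation D := (spaceD lam).
Variables (G : seqC -> seqC) (l c L theta r0 : R).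
Hypothesis d_le : forall n, Re (d n) <= - (l + c * wt lam (1 / 2) n).
Hypothesis l_ge0 : 0 <= l.
Hypothesis c_gt0 : 0 < c.
Hypothesis L_ge0 : 0 <= L.
Hypothesis theta_gt0 : 0 < theta.
Hypothesis theta_le : theta <= c ^+ 2 / 8.
Hypothesis G_bnd : forall w, D (1 / 2) w -> (sq 0 w <= r0%:E)%E ->
  (sq (- (1 / 2)) (G w) <= theta%:E * sq (1 / 2) w)%E.
Hypothesis G_lip : forall w v, D (1 / 2) w -> D (1 / 2) v ->
  (sq 0 w <= r0%:E)%E -> (sq 0 v <= r0%:E)%E ->
  (sq (- (1 / 2)) (G w - G v)%R <= L%:E * ((sq (1 / 2) w + sq (1 / 2) v) * sq 0 (w - v)%R)
     + theta%:E * sq (1 / 2) (w - v)%R)%E.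

(** A curve of finite energy lies in D_(1/2) for almost every time only; the default 0 at the other
    times does not affect integrals. *)
Definition Gcurve (w : R -> seqC) (t : R) : seqC :=
  if `[< D (1 / 2) (w t) >] then G (w t) else 0.

Hypothesis G_meas : forall T (w : R -> seqC), 0 <= T ->
  (forall n, ccont `[0, T] (w^~ n)) ->
  (forall t, 0 <= t <= T -> (sq 0 (w t) <= r0%:E)%E) ->
  forall n, cmeas `[0, T] (fun t => Gcurve w t n).

Implicit Types (w v g : R -> seqC) (T a q : R).

(** The number [q] bounds the squared norm of [exp (l t) w] both in L^oo(0, T; H) and, up to the
    factor [c], in L^2(0, T; D_(1/2)). This is the norm of the contraction argument. *)
Definition energy_le T w q :=
  (forall t, 0 <= t <= T -> ((expR (2 * l * t))%:E * sq 0 (w t) <= q%:E)%E) /\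
  (c%:E * wint lam l (1 / 2) T w <= q%:E)%E.

Lemma eq_wint r T w v : (forall t, 0 <= t <= T -> w t = v t) ->
  wint lam l r T w = wint lam l r T v.
Proof.
by move=> wv; apply: eq_integral => s; rewrite inE/= in_itv/= => sT; rewrite wv.
Qed.

Lemma eq_energy_le T w v q : (forall t, 0 <= t <= T -> w t = v t) ->
  energy_le T w q -> energy_le T v q.
Proof.
move=> wv [w1 w2]; split; last by rewrite -(eq_wint _ wv).
by move=> t tT; rewrite -wv// w1.
Qed.

Lemma energy_le_sq T w q t : energy_le T w q -> 0 <= t <= T -> (sq 0 (w t) <= q%:E)%E.
Proof.
move=> [w1 _] /[dup] tT /andP[t0 _]; apply: le_trans (w1 t tT).
by rewrite -[leLHS]mul1e lee_wpmul2r ?sq_ge0// lee_fin -expR0 ler_expR !mulr_ge0.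
Qed.

Lemma wint_mono r T T' w : T' <= T -> (forall n, cmeas `[0, T] (w^~ n)) ->
  (wint lam l r T' w <= wint lam l r T w)%E.
Proof.
move=> TT mw; apply: ge0_subset_integral => //.
- exact: measurable_wint.
- by move=> s _; rewrite mule_ge0 ?sq_ge0// lee_fin expR_ge0.
- by apply: subset_itvl; rewrite bnd_simp.
Qed.

Lemma cmeasS T T' w : T' <= T -> (forall n, cmeas `[0, T] (w^~ n)) ->
  forall n, cmeas `[0, T'] (w^~ n).
Proof.
move=> TT mw n; have sub : `[0, T']%classic `<=` (`[0, T]%classic : set R).
  by apply: subset_itvl; rewrite bnd_simp.
by have [m1 m2] := mw n; split; [apply: measurable_funS sub m1|apply: measurable_funS sub m2].
Qed.

Lemma system_energy_le T (z : seqC) g (a b : R) : 0 <= T ->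
  (forall n, cmeas `[0, T] (g^~ n)) -> (sq 0 z <= a%:E)%E ->
  (wint lam l (- (1 / 2)) T g <= b%:E)%E ->
  energy_le T (system_duhamel d z g) (a + c^-1 * b).
Proof.
move=> T0 mg za gb.
have H t : 0 <= t <= T ->
    ((expR (2 * l * t))%:E * sq 0 (system_duhamel d z g t) +
   c%:E * wint lam l (1 / 2) t (system_duhamel d z g) <= (a + c^-1 * b)%:E)%E.
  move=> /andP[t0 tT]; apply: le_trans (system_energy z d_le l_ge0 c_gt0 t0 (cmeasS tT mg)) _.
  rewrite EFinD; apply: leeD => //; rewrite EFinM; apply: lee_wpmul2l.
    by rewrite lee_fin invr_ge0 ltW.
  by apply: le_trans gb; exact: wint_mono.
split=> [t tT|].
  apply: le_trans (H t tT); rewrite leeDl// mule_ge0 ?wint_ge0// lee_fin ltW//.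
have := H T; rewrite T0 lexx => /(_ isT); apply: le_trans.
by rewrite leeDr// mule_ge0 ?sq_ge0// lee_fin expR_ge0.
Qed.

Lemma Gcurve_le w t : (sq 0 (w t) <= r0%:E)%E ->
  (sq (- (1 / 2)) (Gcurve w t) <= theta%:E * sq (1 / 2) (w t))%E.
Proof.
rewrite /Gcurve; case: asboolP => [wD wr|_ _]; first exact: G_bnd.
by rewrite sq0 mule_ge0 ?sq_ge0// lee_fin ltW.
Qed.

(** If exactly one of the two points is in D_(1/2), their difference is not, and the right-hand side
    is infinite. *)
Lemma Gcurve_lip w v t : (sq 0 (w t) <= r0%:E)%E -> (sq 0 (v t) <= r0%:E)%E ->
  (sq (- (1 / 2)) (Gcurve w t - Gcurve v t)%R <=
    L%:E * ((sq (1 / 2) (w t) + sq (1 / 2) (v t)) * sq 0 (w t - v t)%R)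
     + theta%:E * sq (1 / 2) (w t - v t)%R)%E.
Proof.
move=> wr vr; rewrite /Gcurve; case: asboolP => wD; case: asboolP => vD.
- exact: G_lip.
- rewrite (_ : sq (1 / 2) (w t - v t)%R = +oo%E) ?gt0_muley ?lte_fin//.
    rewrite addey ?leey// -ltNye; apply: (@lt_le_trans _ _ 0%E) => //.
    by rewrite !mule_ge0 ?adde_ge0 ?sq_ge0.
  apply/eqP; rewrite -leye_eq leNgt; apply/negP => wvD; apply: vD.
  by rewrite -(subKr (w t) (v t)); exact: spaceDB.
- rewrite (_ : sq (1 / 2) (w t - v t)%R = +oo%E) ?gt0_muley ?lte_fin//.
    rewrite addey ?leey// -ltNye; apply: (@lt_le_trans _ _ 0%E) => //.
    by rewrite !mule_ge0 ?adde_ge0 ?sq_ge0.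
  apply/eqP; rewrite -leye_eq leNgt; apply/negP => wvD; apply: wD.
  by rewrite -(subrK (v t) (w t)); exact: spaceDD.
- by rewrite subrr sq0 adde_ge0 ?mule_ge0 ?adde_ge0 ?sq_ge0// lee_fin ltW.
Qed.

Section on_interval.
Variables (T a : R).
Hypothesis T_ge0 : 0 <= T.
Hypothesis a_le : a <= r0.
Hypothesis La_le : L * a <= c ^+ 2 / 16.

Lemma wint_le_div w q : energy_le T w q -> (wint lam l (1 / 2) T w <= (c^-1 * q)%:E)%E.
Proof.
move=> [_ w2]; set W := wint _ _ _ _ _ in w2 *.
have -> : W = ((c^-1)%:E * (c%:E * W))%E.
  by rewrite muleA -EFinM mulVf ?mul1e// gt_eqF.
by rewrite EFinM; apply: lee_wpmul2l => //; rewrite lee_fin invr_ge0 ltW.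
Qed.

Let small w t : energy_le T w a -> 0 <= t <= T -> (sq 0 (w t) <= r0%:E)%E.
Proof. by move=> wa tT; apply: le_trans (energy_le_sq wa tT) _; rewrite lee_fin. Qed.

Let ccont_meas w : (forall n, ccont `[0, T] (w^~ n)) -> forall n, cmeas `[0, T] (w^~ n).
Proof. by move=> cw n; exact: cmeas_ccont. Qed.

Lemma wint_Gcurve w : (forall n, ccont `[0, T] (w^~ n)) ->
  (forall t, 0 <= t <= T -> (sq 0 (w t) <= r0%:E)%E) ->
  (wint lam l (- (1 / 2)) T (Gcurve w) <= theta%:E * wint lam l (1 / 2) T w)%E.
Proof.
move=> cw wr; rewrite /wint -ge0_integralZl_EFin ?(ltW theta_gt0)//; last 2 first.
- by move=> s _; rewrite mule_ge0 ?sq_ge0// lee_fin expR_ge0.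
- by apply: measurable_wint => n; exact: (ccont_meas cw).
apply: ge0_le_integral => //.
- by move=> s _; rewrite mule_ge0 ?sq_ge0// lee_fin expR_ge0.
- by apply: measurable_wint; apply: G_meas.
- by apply: measurable_funeM; apply: measurable_wint => n; exact: (ccont_meas cw).
move=> s; rewrite /= in_itv/= => sT; rewrite muleCA; apply: lee_wpmul2l.
  by rewrite lee_fin expR_ge0.
by apply: Gcurve_le; exact: wr.
Qed.

(** In the product term of the Lipschitz bound, the D_(1/2) norms are integrated in time and the H
    norm of the difference is bounded uniformly in time. *)
Lemma wint_GcurveB w v q : (forall n, ccont `[0, T] (w^~ n)) ->
  (forall n, ccont `[0, T] (v^~ n)) -> energy_le T w a -> energy_le T v a ->
  energy_le T (fun t => w t - v t) q -> 0 <= q ->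
  (wint lam l (- (1 / 2)) T (fun t => Gcurve w t - Gcurve v t)%R <= (q * c / 4)%:E)%E.
Proof.
move=> cw cv wa va wvq q0.
have mw := ccont_meas cw; have mv := ccont_meas cv.
have mwv n : cmeas `[0, T] (fun t => (w t - v t) n).
  by apply: cmeasD => //; exact: cmeasN.
have mG n : cmeas `[0, T] (fun t => (Gcurve w t - Gcurve v t) n).
  apply: cmeasD; first by apply: G_meas => // t tT; exact: small.
  by apply: cmeasN; apply: G_meas => // t tT; exact: small.
have a0 : 0 <= a.
  rewrite -lee_fin; have := energy_le_sq wa (t := 0); rewrite lexx T_ge0 => /(_ isT).
  by apply: le_trans; exact: sq_ge0.
have p0 (r : R) (y : seqC) s : (0 <= (expR (2 * l * s))%:E * sq r y)%E.
  by rewrite mule_ge0 ?sq_ge0// lee_fin expR_ge0.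
(* The weight [exp (2 l s)] is spent on the D_(1/2) norms; the H norm of the difference is bounded
   by [q] without it. *)
pose h1 s := ((L * q)%:E * ((expR (2 * l * s))%:E * sq (1 / 2) (w s) + (expR (2 * l * s))%:E * sq (1 / 2) (v s)))%E.
pose h2 s := (theta%:E * ((expR (2 * l * s))%:E * sq (1 / 2) (w s - v s)%R))%E.
have mw1 := measurable_wint lam l (1 / 2) mw.
have mv1 := measurable_wint lam l (1 / 2) mv.
have mwv1 := measurable_wint lam l (1 / 2) mwv.
have mh1 : measurable_fun (`[0, T]%classic : set R) h1.
  by apply: measurable_funeM; apply: emeasurable_funD.
have mh2 : measurable_fun (`[0, T]%classic : set R) h2 by apply: measurable_funeM.
have Lq0 : 0 <= L * q by rewrite mulr_ge0.
apply: (@le_trans _ _ (\int[leb]_(s in `[0%R, T]) (h1 s + h2 s))%E).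
  apply: ge0_le_integral => //.
  - exact: measurable_wint.
  - exact: emeasurable_funD.
  move=> s; rewrite /= in_itv/= => sT.
  apply: (le_trans (lee_wpmul2l _ (Gcurve_lip (small wa sT) (small va sT)))).
    by rewrite lee_fin expR_ge0.
  rewrite ge0_muleDr; last 2 first.
  - by rewrite mule_ge0 ?mule_ge0 ?adde_ge0 ?sq_ge0.
  - by rewrite mule_ge0 ?sq_ge0// lee_fin ltW.
  apply: leeD; last by rewrite muleCA.
  have -> : h1 s = ((expR (2 * l * s))%:E * (L%:E * ((sq (1 / 2) (w s) + sq (1 / 2) (v s)) * q%:E)))%E.
    rewrite /h1 -ge0_muleDr ?sq_ge0// EFinM -muleA (muleCA q%:E) (muleCA L%:E).
    by rewrite (muleC q%:E).
  apply: lee_wpmul2l; first by rewrite lee_fin expR_ge0.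
  apply: lee_wpmul2l; first by rewrite lee_fin.
  apply: lee_wpmul2l; first by rewrite adde_ge0 ?sq_ge0.
  exact: energy_le_sq wvq sT.
rewrite ge0_integralD//; last 2 first.
- by move=> s _; rewrite mule_ge0 ?adde_ge0 ?p0// lee_fin.
- by move=> s _; rewrite mule_ge0 ?p0// lee_fin ltW.
rewrite ge0_integralZl_EFin//; last 2 first.
- by move=> s _; rewrite adde_ge0 ?p0.
- exact: emeasurable_funD.
rewrite ge0_integralZl_EFin ?(ltW theta_gt0)//.
rewrite ge0_integralD//.
apply: (@le_trans _ _ ((L * q)%:E * ((c^-1 * a)%:E + (c^-1 * a)%:E) + theta%:E * (c^-1 * q)%:E)%E).
  apply: leeD; apply: lee_wpmul2l; rewrite ?lee_fin ?(ltW theta_gt0)//.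
    by apply: leeD; exact: wint_le_div.
  exact: wint_le_div wvq.
rewrite -(EFinD (c^-1 * a)) -!EFinM -EFinD lee_fin.
(* The claim becomes [2 L a + theta <= c^2 / 4], which holds since each of the two terms is at most
   [c^2 / 8]. *)
have -> : L * q * (c^-1 * a + c^-1 * a) + theta * (c^-1 * q) = q * c^-1 * (2 * (L * a) + theta) by ring.
have -> : q * c / 4 = q * c^-1 * (c ^+ 2 / 4) by field; rewrite gt_eqF.
rewrite ler_wpM2l ?mulr_ge0 ?invr_ge0 ?(ltW c_gt0)//.
by have := theta_le; move: La_le; lra.
Qed.

Lemma system_duhamelB (z z' : seqC) g g' t : (forall n, citg `[0, t] (g^~ n)) ->
  (forall n, citg `[0, t] (g'^~ n)) ->
  system_duhamel d z g t - system_duhamel d z' g' t =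
  system_duhamel d (z - z') (fun s => g s - g' s) t.
Proof.
move=> ig ig'; apply/funext => n.
rewrite (_ : (_ - _) n = duhamel (d n) (z n) (g^~ n) t - duhamel (d n) (z' n) (g'^~ n) t)//.
have ign : citg `[0, t] (fun s => - g' s n).
  by apply: eq_citg (citgZ (-1) _ (ig' n)) => // s _; rewrite mulN1r.
rewrite /system_duhamel !duhamelE//; last exact: citgD (ig n) ign.
rewrite -mulrBr; congr (_ * _); rewrite opprD addrACA; congr (_ + _).
transitivity (cint `[0, t] (fun s => cexp (- (s%:C%C * d n)) * g s n) +
  cint `[0, t] (fun s => (-1) * (cexp (- (s%:C%C * d n)) * g' s n))).
  by rewrite cintZ ?mulN1r//; exact: citg_cexpM.
rewrite -cintD//; last 2 first.
- exact: citg_cexpM.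
- by apply: citgZ => //; exact: citg_cexpM.
by apply: eq_cint => s _; rewrite mulN1r -mulrBr.
Qed.

(** The initial data cancel in the difference, so only the forcing counts: [c^-1] from the energy
    estimate times [q c / 4]. *)
Lemma system_contraction (z : seqC) w v q : (forall n, ccont `[0, T] (w^~ n)) ->
  (forall n, ccont `[0, T] (v^~ n)) -> energy_le T w a -> energy_le T v a ->
  energy_le T (fun t => w t - v t) q -> 0 <= q ->
  energy_le T (fun t => system_duhamel d z (Gcurve w) t - system_duhamel d z (Gcurve v) t) (q / 4).
Proof.
move=> cw cv wa va wvq q0.
have mG u : (forall n, ccont `[0, T] (u^~ n)) -> energy_le T u a ->
    forall n, cmeas `[0, T] (fun t => Gcurve u t n).
  by move=> cu ua; apply: G_meas => // t tT; exact: small.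
have iG u : (forall n, ccont `[0, T] (u^~ n)) -> energy_le T u a ->
    forall n t, 0 <= t <= T -> citg `[0, t] ((Gcurve u)^~ n).
  move=> cu ua n t /andP[t0 tT]; apply: (@citgS _ _ _ 0 T) => //.
  apply: (citg_wint (lam := lam) l_ge0 (mG u cu ua) (r := - (1 / 2))).
  apply: le_lt_trans (wint_Gcurve cu (fun t tT => small ua tT)) _.
  rewrite lte_mul_pinfty ?lee_fin ?(ltW theta_gt0)//.
  by apply: le_lt_trans (wint_le_div ua) _; rewrite ltry.
apply: (@eq_energy_le T (system_duhamel d (z - z) (fun t => Gcurve w t - Gcurve v t))).
  by move=> t tT; rewrite -system_duhamelB// => n; exact: iG.
rewrite subrr (_ : q / 4 = 0 + c^-1 * (q * c / 4)); last by field; rewrite gt_eqF.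
apply: system_energy_le => //.
- by move=> n; apply: cmeasD; [exact: mG|apply: cmeasN; exact: mG].
- by rewrite sq0.
- exact: wint_GcurveB.
Qed.

Lemma system_selfmap (z : seqC) w : (sq 0 z <= (a / 2)%:E)%E ->
  (forall n, ccont `[0, T] (w^~ n)) -> energy_le T w a ->
  energy_le T (system_duhamel d z (Gcurve w)) a /\
  (forall n, ccont `[0, T] ((system_duhamel d z (Gcurve w))^~ n)).
Proof.
move=> za cw wa.
have a0 : 0 <= a.
  by have := le_trans (sq_ge0 lam 0 z) za; rewrite lee_fin; lra.
have mG : forall n, cmeas `[0, T] (fun t => Gcurve w t n).
  by apply: G_meas => // t tT; exact: small.
have wG : (wint lam l (- (1 / 2)) T (Gcurve w) <= (theta * (c^-1 * a))%:E)%E.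
  apply: le_trans (wint_Gcurve cw (fun t tT => small wa tT)) _.
  rewrite EFinM; apply: lee_wpmul2l; rewrite ?lee_fin ?(ltW theta_gt0)//.
  exact: wint_le_div.
split; last first.
  move=> n; apply: duhamel_cont => //; apply: (citg_wint (lam := lam) l_ge0 mG (r := - (1 / 2))).
  by apply: le_lt_trans wG _; rewrite ltry.
have [e1 e2] := system_energy_le T_ge0 mG za wG.
(* The datum uses [a / 2] and the nonlinearity at most [a / 8], because [theta <= c^2 / 8]. *)
have le_a : a / 2 + c^-1 * (theta * (c^-1 * a)) <= a.
  have -> : c^-1 * (theta * (c^-1 * a)) = theta * (a / c ^+ 2) by field; rewrite gt_eqF.
  have := ler_wpM2r (_ : 0 <= a / c ^+ 2) theta_le => /(_ _) h.
  have {h} := h (divr_ge0 a0 (sqr_ge0 c)).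
  have -> : c ^+ 2 / 8 * (a / c ^+ 2) = a / 8 by field; rewrite gt_eqF.
  lra.
split; first by move=> t tT; apply: le_trans (e1 t tT) _; rewrite lee_fin.
by apply: le_trans e2 _; rewrite lee_fin.
Qed.

Lemma energy_leB w v q q' : (forall n, cmeas `[0, T] (w^~ n)) ->
  (forall n, cmeas `[0, T] (v^~ n)) -> energy_le T w q -> energy_le T v q' ->
  energy_le T (fun t => w t + v t) (2 * q + 2 * q').
Proof.
move=> mw mv [w1 w2] [v1 v2].
have p0 (r : R) (y : seqC) s : (0 <= (expR (2 * l * s))%:E * sq r y)%E.
  by rewrite mule_ge0 ?sq_ge0// lee_fin expR_ge0.
have S (r s : R) (y x : seqC) : ((expR (2 * l * s))%:E * sq r (y + x)%R <=
    2%:E * ((expR (2 * l * s))%:E * sq r y) + 2%:E * ((expR (2 * l * s))%:E * sq r x))%E.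
  apply: (le_trans (lee_wpmul2l _ (sqDr lam r y x))); first by rewrite lee_fin expR_ge0.
  by rewrite ge0_muleDr ?mule_ge0 ?sq_ge0// [in leRHS]muleCA [X in (_ <= _ + X)%E]muleCA.
split.
  move=> t tT; apply: le_trans (S _ _ _ _) _; rewrite (EFinD (2 * q)) !EFinM.
  by apply: leeD; apply: lee_wpmul2l => //; [exact: w1|exact: v1].
apply: (@le_trans _ _ (c%:E * (2%:E * wint lam l (1 / 2) T w + 2%:E * wint lam l (1 / 2) T v))%E).
  apply: lee_wpmul2l; first by rewrite lee_fin ltW.
  have mw1 := measurable_wint lam l (1 / 2) mw.
  have mv1 := measurable_wint lam l (1 / 2) mv.
  rewrite /wint -!ge0_integralZl_EFin//; [|by move=> s _; exact: p0..].
  rewrite -ge0_integralD//; last 4 first.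
  - by move=> s _; rewrite mule_ge0.
  - exact: measurable_funeM.
  - by move=> s _; rewrite mule_ge0.
  - exact: measurable_funeM.
  apply: ge0_le_integral => //.
  - by apply: measurable_wint => n; exact: cmeasD.
  - by apply: emeasurable_funD; exact: measurable_funeM.
rewrite ge0_muleDr ?mule_ge0 ?wint_ge0// !(muleCA c%:E) (EFinD (2 * q)) !EFinM.
by apply: leeD; apply: lee_wpmul2l.
Qed.

Lemma energy_le_mono w q q' : q <= q' -> energy_le T w q -> energy_le T w q'.
Proof.
move=> qq [w1 w2]; split=> [t tT|]; first by apply: le_trans (w1 t tT) _; rewrite lee_fin.
by apply: le_trans w2 _; rewrite lee_fin.
Qed.

Lemma energy_leN w q : energy_le T w q -> energy_le T (fun t => - w t) q.
Proof.
move=> [w1 w2]; split=> [t tT|]; first by rewrite sqN w1.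
by rewrite /wint; under eq_integral do rewrite sqN.
Qed.

Lemma energy_le_liminf (y : nat -> R -> seqC) w q : 0 <= q ->
  (forall j n, cmeas `[0, T] (fun s => y j s n)) -> (forall n, cmeas `[0, T] (w^~ n)) ->
  (forall s, 0 <= s <= T -> forall n, ccvg (fun j => y j s n) (w s n)) ->
  (forall j, energy_le T (y j) q) -> energy_le T w q.
Proof.
move=> q0 my mw yw yq; split=> [t tT|].
  have e0 : 0 < expR (2 * l * t) by exact: expR_gt0.
  have K (x : seqC) : ((expR (2 * l * t))%:E * sq 0 x <= q%:E)%E <->
      (sq 0 x <= ((expR (2 * l * t))^-1 * q)%:E)%E.
    split=> h.
      have -> : sq 0 x = (((expR (2 * l * t))^-1)%:E * ((expR (2 * l * t))%:E * sq 0 x))%E.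
        by rewrite muleA -EFinM mulVf ?mul1e// gt_eqF.
      by rewrite EFinM; apply: lee_wpmul2l => //; rewrite lee_fin invr_ge0 ltW.
    have -> : q%:E = ((expR (2 * l * t))%:E * ((expR (2 * l * t))^-1 * q)%:E)%E.
      by rewrite -EFinM mulVKf// gt_eqF.
    by apply: lee_wpmul2l => //; rewrite lee_fin ltW.
  apply/K; apply: (@sq_liminf _ lam 0 (fun j => y j t)) => [n|j]; first exact: yw.
  by apply/K; case: (yq j) => + _; apply.
have H : (wint lam l (1 / 2) T w <= (c^-1 * q)%:E)%E.
  by apply: (@wint_liminf _ lam l (1 / 2) T y) => // j; exact: wint_le_div.
apply: (le_trans (lee_wpmul2l _ H)); first by rewrite lee_fin ltW.
by rewrite -EFinM mulVKf// gt_eqF.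
Qed.

(** Both curves are fixed points, so any energy bound on their difference may be divided by 4 again
    and again. *)
Lemma energy_le_unique (z : seqC) w v : (forall n, ccont `[0, T] (w^~ n)) ->
  (forall n, ccont `[0, T] (v^~ n)) -> energy_le T w a -> energy_le T v a ->
  (forall t, 0 <= t <= T -> w t = system_duhamel d z (Gcurve w) t) ->
  (forall t, 0 <= t <= T -> v t = system_duhamel d z (Gcurve v) t) ->
  forall t, 0 <= t <= T -> w t = v t.
Proof.
move=> cw cv wa va wE vE t tT.
have a0 : 0 <= a.
  by rewrite -lee_fin; apply: le_trans (energy_le_sq wa tT); exact: sq_ge0.
(* The starting value [4 a = 2 a + 2 a] is the squared-norm bound for a difference of two curves of
   the ball. *)
have H k : energy_le T (fun t => w t - v t) (4 * a * (4^-1) ^+ k).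
  elim: k => [|k IH].
    rewrite expr0 mulr1 (_ : 4 * a = 2 * a + 2 * a); last by ring.
    apply: energy_leB => //; try exact: ccont_meas; last exact: energy_leN.
    by move=> n; apply: cmeasN; exact: ccont_meas.
  rewrite exprSr mulrA; have q0 : 0 <= 4 * a * 4^-1 ^+ k by rewrite !mulr_ge0// exprn_ge0 ?invr_ge0.
  apply: eq_energy_le (system_contraction z cw cv wa va IH q0) => s sT.
  by rewrite -wE// -vE.
apply/eqP; rewrite -subr_eq0; apply/eqP/(@sq_eq0 _ lam 0)/eqP; rewrite eq_le sq_ge0 andbT.
have c0 : 4 * a * (4^-1) ^+ k @[k --> \oo] --> (0 : R).
  rewrite -[X in _ --> X](mulr0 (4 * a)); apply: cvgMr; apply: cvg_expr.
  by rewrite ger0_norm ?invr_ge0// invf_lt1// ltr1n.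
apply/lee_addgt0Pr => eps eps0; rewrite add0e.
have /cvgrPdist_lt /(_ _ eps0) [K _ /(_ K (leqnn K))] := c0.
rewrite /= sub0r normrN => /(le_lt_trans (ler_norm _)) /ltW h.
by apply: le_trans (energy_le_sq (H K) tT) _; rewrite lee_fin.
Qed.

End on_interval.

Lemma ccont_uniform_limit T (f : nat -> R -> R[i]) (h : R -> R[i]) (q : nat -> R) :
  (forall k, ccont `[0, T] (f k)) -> q k @[k --> \oo] --> (0 : R) ->
  (forall k t, 0 <= t <= T -> csq (h t - f k t) <= q k) -> ccont `[0, T] h.
Proof.
move=> cf q0 hf.
apply: ccont_of_csq => t eps tT eps0.
(* Two applications of [csqD_le] give [2 eps/12 + 2 (2 eps/8 + 2 eps/12) = eps]. *)
have e1 : 0 < eps / 12 by rewrite divr_gt0.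
have /cvgrPdist_lt /(_ _ e1) [k _ /(_ k (leqnn k))] := q0.
rewrite /= sub0r normrN => /(le_lt_trans (ler_norm _)) qk.
have tT' : `[0, T]%classic t by rewrite /= in_itv.
have := ccont_csq_sum (u := fun s _ => f k s) (fun=> 1) 1 (fun=> cf k) tT'.
have e2 : 0 < eps / 8 by rewrite divr_gt0.
move=> /cvgrPdist_lt /(_ _ e2) ft.
have {}ft : \forall s \near t, `[0, T]%classic s ->
  `|0 - \sum_(n < 1) 1 * csq (f k t - f k s)| < eps / 8 := ft.
apply: filterS ft => s + sT; rewrite /= in_itv/= big_ord1 mul1r sub0r normrN => /(_ sT).
move=> /(le_lt_trans (ler_norm _)) fk.
rewrite (_ : h t - h s = (h t - f k t) + ((f k t - f k s) - (h s - f k s))); last by ring.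
apply: le_trans (csqD_le _ _) _; have := csqD_le (f k t - f k s) (- (h s - f k s)).
by rewrite csqN; have := hf k t tT; have := hf k s sT; lra.
Qed.

Section existence.
Variables (z : seqC) (a : R).
Hypothesis a_le : a <= r0.
Hypothesis La_le : L * a <= c ^+ 2 / 16.
Hypothesis z_le : (sq 0 z <= (a / 2)%:E)%E.

Let a_ge0 : 0 <= a.
Proof. by have := le_trans (sq_ge0 lam 0 z) z_le; rewrite lee_fin; lra. Qed.

(** The iterates refer to no time horizon: the same sequence is estimated on every [[0, T]], with
    constants independent of [T]. *)
Fixpoint picard k : R -> seqC :=
  if k is k'.+1 then system_duhamel d z (Gcurve (picard k')) else fun=> 0.

Lemma picard_good T k : 0 <= T ->
  energy_le T (picard k) a /\ (forall n, ccont `[0, T] ((picard k)^~ n)).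
Proof.
move=> T0; elim: k => [|k [IH1 IH2]] /=; last exact: system_selfmap.
split; last by move=> n; exact: ccont_cst.
split=> [t tT|]; first by rewrite sq0 mule0 lee_fin.
rewrite /wint; under eq_integral do rewrite sq0 mule0.
by rewrite integral0 mule0 lee_fin.
Qed.

Lemma picard_diff T k : 0 <= T ->
  energy_le T (fun t => picard k.+1 t - picard k t) (4 * a * (4^-1) ^+ k).
Proof.
move=> T0; have [e c'] := (fun j => picard_good j T0, tt); have {c'} _ := c'.
elim: k => [|k IH].
  rewrite expr0 mulr1 (_ : 4 * a = 2 * a + 2 * a); last by ring.
  apply: (energy_leB (v := fun t => - picard 0 t)).
  - by move=> n; apply: cmeas_ccont; case: (e 1%N).
  - by move=> n; apply: cmeasN; apply: cmeas_ccont; case: (e 0%N).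
  - by case: (e 1%N).
  - by apply: energy_leN; case: (e 0%N).
rewrite exprSr mulrA; have q0 : 0 <= 4 * a * 4^-1 ^+ k by rewrite !mulr_ge0// exprn_ge0 ?invr_ge0.
by apply: (system_contraction T0 a_le La_le z _ _ _ _ IH q0);
  [case: (e k.+1)|case: (e k)|case: (e k.+1)|case: (e k)].
Qed.

Lemma picard_tail T i k : 0 <= T ->
  energy_le T (fun t => picard (k + i)%N t - picard k t) (16 * a * (4^-1) ^+ k).
Proof.
move=> T0; have M j n : cmeas `[0, T] ((picard j)^~ n).
  by apply: cmeas_ccont; case: (picard_good j T0).
elim: i k => [|i IH] k.
  apply: (@eq_energy_le _ (fun=> 0)); first by move=> t _; rewrite addn0 subrr.
  apply: (@energy_le_mono T _ 0).
    by rewrite !mulr_ge0// exprn_ge0 ?invr_ge0.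
  split=> [t tT|]; first by rewrite sq0 mule0 lee_fin.
  rewrite /wint; under eq_integral do rewrite sq0 mule0.
  by rewrite integral0 mule0 lee_fin.
have := energy_leB _ _ (IH k.+1) (picard_diff k T0) => /(_ _ _) h.
have {h} := h (fun n => cmeasD (M _ n) (cmeasN (M _ n))) (fun n => cmeasD (M _ n) (cmeasN (M _ n))).
rewrite addSnnS => h.
(* The constant 16 solves the recursion for squared norms: [2 (16 a / 4) + 2 (4 a) = 16 a]. *)
apply: (@energy_le_mono T _ (2 * (16 * a * 4^-1 ^+ k.+1) + 2 * (4 * a * 4^-1 ^+ k))).
  rewrite exprS.
  have h0 : (0 : R) <= 4^-1 by rewrite invr_ge0.
  have := mulr_ge0 a_ge0 (exprn_ge0 k h0); lra.
by apply: eq_energy_le h => t _; rewrite addrA subrK.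
Qed.

(** The limit is taken in each coordinate at each time; energy bounds, also for the distance to the
    iterates, pass to it by lower semicontinuity, and continuity by uniform convergence. *)
Lemma semilinear_existence : exists w : R -> seqC,
  (forall T, 0 <= T -> energy_le T w a) /\
  (forall T n, 0 <= T -> ccont `[0, T] (w^~ n)) /\
  (forall t, 0 <= t -> w t = system_duhamel d z (Gcurve w) t).
Proof.
pose q k := 16 * a * (4^-1) ^+ k : R.
have q_ge0 k : 0 <= q k by rewrite !mulr_ge0// exprn_ge0 ?invr_ge0.
have q_cvg (b : R) : b * q k @[k --> \oo] --> (0 : R).
  rewrite -[X in _ --> X](mulr0 (b * (16 * a))) /q.
  under eq_fun do rewrite mulrA; apply: cvgMr; apply: cvg_expr.
  by rewrite ger0_norm ?invr_ge0// invf_lt1// ltr1n.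
have geo t n : 0 <= t -> exists y, ccvg (fun k => picard k t n) y /\
    forall k, csq (y - picard k t n) <= q k.
  move=> t0; apply: csq_geometric_cvg => [|k i]; first by rewrite mulr_ge0.
  rewrite -lee_fin; apply: le_trans (energy_le_sq (picard_tail i k t0) (_ : 0 <= t <= t)).
    by rewrite -[X in (X%:E <= _)%E]mul1r -(wt0 lam n); exact: sq_coord.
  by rewrite t0 lexx.
have [w Hw] : exists w : R -> seqC, forall t n, 0 <= t ->
    ccvg (fun k => picard k t n) (w t n) /\ forall k, csq (w t n - picard k t n) <= q k.
  have ex t n : exists y, 0 <= t -> ccvg (fun k => picard k t n) y /\
      forall k, csq (y - picard k t n) <= q k.
    have [t0|] := boolP (0 <= t); last by exists 0.
    by have [y yP] := geo t n t0; exists y.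
  by exists (fun t n => sval (cid (ex t n))) => t n t0; case: cid => /= y; apply.
have wcont T n : 0 <= T -> ccont `[0, T] (w^~ n).
  move=> T0; apply: (@ccont_uniform_limit T (fun k t => picard k t n) _ (fun k => 1 * q k)).
  - by move=> k; case: (picard_good k T0).
  - exact: q_cvg.
  - by move=> k t /andP[t0 _]; rewrite mul1r; case: (Hw t n t0).
have pm T k n : 0 <= T -> cmeas `[0, T] ((picard k)^~ n).
  by move=> T0; apply: cmeas_ccont; case: (picard_good k T0).
have wm T n : 0 <= T -> cmeas `[0, T] (w^~ n).
  by move=> T0; apply: cmeas_ccont; exact: wcont.
have wa T : 0 <= T -> energy_le T w a.
  move=> T0; apply: (@energy_le_liminf T picard) => //.
  - by move=> j n; exact: pm.
  - by move=> n; exact: wm.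
  - by move=> s /andP[s0 _] n; case: (Hw s n s0).
  - by move=> j; case: (picard_good j T0).
have wq T k : 0 <= T -> energy_le T (fun t => w t - picard k t) (q k).
  move=> T0; apply: (@energy_le_liminf T (fun j t => picard (k + j)%N t - picard k t)) => //.
  - by move=> j n; apply: cmeasD; [exact: pm|apply: cmeasN; exact: pm].
  - by move=> n; apply: cmeasD; [exact: wm|apply: cmeasN; exact: pm].
  - move=> s /andP[s0 _] n; apply: ccvgB; last exact: ccvg_cst.
    have [cw _] := Hw s n s0; have := ccvg_shift k cw.
    by congr ccvg; apply/funext => j; rewrite addnC.
  - by move=> j; exact: picard_tail.
exists w; split=> //; split=> // t t0.
have tt : 0 <= t <= t by rewrite t0 lexx.
apply/funext => n; have [cw _] := Hw t n t0.
(* The shifted iterates converge to [w], and by the contraction applied to [w] and [picard k] also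
   to the Duhamel image of [w]. *)
apply: (ccvg_unique (ccvg_shift 1 cw)).
apply: (@ccvg_csq_small _ _ _ (fun k => 4^-1 * q k)); first exact: q_cvg.
move=> k; rewrite addn1 mulrC; have [pa pc] := picard_good k t0.
have := system_contraction t0 a_le La_le z (fun n => wcont t n t0) pc (wa t t0) pa (wq t k t0) (q_ge0 k).
move=> /energy_le_sq /(_ tt) h; rewrite -lee_fin; apply: le_trans h.
by rewrite -[X in (X%:E <= _)%E]mul1r -(wt0 lam n); exact: sq_coord.
Qed.

End existence.

(** The nonlinearity costs at most [theta / c <= c / 8] times the dissipation integral, which can be
    subtracted because that integral is finite. The initial datum keeps the constant 1. *)
Lemma semilinear_apriori (z : seqC) T w : 0 <= T -> (forall n, ccont `[0, T] (w^~ n)) ->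
  (forall t, 0 <= t <= T -> (sq 0 (w t) <= r0%:E)%E) ->
  (wint lam l (1 / 2) T w < +oo)%E ->
  (forall t, 0 <= t <= T -> w t = system_duhamel d z (Gcurve w) t) ->
  ((expR (2 * l * T))%:E * sq 0 (w T) + (c / 2)%:E * wint lam l (1 / 2) T w <= sq 0 z)%E.
Proof.
move=> T0 cw wr woo wE.
have mG : forall n, cmeas `[0, T] (fun t => Gcurve w t n) by exact: G_meas.
have := system_energy z d_le l_ge0 c_gt0 T0 mG.
rewrite -(eq_wint (1 / 2) wE) -wE ?T0 ?lexx//.
have := wint_Gcurve T0 cw wr.
set W := wint _ _ (1 / 2) _ _ in woo *; set X := wint _ _ _ _ _ => XW.
have W0 : (0 <= W)%E by exact: wint_ge0.
have Wf : W \is a fin_num by rewrite ge0_fin_numE.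
rewrite -(fineK Wf) in XW *; set V := fine W in XW *.
have V0 : 0 <= V by exact: fine_ge0.
move=> h; have {}h := le_trans h (leeD (lexx _) (lee_wpmul2l _ XW)).
have {h} := h (_ : (0 <= (c^-1)%:E)%E); rewrite lee_fin invr_ge0 (ltW c_gt0) => /(_ isT).
case: (sq 0 z) (sq_ge0 lam 0 z) => [zz| |] //; last by move=> _ _; rewrite leey.
case: (_ * sq 0 (w T))%E => [y| |] //=; last by move=> _ _; rewrite addNye leNye.
rewrite -!EFinM -!EFinD !lee_fin => _ h.
have : c^-1 * (theta * V) <= c / 8 * V.
  rewrite mulrA ler_wpM2r// ler_pdivrMl//; apply: le_trans theta_le _.
  by rewrite le_eqVlt; apply/orP; left; apply/eqP; ring.
have := mulr_ge0 (ltW c_gt0) V0; lra.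
Qed.

End semilinear.

(** * The conjugated nonlinearity *)

Section nonlinearity.
Variables (R : realType) (H : hilbertType R) (A : diagParabolic H).
Local Notation lam := (eigval A).
Local Notation seqC := (nat -> R[i]).
Local Notation Re := complex.Re.
Local Notation Im := complex.Im.
Local Notation D := (spaceD lam).
Local Notation sq := (sqnormD lam).
Variables (F : H -> seqC) (gam eta k0 ph : R).
Hypothesis gam_ge0 : 0 <= gam.
Hypothesis eta_ge0 : 0 <= eta.
Hypothesis k0_ge0 : 0 <= k0.
Hypothesis ph_ge0 : 0 <= ph.
Hypothesis F_map : forall u, D gam (hcoord A u) -> D (- (1 / 2)) (F u).
Hypothesis F_bnd : forall u, D gam (hcoord A u) -> hnorm u <= eta ->
  normD lam (- (1 / 2)) (F u) <= ph * normD lam gam (hcoord A u).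
Hypothesis F_lip : forall u v, D gam (hcoord A u) -> D gam (hcoord A v) ->
  hnorm u <= eta -> hnorm v <= eta ->
  normD lam (- (1 / 2)) (F u - F v) <=
    k0 * (normD lam gam (hcoord A u) + normD lam gam (hcoord A v)) * hnorm (u - v)
    + k0 * ph * normD lam gam (hcoord A (u - v)).

Definition seqF (x : seqC) : seqC := F (toH A x).

Lemma spaceD_D0 x : D gam x -> D 0 x.
Proof. exact: spaceD_mono. Qed.

Lemma hnorm_toH x : D 0 x -> (hnorm (toH A x) ^+ 2)%:E = sq 0 x.
Proof. by move=> xD; rewrite -(parseval A) toHK. Qed.

Lemma hnorm_toH_le x : D gam x -> (sq 0 x <= (eta ^+ 2)%:E)%E -> hnorm (toH A x) <= eta.
Proof.
move=> xD xe; rewrite -(@ler_pXn2r _ 2)// ?nnegrE ?hnorm_ge0//.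
by rewrite -lee_fin hnorm_toH//; exact: spaceD_D0.
Qed.

Lemma toHB x y : D 0 x -> D 0 y -> toH A x - toH A y = toH A (x - y).
Proof.
move=> xD yD; apply: (hcoord_inj (A := A)); rewrite hcoordB !toHK//.
exact: spaceDB.
Qed.

Lemma seqF_D x : D gam x -> D (- (1 / 2)) (seqF x).
Proof. by move=> xD; apply: F_map; rewrite toHK//; exact: spaceD_D0. Qed.

Lemma seqF_bnd x : D gam x -> (sq 0 x <= (eta ^+ 2)%:E)%E ->
  (sq (- (1 / 2)) (seqF x) <= (ph ^+ 2)%:E * sq gam x)%E.
Proof.
move=> xD xe; have h := hnorm_toH_le xD xe.
have hx : hcoord A (toH A x) = x by apply: toHK; exact: spaceD_D0.
have := F_bnd _ h; rewrite hx => /(_ xD) {}h.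
rewrite -(normD_sqr (seqF_D xD)) -(normD_sqr xD) -EFinM lee_fin -exprMn.
by rewrite ler_pXn2r// nnegrE ?mulr_ge0// normD_ge0.
Qed.

(** The factors 4 and 2 come from [(a + b)^2 <= 2 a^2 + 2 b^2], used for the two terms of the
    Lipschitz bound and again for the sum of the two D_gam norms. *)
Lemma seqF_lip x y : D gam x -> D gam y ->
  (sq 0 x <= (eta ^+ 2)%:E)%E -> (sq 0 y <= (eta ^+ 2)%:E)%E ->
  (sq (- (1 / 2)) (seqF x - seqF y)%R <=
    (4 * k0 ^+ 2)%:E * ((sq gam x + sq gam y) * sq 0 (x - y)%R) +
    (2 * (k0 * ph) ^+ 2)%:E * sq gam (x - y)%R)%E.
Proof.
move=> xD yD xe ye; have x0 := spaceD_D0 xD; have y0 := spaceD_D0 yD.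
have := F_lip (u := toH A x) (v := toH A y).
rewrite hcoordB !toHK// toHB// => /(_ xD yD (hnorm_toH_le xD xe) (hnorm_toH_le yD ye)) h.
have xyD := spaceDB xD yD.
rewrite -(normD_sqr (spaceDB (seqF_D xD) (seqF_D yD))) -(normD_sqr xD) -(normD_sqr yD).
rewrite -(normD_sqr xyD) -hnorm_toH; last exact: spaceDB.
rewrite -(EFinD (normD lam gam x ^+ 2)) -!EFinM -EFinD lee_fin.
set p := normD _ _ x in h *; set p' := normD _ _ y in h *; set n := hnorm _ in h *.
set q := normD _ _ (x - y) in h *; set N := normD _ _ _ in h *.
have N0 : 0 <= N by exact: normD_ge0.
apply: (@le_trans _ _ ((k0 * (p + p') * n + k0 * ph * q) ^+ 2)).
  by rewrite ler_pXn2r// nnegrE// (le_trans N0 h).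
have h1 (a b : R) : (a + b) ^+ 2 <= 2 * a ^+ 2 + 2 * b ^+ 2.
  by have := sqr_ge0 (a - b); lra.
apply: le_trans (h1 _ _) _.
have h2 : (p + p') ^+ 2 <= 2 * p ^+ 2 + 2 * p' ^+ 2 by exact: h1.
have h3 := ler_wpM2r (sqr_ge0 n) (ler_wpM2l (sqr_ge0 k0) h2).
rewrite !exprMn; lra.
Qed.

Lemma seqF_local (M : R) x y k (q : R) : D gam x -> D gam y ->
  (sq 0 x <= (eta ^+ 2)%:E)%E -> (sq 0 y <= (eta ^+ 2)%:E)%E ->
  (sq gam x <= M%:E)%E -> (sq gam y <= M%:E)%E -> (sq gam (x - y)%R <= q%:E)%E ->
  csq (seqF x k - seqF y k) <=
    wt lam (1 / 2) k * (8 * k0 ^+ 2 * M + 2 * (k0 * ph) ^+ 2) * q.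
Proof.
move=> xD yD xe ye xM yM xyq.
rewrite -mulrA -ler_pdivrMl ?wt_gt0// -wtN -lee_fin.
have := sq_coord lam (- (1 / 2)) (seqF x - seqF y) k.
move=> /le_trans; apply; apply: le_trans (seqF_lip xD yD xe ye) _.
have M0 : 0 <= M by rewrite -lee_fin (le_trans _ xM)// sq_ge0.
have xyq0 : (sq 0 (x - y)%R <= q%:E)%E by apply: le_trans xyq; exact: sq_mono.
have -> : (8 * k0 ^+ 2 * M + 2 * (k0 * ph) ^+ 2) * q =
    4 * k0 ^+ 2 * ((M + M) * q) + 2 * (k0 * ph) ^+ 2 * q by ring.
rewrite EFinD (EFinM (4 * k0 ^+ 2)) (EFinM (2 * (k0 * ph) ^+ 2)).
apply: leeD; apply: lee_wpmul2l; rewrite ?lee_fin ?mulr_ge0 ?sqr_ge0//.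
rewrite EFinM; apply: lee_pmul; rewrite ?adde_ge0 ?sq_ge0//.
by rewrite EFinD; exact: leeD.
Qed.

(** On sequences with [N] coordinates the D_gam norm is a finite sum, so continuity of the
    coordinates suffices. *)
Lemma ccont_seqF T (u : R -> seqC) N k : (forall n, ccont `[0, T] (u^~ n)) ->
  (forall t, 0 <= t <= T -> (sq 0 (u t) <= (eta ^+ 2)%:E)%E) ->
  ccont `[0, T] (fun t => seqF (seqtrunc N (u t)) k).
Proof.
move=> cu ue.
pose W := \sum_(n < N) wt lam gam n * eta ^+ 2.
pose C := wt lam (1 / 2) k * (8 * k0 ^+ 2 * W + 2 * (k0 * ph) ^+ 2).
have ub t : 0 <= t <= T -> (sq gam (seqtrunc N (u t)) <= W%:E)%E.
  move=> tT; rewrite sq_seqtruncE lee_fin; apply: ler_sum => n _; rewrite ler_wpM2l ?wt_ge0//.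
  by rewrite -lee_fin -[X in (X%:E <= _)%E]mul1r -(wt0 lam n) (le_trans (sq_coord _ _ _ _))// ue.
have W0 : 0 <= W by apply: sumr_ge0 => n _; rewrite mulr_ge0 ?wt_ge0 ?sqr_ge0.
have C0 : 0 <= C by rewrite mulr_ge0 ?wt_ge0// addr_ge0 ?mulr_ge0 ?sqr_ge0.
have uD t : D gam (seqtrunc N (u t)) by exact: spaceD_seqtrunc.
have ue' t : 0 <= t <= T -> (sq 0 (seqtrunc N (u t)) <= (eta ^+ 2)%:E)%E.
  by move=> tT; apply: le_trans (sq_seqtrunc_le _ _ _ _) (ue t tT).
pose r t s := \sum_(n < N) wt lam gam n * csq (u t n - u s n).
have L t s : 0 <= t <= T -> 0 <= s <= T ->
    csq (seqF (seqtrunc N (u t)) k - seqF (seqtrunc N (u s)) k) <= C * r t s.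
  move=> tT sT; apply: (seqF_local k (uD t) (uD s) (ue' t tT) (ue' s sT) (ub t tT) (ub s sT)).
  rewrite (_ : seqtrunc N (u t) - seqtrunc N (u s) = seqtrunc N (u t - u s)) ?sq_seqtruncE//.
  apply/funext => n; rewrite /seqtrunc (_ : (_ - _) n = (if (n < N)%N then u t n else 0) -
    (if (n < N)%N then u s n else 0))//; case: ifP => // _; exact: subrr.
have rc t : `[0, T]%classic t -> r t s @[s --> within `[0, T]%classic (nbhs t)] --> (0 : R).
  by move=> tT; exact: ccont_csq_sum.
apply: ccont_of_csq => t eps tT eps0.
have e2 : 0 < eps / (C + 1) by rewrite divr_gt0// ltr_wpDl.
have tT' : `[0, T]%classic t by rewrite /= in_itv.
have /cvgrPdist_lt /(_ _ e2) rt := rc t tT'.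
have {}rt : \forall s \near t, `[0, T]%classic s -> `|0 - r t s| < eps / (C + 1) := rt.
apply: filterS rt => s + sT; rewrite /= in_itv/= sub0r normrN => /(_ sT).
move=> /(le_lt_trans (ler_norm _)); rewrite ltr_pdivlMr ?ltr_wpDl// => rs.
apply: le_trans (L t s tT sT) _.
have : 0 <= r t s by apply: sumr_ge0 => n _; rewrite mulr_ge0 ?wt_ge0 ?csq_ge0.
lra.
Qed.

(** The curve is only coordinatewise continuous, so [F] along it need not be continuous. It is a
    pointwise limit of its values at truncations, which converge in D_gam wherever [P] holds. *)
Lemma cmeas_seqF T (u : R -> seqC) (P : R -> bool) k : (forall n, ccont `[0, T] (u^~ n)) ->
  (forall t, 0 <= t <= T -> (sq 0 (u t) <= (eta ^+ 2)%:E)%E) ->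
  measurable_fun (`[0, T]%classic : set R) P ->
  (forall t, P t -> D gam (u t)) ->
  cmeas `[0, T] (fun t => if P t then seqF (u t) k else 0).
Proof.
move=> cu ue mP PD.
pose f N t := if P t then seqF (seqtrunc N (u t)) k else 0.
have mI : measurable (`[0, T]%classic : set (measurableTypeR R)) by exact: measurable_itv.
have cf t : 0 <= t <= T -> ccvg (fun N => f N t) (if P t then seqF (u t) k else 0).
  move=> tT; rewrite /f; case: ifPn => Pt; last exact: ccvg_cst.
  have uD := PD t Pt.
  pose M := fine (sq gam (u t)).
  have ME : sq gam (u t) = M%:E by rewrite /M fineK// ge0_fin_numE ?sq_ge0.
  pose C := wt lam (1 / 2) k * (8 * k0 ^+ 2 * M + 2 * (k0 * ph) ^+ 2).
  have tail := sq_tail_cvg uD.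
  apply: (@ccvg_csq_small _ _ _ (fun N => C * fine (sq gam (u t - seqtrunc N (u t))))).
    rewrite -[X in _ --> X](mulr0 C); apply: cvgMr.
    by move/fine_cvgP : tail => [].
  move=> N; apply: seqF_local => //.
  - exact: spaceD_seqtrunc.
  - exact: ue.
  - by apply: le_trans (sq_seqtrunc_le _ _ _ _) (ue t tT).
  - by rewrite ME.
  - by apply: le_trans (sq_seqtrunc_le _ _ _ _) _; rewrite ME.
  rewrite fineK// ge0_fin_numE ?sq_ge0//.
  by apply: spaceDB => //; exact: spaceD_seqtrunc.
have mf N : cmeas `[0, T] (f N).
  have [m1 m2] := cmeas_ccont (ccont_seqF N k cu ue).
  have S (b : bool) : (`[0, T]%classic `&` P @^-1` [set b]) `<=` (`[0, T]%classic : set R).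
    by move=> ? [].
  split.
    rewrite (_ : (fun s => _) = (fun s => if P s then Re (seqF (seqtrunc N (u s)) k) else 0)).
      by apply: measurable_fun_if => //; apply: measurable_funS m1 => //; exact: S.
    by apply/funext => s; rewrite /f; case: ifP.
  rewrite (_ : (fun s => _) = (fun s => if P s then Im (seqF (seqtrunc N (u s)) k) else 0)).
    by apply: measurable_fun_if => //; apply: measurable_funS m2 => //; exact: S.
  by apply/funext => s; rewrite /f; case: ifP.
split.
- apply: (measurable_fun_cvg (h := fun N t => Re (f N t))) => [N|t].
    by case: (mf N).
  by rewrite /= in_itv/= => tT; case: (cf t tT).
- apply: (measurable_fun_cvg (h := fun N t => Im (f N t))) => [N|t].
    by case: (mf N).
  by rewrite /= in_itv/= => tT; case: (cf t tT).
Qed.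

(** * The nonlinearity in the conjugated variable *)

Section conjugated.
Variables (T S : seqC -> seqC) (CT CS s0 r0 : R).
Hypothesis gam_le : gam <= 1 / 2.
Hypothesis T0 : T 0 = 0.
Hypothesis T_lin : forall a x y, D (-1) x -> D (-1) y -> T (a *: x + y) = a *: T x + T y.
Hypothesis T_row : forall n, exists M, forall y, D (-1) y ->
  T y n = \sum_(k < M) y k * T (unitseq R k) n.
Hypothesis S_lin : forall a x y, D (-1) x -> D (-1) y -> S (a *: x + y) = a *: S x + S y.
Hypothesis S_row : forall n, exists M, forall y, D (-1) y ->
  S y n = \sum_(k < M) y k * S (unitseq R k) n.
Hypothesis CT_ge0 : 0 <= CT.
Hypothesis CS_ge0 : 0 <= CS.
Hypothesis s0_ge0 : 0 <= s0.
Hypothesis T_bnd : forall y, D (- (1 / 2)) y ->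
  (sq (- (1 / 2)) (T y) <= CT%:E * sq (- (1 / 2)) y)%E.
Hypothesis S_bnd : forall y, D gam y -> (sq gam (S y) <= CS%:E * sq gam y)%E.
Hypothesis S_bnd0 : forall y, D 0 y -> (sq 0 (S y) <= s0%:E * sq 0 y)%E.
Hypothesis r0_le : s0 * r0 <= eta ^+ 2.

Definition conjG (w : seqC) : seqC := T (seqF (S w)).

Let halfD w : D (1 / 2) w -> D gam w. Proof. exact: spaceD_mono. Qed.
Let half0 w : D (1 / 2) w -> D 0 w. Proof. by apply: spaceD_mono. Qed.
Let halfm w : D (1 / 2) w -> D (-1) w. Proof. by apply: spaceD_mono; lra. Qed.
Let nhalfm w : D (- (1 / 2)) w -> D (-1) w. Proof. by apply: spaceD_mono; lra. Qed.

Let S_D w : D (1 / 2) w -> D gam (S w).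
Proof. by move=> wD; apply: le_lt_trans (S_bnd (halfD wD)) _; rewrite lte_mul_pinfty//; exact: halfD. Qed.

Let S_small w : D 0 w -> (sq 0 w <= r0%:E)%E -> (sq 0 (S w) <= (eta ^+ 2)%:E)%E.
Proof.
move=> wD wr; apply: le_trans (S_bnd0 wD) _.
apply: (@le_trans _ _ (s0%:E * r0%:E)%E); first by apply: lee_wpmul2l.
by rewrite -EFinM lee_fin.
Qed.

Lemma conjG_bnd w : D (1 / 2) w -> (sq 0 w <= r0%:E)%E ->
  (sq (- (1 / 2)) (conjG w) <= (CT * (ph ^+ 2 * CS))%:E * sq (1 / 2) w)%E.
Proof.
move=> wD wr; have SwD := S_D wD; have Sws := S_small (half0 wD) wr.
apply: le_trans (T_bnd (seqF_D SwD)) _.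
rewrite EFinM -muleA; apply: lee_wpmul2l => //.
apply: le_trans (seqF_bnd SwD Sws) _; rewrite (EFinM (ph ^+ 2)) -muleA.
apply: lee_wpmul2l; first by rewrite lee_fin sqr_ge0.
apply: le_trans (S_bnd (halfD wD)) _; apply: lee_wpmul2l => //.
exact: sq_mono.
Qed.

Lemma conjG_lip w v : D (1 / 2) w -> D (1 / 2) v ->
  (sq 0 w <= r0%:E)%E -> (sq 0 v <= r0%:E)%E ->
  (sq (- (1 / 2)) (conjG w - conjG v)%R <=
    (CT * (4 * k0 ^+ 2 * (CS * s0)))%:E * ((sq (1 / 2) w + sq (1 / 2) v) * sq 0 (w - v)%R) +
    (CT * (2 * (k0 * ph) ^+ 2 * CS))%:E * sq (1 / 2) (w - v)%R)%E.
Proof.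
move=> wD vD wr vr; have SwD := S_D wD; have SvD := S_D vD.
have wvD := spaceDB wD vD.
have Swv : S w - S v = S (w - v) by rewrite (blockB S_lin)//; exact: halfm.
rewrite /conjG -(blockB T_lin); [|exact/nhalfm/seqF_D|exact/nhalfm/seqF_D].
apply: le_trans (T_bnd (spaceDB (seqF_D SwD) (seqF_D SvD))) _.
have k20 : 0 <= 4 * k0 ^+ 2 by rewrite mulr_ge0 ?sqr_ge0.
have kp0 : 0 <= 2 * (k0 * ph) ^+ 2 by rewrite mulr_ge0 ?sqr_ge0.
apply: (le_trans (lee_wpmul2l _ (seqF_lip SwD SvD (S_small (half0 wD) wr) (S_small (half0 vD) vr)))) => //.
rewrite Swv ge0_muleDr; last 2 first.
- by rewrite !mule_ge0 ?adde_ge0 ?sq_ge0.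
- by rewrite mule_ge0 ?sq_ge0.
have B x : D (1 / 2) x -> (sq gam (S x) <= CS%:E * sq (1 / 2) x)%E.
  move=> xD; apply: le_trans (S_bnd (halfD xD)) _; apply: lee_wpmul2l => //; exact: sq_mono.
apply: leeD.
  rewrite (EFinM CT) -muleA; apply: lee_wpmul2l => //.
  rewrite (EFinM (4 * k0 ^+ 2)) -muleA; apply: lee_wpmul2l => //.
  apply: (@le_trans _ _ ((CS%:E * (sq (1 / 2) w + sq (1 / 2) v)) * (s0%:E * sq 0 (w - v)%R))%E).
    apply: lee_pmul; rewrite ?adde_ge0 ?sq_ge0//.
      by rewrite ge0_muleDr ?sq_ge0//; apply: leeD; exact: B.
    by apply: S_bnd0; exact: half0.
  by rewrite -!muleA (muleCA _ s0%:E) (EFinM CS) -muleA.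
rewrite (EFinM CT) -muleA; apply: lee_wpmul2l => //.
rewrite (EFinM (2 * (k0 * ph) ^+ 2)) -muleA; apply: lee_wpmul2l => //.
exact: B.
Qed.

Lemma ccont_row (X : seqC -> seqC) T' (w : R -> seqC) n :
  (exists M, forall y, D (-1) y -> X y n = \sum_(k < M) y k * X (unitseq R k) n) ->
  (forall k, ccont `[0, T'] (w^~ k)) -> (forall t, 0 <= t <= T' -> D (-1) (w t)) ->
  ccont `[0, T'] (fun t => X (w t) n).
Proof.
move=> [M HM] cw wD.
apply: (@eq_ccont _ _ _ (fun t => \sum_(k < M) w t k * X (unitseq R k) n)).
  by move=> t tT; rewrite HM//; exact: wD.
by apply: ccont_sum => k; apply: ccontM => //; exact: ccont_cst.
Qed.

(* The nonlinearity along a curve, set to 0 at the negligible times where the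
   curve leaves the domain. *)
Definition Fcurve (w : R -> seqC) (t : R) : seqC :=
  if `[< D (1 / 2) (w t) >] then seqF (S (w t)) else 0.

Lemma Gcurve_conjG w t : Gcurve lam conjG w t = T (Fcurve w t).
Proof. by rewrite /Gcurve /Fcurve; case: asboolP. Qed.

Lemma Fcurve_D w t : D (- (1 / 2)) (Fcurve w t).
Proof.
rewrite /Fcurve; case: asboolP => [wD|_]; last exact: spaceD0.
exact/seqF_D/S_D.
Qed.

Lemma Fcurve_bnd w t : D 0 (w t) -> (sq 0 (w t) <= r0%:E)%E ->
  (sq (- (1 / 2)) (Fcurve w t) <= (ph ^+ 2 * CS)%:E * sq (1 / 2) (w t))%E.
Proof.
move=> wD wr; rewrite /Fcurve; case: asboolP => [w2|_].
  apply: le_trans (seqF_bnd (S_D w2) (S_small wD wr)) _; rewrite (EFinM (ph ^+ 2)) -muleA.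
  apply: lee_wpmul2l; first by rewrite lee_fin sqr_ge0.
  apply: le_trans (S_bnd (halfD w2)) _; apply: lee_wpmul2l => //.
  exact: sq_mono.
by rewrite sq0 mule_ge0 ?sq_ge0// lee_fin mulr_ge0// sqr_ge0.
Qed.

Lemma Fcurve_meas T' (w : R -> seqC) : (forall n, ccont `[0, T'] (w^~ n)) ->
  (forall t, 0 <= t <= T' -> (sq 0 (w t) <= r0%:E)%E) ->
  forall n, cmeas `[0, T'] (fun t => Fcurve w t n).
Proof.
move=> cw wr n.
have mI : measurable (`[0, T']%classic : set (measurableTypeR R)) by exact: measurable_itv.
have wD0 t : 0 <= t <= T' -> D 0 (w t) by move=> tT; apply: le_lt_trans (wr t tT) _; rewrite ltry.
have cSw k : ccont `[0, T'] (fun t => S (w t) k).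
  apply: ccont_row => // t tT; apply: spaceD_mono (wD0 t tT); lra.
pose P t := `[< D (1 / 2) (w t) >].
(* The times spent in D_(1/2) are those where the measurable function [sq (1 / 2) (w t)] is
   finite. *)
have mP : measurable_fun (`[0, T']%classic : set R) P.
  apply: (measurable_fun_bool true).
  have := emeasurable_fun_infty_o mI (measurable_sq lam (1 / 2) (fun n => cmeas_ccont (cw n))) +oo%E.
  by congr measurable; apply/seteqP; split=> t [tT] /= h; split=> //=; [apply/asboolP|apply/asboolP].
rewrite (_ : (fun t => _) = fun t => if P t then seqF (S (w t)) n else 0); last first.
  by apply/funext => t; rewrite /Fcurve /P; case: ifP.
apply: (@cmeas_seqF T' (fun t => S (w t))) => //.
- by move=> t tT; apply: S_small; [exact: wD0|exact: wr].
- by move=> t /asboolP; exact: S_D.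
Qed.

Lemma conjG_meas T' (w : R -> seqC) : 0 <= T' -> (forall n, ccont `[0, T'] (w^~ n)) ->
  (forall t, 0 <= t <= T' -> (sq 0 (w t) <= r0%:E)%E) ->
  forall n, cmeas `[0, T'] (fun t => Gcurve lam conjG w t n).
Proof.
move=> T'0 cw wr n; have [M HM] := T_row n.
rewrite (_ : (fun t => _) = fun t => \sum_(k < M) Fcurve w t k * T (unitseq R k) n).
  by apply: cmeas_sum => k; apply: cmeasM; [exact: Fcurve_meas|exact: cmeas_cst].
by apply/funext => t; rewrite Gcurve_conjG HM//; exact/nhalfm/Fcurve_D.
Qed.

End conjugated.
End nonlinearity.

(** * Spectral gap of the shifted operator *)

Section gap.
Variables (R : realType) (H : hilbertType R) (A : diagParabolic H) (l mu : R).
Local Notation lam := (eigval A).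
Local Notation Re := complex.Re.
Local Notation Im := complex.Im.

Lemma Re_le_c n : Re (lam n) <= c_ A.
Proof.
rewrite /c_ le_max; apply/orP; right; apply: ub_le_sup; last by exists n.
exists (Re (lam 0%N)) => _ [k _ <-].
by case: (eigval_parabolic A) => dec _ _; exact: dec.
Qed.

(** For finitely many indices the strict inequality is enough. For the others the sector condition
    bounds the weight of D_(1/2) by a multiple of [|Re (lam n)|], and half of that real part
    dominates [l]. *)
Lemma spectral_gap : 0 < l -> l + c_ A < mu -> exists2 c : R, 0 < c &
  forall n, Re (eigval_mu A l mu n) <= - (l + c * wt lam (1 / 2) n).
Proof.
move=> l0 lmu; case: (eigval_parabolic A) => _ _ [C C0 HC].
(* Once [Re (lam n)^2 >= 1], one has [1 + |lam n|^2 <= (2 + C^-2) Re (lam n)^2]. *)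
pose K := 2 + (C^-1) ^+ 2.
have K0 : 0 < K by rewrite ltr_pwDl ?sqr_ge0.
pose g n := - Re (eigval_mu A l mu n) - l.
have mu0 : 0 <= mu.
  by apply: ltW; apply: lt_trans lmu; rewrite ltr_pwDl// /c_ le_max lexx.
have gpos n : 0 < g n.
  rewrite /g /eigval_mu /lowb cReD cReN; case: ifP => [_ /=|/negbT].
    by have := Re_le_c n; lra.
  by rewrite -ltNge /=; lra.
have wpos n : 0 < wt lam (1 / 2) n by exact: wt_gt0.
(* This threshold gives both [|Re (lam n)| >= 1] and [|Re (lam n)| <= 2 g n]. *)
have [N HN] := Re_lam_lt (eigval_parabolic A) (- (2 * l + 1)).
have [||c c0 Hc] := @finite_positive_lbound R xpredT (fun n => 2 * K * (g n / wt lam (1 / 2) n)) N.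
- by move=> n _; rewrite !mulr_gt0// invr_gt0.
- move=> n Nn _; have := HN n Nn => h.
  have Kge1 : 1 <= K by rewrite /K; have := sqr_ge0 (C^-1); lra.
  have wle : wt lam (1 / 2) n <= K * - Re (lam n).
    rewrite -(@ler_pXn2r _ 2)// ?nnegrE ?wt_ge0 ?mulr_ge0 ?(ltW K0)//; last by lra.
    rewrite expr2 -wtD (_ : 1 / 2 + 1 / 2 = 1); last by field.
    rewrite /wt powRr1 ?addr_ge0 ?sqr_ge0// cabs_sqr /csq exprMn sqrrN.
    have hI : Im (lam n) ^+ 2 <= (C^-1) ^+ 2 * Re (lam n) ^+ 2.
      have hh : `|Im (lam n)| <= `|C^-1 * Re (lam n)|.
        by rewrite normrM (ger0_norm (_ : 0 <= C^-1)) ?invr_ge0 ?(ltW C0)// ler_pdivlMl.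
      rewrite -exprMn -(real_normK (num_real (Im (lam n)))).
      rewrite -(real_normK (num_real (C^-1 * Re (lam n)))).
      by rewrite ler_pXn2r ?nnegrE.
    have hR : 1 <= Re (lam n) ^+ 2 by nra.
    apply: (@le_trans _ _ (K * Re (lam n) ^+ 2)); last first.
      by rewrite ler_wpM2r ?sqr_ge0// expr2 ler_peMr// ltW.
    rewrite /K mulrDl; move: (C^-1 ^+ 2 * _) hI => k2; move: (Re (lam n) ^+ 2) hR => rr.
    by move: (Im (lam n) ^+ 2) => ii; lra.
  have gge : - Re (lam n) <= 2 * g n.
    rewrite /g /eigval_mu cReD cReN; case: ifP => _ /=; lra.
  rewrite mulrA ler_pdivlMr// (mul1r (wt _ _ _)); apply: le_trans wle _.
  by rewrite (_ : 2 * K * g n = K * (2 * g n)) ?ler_wpM2l ?(ltW K0)//; ring.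
exists (c / (2 * K)); first by rewrite divr_gt0// mulr_gt0.
move=> n; have := Hc n isT; rewrite mulrA ler_pdivlMr// => h.
suff : c / (2 * K) * wt lam (1 / 2) n <= g n by rewrite /g; lra.
by rewrite mulrAC ler_pdivrMr ?mulr_gt0// (mulrC (g n)).
Qed.

End gap.

(** * Curves in the Hilbert space *)

Section curve.
Variables (R : realType) (lam d z : nat -> R[i]) (g : R -> nat -> R[i]) (l c T : R).
Local Notation Re := complex.Re.
Local Notation seqC := (nat -> R[i]).
Local Notation sq := (sqnormD lam).
Local Notation D := (spaceD lam).
Hypothesis g_meas : forall n, cmeas `[0, T] (g^~ n).

(** Let [x n] be the weighted L^2 norm in time of coordinate [n]. Then [wint] is the squared D_r
    norm of the single sequence [x], whose tails tend to 0. *)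
Lemma wint_tail_small r (eps : R) : (wint lam l r T g < +oo)%E -> 0 < eps ->
  exists N0, forall N, (N0 <= N)%N ->
    (wint lam l r T (fun s => g s - seqtrunc N (g s))%R <= eps%:E)%E.
Proof.
move=> gfin eps0.
pose I n := \int[leb]_(s in `[0, T]) (expR (2 * l * s) * csq (g s n)).
pose x : seqC := fun n => (Num.sqrt (I n))%:C%C.
have xE n : csq (x n) = I n.
  rewrite csq_real sqr_sqrtr//; apply: Rintegral_ge0 => s _.
  by rewrite mulr_ge0 ?expR_ge0 ?csq_ge0.
have E (P : pred nat) : wint lam l r T (fun s n => if P n then g s n else 0) =
    sq r (fun n => if P n then x n else 0).
  rewrite wintE; last first.
    by move=> n; case: (P n) => //; exact: cmeas_cst.
  rewrite sqnormDE; apply: eq_eseriesr => n _; case: (P n).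
    rewrite xE EFinM; congr (_ * _)%E.
    by rewrite EFin_Rintegral//; exact: (wint_itg g_meas _ gfin).
  rewrite csq0 integral0_eq ?mule0 ?mulr0// => s _.
  by rewrite mulr0.
have x_fin : (sq r x < +oo)%E by have := E xpredT; rewrite /= => <-.
have [N0 HN] := sq_tail_small x_fin eps0; exists N0 => N /HN; congr (_ <= _)%E.
have -> : (fun s => g s - seqtrunc N (g s)) = (fun s n => if (N <= n)%N then g s n else 0).
  apply/funext => s; apply/funext => n; rewrite /seqtrunc (_ : (_ - _) n =
    g s n - (if (n < N)%N then g s n else 0))// ltnNge; case: (N <= n)%N; rewrite /= ?subr0//.
  exact: subrr.
rewrite E; congr (sq r _); apply/funext => n; rewrite /seqtrunc (_ : (_ - _) n =
  x n - (if (n < N)%N then x n else 0))// ltnNge; case: (N <= n)%N; rewrite /= ?subr0//.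
exact: subrr.
Qed.

Hypothesis d_le : forall n, Re (d n) <= - (l + c * wt lam (1 / 2) n).
Hypothesis l_ge0 : 0 <= l.
Hypothesis c_gt0 : 0 < c.
Hypothesis T_ge0 : 0 <= T.
Hypothesis z_D : D 0 z.
Hypothesis g_fin : (wint lam l (- (1 / 2)) T g < +oo)%E.
Local Notation w := (system_duhamel d z g).

Lemma system_duhamel_ccont n : ccont `[0, T] (w^~ n).
Proof. by apply: duhamel_cont => //; exact: (citg_wint l_ge0 g_meas n g_fin). Qed.

(** The system is diagonal, so the tail of the solution is the solution for the tails of the data;
    the energy estimate bounds it uniformly in time. *)
Lemma system_tail_small (eps : R) : 0 < eps -> exists N, forall t, 0 <= t <= T ->
  (sq 0 (w t - seqtrunc N (w t))%R <= eps%:E)%E.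
Proof.
move=> eps0.
have e1 : 0 < eps / 2 by lra.
have e2 : 0 < c * (eps / 2) by rewrite mulr_gt0.
have [N1 H1] := sq_tail_small z_D e1.
have [N2 H2] := wint_tail_small g_fin e2.
exists (maxn N1 N2) => t /andP[t0 tT]; set N := maxn _ _.
pose gN s := g s - seqtrunc N (g s).
have gNE s n : gN s n = if (N <= n)%N then g s n else 0.
  rewrite /gN /seqtrunc (_ : (_ - _) n = g s n - (if (n < N)%N then g s n else 0))//.
  by rewrite ltnNge; case: (N <= n)%N; rewrite /= ?subr0//; exact: subrr.
have mgN n : cmeas `[0, T] (gN^~ n).
  rewrite (_ : (fun s => _) = if (N <= n)%N then g^~ n else fun=> 0).
    by case: ifP => // _; exact: cmeas_cst.
  by apply/funext => s; rewrite gNE; case: ifP.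
have -> : w t - seqtrunc N (w t) = system_duhamel d (z - seqtrunc N z) gN t.
  apply/funext => n; rewrite /seqtrunc (_ : (_ - _) n = w t n - (if (n < N)%N then w t n else 0))//.
  rewrite /system_duhamel (_ : (gN^~ n) = fun s => if (N <= n)%N then g s n else 0); last first.
    by apply/funext => s; exact: gNE.
  rewrite (_ : (_ - _) n = z n - (if (n < N)%N then z n else 0))// ltnNge.
  case: (N <= n)%N => /=; first by rewrite !subr0.
  rewrite !subrr /duhamel mulr0 add0r (_ : cint _ _ = cint `[0, t] (fun=> 0)); last first.
    by apply: eq_cint => s _; rewrite mulr0.
  by rewrite /cint /= Rintegral_cst ?mul0r//; exact: measurable_itv.
have h := system_energy (z - seqtrunc N z) d_le l_ge0 c_gt0 t0 (cmeasS tT mgN).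
apply: (@le_trans _ _ ((expR (2 * l * t))%:E * sq 0 (system_duhamel d (z - seqtrunc N z)%R gN t))%E).
  exact: sq_le_expR.
apply: le_trans (le_trans _ h) _.
  by rewrite leeDl// mule_ge0 ?wint_ge0// lee_fin ltW.
rewrite (splitr eps) EFinD; apply: leeD; first by apply: H1; exact: leq_maxl.
have -> : (eps / 2)%:E = ((c^-1)%:E * (c * (eps / 2))%:E)%E.
  by rewrite -EFinM mulKf// gt_eqF.
apply: lee_wpmul2l; first by rewrite lee_fin invr_ge0 ltW.
by apply: le_trans (wint_mono lam l _ tT mgN) _; apply: H2; exact: leq_maxr.
Qed.

(** Strong continuity in H: finitely many continuous coordinates plus a tail that is uniformly small
    in time. *)
Lemma system_sq0_cont t (eps : R) : 0 < eps -> 0 <= t <= T ->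
  \forall s \near t, 0 <= s <= T -> (sq 0 (w t - w s)%R <= eps%:E)%E.
Proof.
move=> eps0 tT.
(* Chosen so that [2 (2 eps/16 + 2 eps/16) + 2 eps/4 = eps]. *)
have e1 : 0 < eps / 16 by lra.
have e2 : 0 < eps / 4 by lra.
have [N HN] := system_tail_small e1.
have tT' : `[0, T]%classic t by rewrite /= in_itv.
have := ccont_csq_sum (wt lam 0) N system_duhamel_ccont tT'.
move=> /cvgrPdist_lt /(_ _ e2) rt.
have {}rt : \forall s \near t, `[0, T]%classic s ->
  `|0 - \sum_(n < N) wt lam 0 n * csq (w t n - w s n)| < eps / 4 := rt.
apply: filterS rt => s + sT; rewrite sub0r normrN /= in_itv /= => /(_ sT).
move=> /(le_lt_trans (ler_norm _)) rs.
rewrite (_ : w t - w s = ((w t - seqtrunc N (w t)) - (w s - seqtrunc N (w s))) +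
  seqtrunc N (w t - w s)); last first.
  apply/funext => n; rewrite /seqtrunc.
  rewrite (_ : (_ + _) n = (w t n - (if (n < N)%N then w t n else 0)) -
    (w s n - (if (n < N)%N then w s n else 0)) + (if (n < N)%N then w t n - w s n else 0))//.
  by case: ifP => _; rewrite (_ : (_ - _) n = w t n - w s n)//; ring.
apply: le_trans (sqDr _ _ _ _) _; rewrite sq_seqtruncE.
apply: (@le_trans _ _ (2%:E * (2%:E * (eps / 16)%:E + 2%:E * (eps / 16)%:E) + 2%:E * (eps / 4)%:E)%E).
  apply: leeD; apply: lee_wpmul2l => //.
    by apply: le_trans (sqBr _ _ _ _) _; apply: leeD; apply: lee_wpmul2l => //; exact: HN.
  by rewrite lee_fin ltW.
by rewrite -!EFinM -!EFinD lee_fin; lra.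
Qed.

End curve.

(** * Continuous curves in H and the continuity method *)

Section hilbert_curves.
Variables (R : realType) (H : hilbertType R) (A : diagParabolic H).
Local Notation lam := (eigval A).
Local Notation Re := complex.Re.
Local Notation sq := (sqnormD lam).

Lemma hcurve_continuous (u : R -> H) :
  (forall T t eps : R, 0 <= t <= T -> 0 < eps ->
    \forall s \near t, 0 <= s <= T -> (sq 0 (hcoord A (u t) - hcoord A (u s))%R <= eps%:E)%E) ->
  {within `[0, +oo[, continuous u}.
Proof.
move=> h; apply/subspace_continuousP => t; rewrite /= in_itv/= andbT => t0.
apply/cvgrPdist_lt => e e0.
have eE : e = ((Re e)%:C)%C by rewrite RRe_real// gtr0_real.
have e1 := Re_gt0 e0; rewrite eE.
have e2 : 0 < (Re e / 2) ^+ 2 by rewrite exprn_gt0// divr_gt0.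
have tT : 0 <= t <= t + 1 by rewrite t0 lerDl ler01.
have /= h1 := h (t + 1) t _ tT e2.
have h2 : \forall s \near t, s < t + 1 by apply: lt_nbhsl; rewrite ltrDl.
apply: filterS2 h1 h2 => s hs st; rewrite /= in_itv/= andbT => s0.
rewrite norm_hnorm ltcR; have := hs _; rewrite s0 (ltW st) => /(_ isT).
rewrite -hcoordB parseval lee_fin ler_pXn2r ?nnegrE ?hnorm_ge0 ?divr_ge0 ?(ltW e1)// => /le_lt_trans.
by apply; lra.
Qed.

Lemma hcurve_near (u : R -> H) (t eps : R) : {within `[0, +oo[, continuous u} ->
  0 <= t -> 0 < eps ->
  \forall s \near t, 0 <= s -> hnorm (u t - u s) < eps.
Proof.
move=> /subspace_continuousP /(_ t) + t0 eps0; rewrite /= in_itv/= andbT => /(_ t0).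
move=> /cvgrPdist_lt /(_ (eps%:C)%C); rewrite ltcR => /(_ eps0) ut.
have {}ut : \forall s \near t, `[0, +oo[%classic s -> `|u t - u s| < (eps%:C)%C := ut.
apply: filterS ut => s /= h s0.
by have := h; rewrite in_itv/= s0 norm_hnorm ltcR; apply.
Qed.

Lemma hcurve_ccont (u : R -> H) (T : R) n : {within `[0, +oo[, continuous u} ->
  ccont `[0, T] (fun t => hcoord A (u t) n).
Proof.
move=> cu; apply: ccont_of_csq => t eps /andP[t0 tT] eps0.
have e1 : 0 < Num.sqrt eps by rewrite sqrtr_gt0.
have := hcurve_near cu t0 e1; apply: filterS => s hs /andP[/hs {}hs _].
rewrite (_ : _ - _ = hcoord A (u t - u s) n); last by rewrite hcoordB.
apply: le_trans (csq_hcoord_le _ _ _) _.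
rewrite -[leRHS](@sqr_sqrtr _ eps) ?(ltW eps0)// ler_pXn2r// ?nnegrE ?hnorm_ge0 ?sqrtr_ge0//.
exact: ltW.
Qed.

(** Continuity method: at the supremum of the times up to which the curve stays below [b'], the
    improved bound [b < b'] leaves room to go further. *)
Lemma hcurve_bootstrap (u : R -> H) (b b' : R) : {within `[0, +oo[, continuous u} ->
  b < b' -> hnorm (u 0) <= b ->
  (forall t, 0 <= t -> (forall s, 0 <= s <= t -> hnorm (u s) <= b') -> hnorm (u t) <= b) ->
  forall t, 0 <= t -> hnorm (u t) <= b'.
Proof.
move=> cu bb' u0b step.
pose E : set R := [set t | 0 <= t /\ forall s, 0 <= s <= t -> hnorm (u s) <= b'].
have E0 : E 0.
  by split=> // s /le_anti <-; apply: le_trans u0b (ltW bb').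
have [ubE|nubE] := pselect (has_ubound E); last first.
  move=> t t0; apply: contrapT => ut; apply: nubE; exists t => s [s0 hs].
  by rewrite leNgt; apply/negP => ts; apply: ut; apply: hs; rewrite t0 ltW.
have supE : has_sup E by split=> //; exists 0.
set r := sup E.
have r0 : 0 <= r by apply: ub_le_sup.
have ltr s : 0 <= s -> s < r -> hnorm (u s) <= b'.
  move=> s0 sr; have rs0 : 0 < r - s by rewrite subr_gt0.
  have [t [t0 ht]] := sup_adherent rs0 supE; rewrite -/r subKr => st.
  by apply: ht; rewrite s0 ltW.
have stay t (p : R) : 0 <= t -> 0 < p -> exists2 e : R, 0 < e &
    forall s, 0 <= s -> `|t - s| < e -> hnorm (u t - u s) < p.
  move=> t0 p0; have /nbhs_ballP[e e0 he] := hcurve_near cu t0 p0.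
  by exists e => // s s0 ts; exact: he.
have ur : hnorm (u r) <= b'.
  rewrite leNgt; apply/negP => ur.
  have rpos : 0 < r.
    rewrite lt_neqAle r0 andbT; apply/negP => /eqP r0'; move: ur; rewrite -r0'.
    by rewrite ltNge (le_trans u0b)// ltW.
  have [|e e0 he] := stay r (hnorm (u r) - b') r0; first by rewrite subr_gt0.
  (* A time slightly before [r], kept nonnegative by the bound [r / 2], at which the curve is still
     below [b']. *)
  pose s := r - Num.min (e / 2) (r / 2).
  have m1 : Num.min (e / 2) (r / 2) <= r / 2 by rewrite ge_min lexx orbT.
  have m2 : Num.min (e / 2) (r / 2) <= e / 2 by rewrite ge_min lexx.
  have m0 : 0 < Num.min (e / 2) (r / 2) by rewrite lt_min !divr_gt0.
  have s0 : 0 <= s by rewrite /s; lra.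
  have := he s s0; rewrite (_ : r - s = Num.min (e / 2) (r / 2)); last by rewrite /s; ring.
  rewrite gtr0_norm// => /(_ ltac:(lra)).
  have := ltr s s0 ltac:(rewrite /s; lra).
  have := hnormD (u r - u s) (u s); rewrite subrK; lra.
have Er : forall s, 0 <= s <= r -> hnorm (u s) <= b'.
  by move=> s /andP[s0]; rewrite le_eqVlt => /orP[/eqP ->//|]; exact: ltr.
have urb := step r r0 Er.
(* The margin [b' - b] extends the bound past [r], against the choice of [r] as a supremum. *)
have [|e e0 he] := stay r (b' - b) r0; first by rewrite subr_gt0.
have : E (r + e / 2).
  split; first by rewrite addr_ge0// divr_ge0// ltW.
  move=> s /andP[s0 sr]; have [sr'|rs] := leP s r; first by apply: Er; rewrite s0.
  have := he s s0; rewrite ltr0_norm ?subr_lt0// opprB => /(_ ltac:(lra)) h.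
  have := hnormD (u r) (u s - u r); rewrite addrC subrK.
  by rewrite -hnormN opprB in h; lra.
move=> /(ub_le_sup ubE); rewrite -/r; lra.
Qed.

End hilbert_curves.

(** * Conjugation of mild solutions *)

Section forcing.
Variables (R : realType) (H : hilbertType R) (A : diagParabolic H).
Local Notation lam := (eigval A).
Local Notation seqC := (nat -> R[i]).
Local Notation sq := (sqnormD lam).
Local Notation D := (spaceD lam).

Lemma measurable_normD (I : set R) r (f : R -> seqC) : (forall n, cmeas I (f^~ n)) ->
  measurable_fun I (fun s => normD lam r (f s)).
Proof.
move=> mf; rewrite /normD.
have h := measurable_sq lam r mf.
have : measurable_fun I (fun s => fine (sq r (f s))).
  by apply: measurableT_comp h.
by move=> h'; apply: measurableT_comp h'; apply: continuous_measurable_fun; exact: sqrt_continuous.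
Qed.

(** Coordinate [n] is a bounded functional on D(A)', with norm at most [k]. *)
Lemma citg_bochner (T : R) (f : R -> seqC) n :
  bochner_integrable A `[0, T] f -> citg `[0, T] (f^~ n).
Proof.
move=> [fD fr fi fint].
have mf k : cmeas `[0, T] (f^~ k) by split; [exact: fr|exact: fi].
have mI : measurable (`[0, T]%classic : set (measurableTypeR R)) by exact: measurable_itv.
have iN : leb.-integrable `[0, T] (EFin \o (fun s => normD lam (-1) (f s))).
  apply/integrableP; split; first by apply/measurable_EFinP; exact: measurable_normD.
  apply: le_lt_trans fint; rewrite le_eqVlt; apply/orP; left; apply/eqP.
  by apply: eq_integral => s _ /=; rewrite ger0_norm// normD_ge0.
pose k := Num.sqrt (wt lam 1 n).
have le (p : R[i] -> R) s : (forall y, p y ^+ 2 <= csq y) -> `[0, T]%classic s ->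
    `|p (f s n)| <= k * normD lam (-1) (f s).
  move=> pl sT; rewrite -(@ler_pXn2r _ 2)// ?nnegrE ?mulr_ge0 ?sqrtr_ge0 ?normD_ge0//.
  rewrite real_normK ?num_real// exprMn sqr_sqrtr ?wt_ge0//.
  apply: le_trans (pl _) _; rewrite -ler_pdivrMl ?wt_gt0// -wtN -lee_fin.
  by rewrite normD_sqr; [exact: sq_coord|exact: fD].
have P (p : R[i] -> R) : (forall y, p y ^+ 2 <= csq y) ->
    measurable_fun (`[0, T]%classic : set R) (fun s => p (f s n)) ->
    leb.-integrable `[0, T] (EFin \o (fun s => p (f s n))).
  move=> pl mp; apply: (le_integrable mI _ _ (itgZ k mI iN)).
    exact/measurable_EFinP.
  move=> s sT /=; rewrite lee_fin (le_trans (le p s pl sT))//.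
  exact: ler_norm.
by split; apply: P => // y; rewrite /csq ?lerDl ?lerDr ?sqr_ge0.
Qed.

Lemma bochner_of_wint l r (T : R) (f : R -> seqC) : 0 <= l -> -1 <= r -> 0 <= T ->
  (forall n, cmeas `[0, T] (f^~ n)) -> (forall t, 0 <= t <= T -> D (-1) (f t)) ->
  (wint lam l r T f < +oo)%E -> bochner_integrable A `[0, T] f.
Proof.
move=> l0 r1 T0 mf fD ffin; split; [|by move=> n; case: (mf n)|by move=> n; case: (mf n)|].
  by move=> t /=; rewrite in_itv; exact: fD.
have mI : measurable (`[0, T]%classic : set (measurableTypeR R)) by exact: measurable_itv.
have mw := measurable_wint lam l r mf.
apply: (@le_lt_trans _ _ (\int[leb]_(s in `[0%R, T]) (1 + (expR (2 * l * s))%:E * sq r (f s)))%E).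
  apply: ge0_le_integral => //.
  - by move=> s _; rewrite lee_fin normD_ge0.
  - by apply/measurable_EFinP; exact: measurable_normD.
  - by apply: emeasurable_funD => //; exact: measurable_cst.
  move=> s; rewrite /= in_itv/= => sT; have fs := fD s sT.
  apply: (@le_trans _ _ (1 + (normD lam (-1) (f s) ^+ 2)%:E)%E).
    rewrite -EFinD lee_fin -[normD_ A _ _]/(normD lam (-1) (f s)).
    by have := sqr_ge0 (normD lam (-1) (f s) - 1); have := normD_ge0 lam (-1) (f s); nra.
  apply: leeD => //; rewrite normD_sqr//.
  apply: le_trans (sq_mono _ _ r1) _.
  by case/andP: sT => s0 _; exact: sq_le_expR.
rewrite ge0_integralD//; last by move=> s _; rewrite mule_ge0 ?sq_ge0// lee_fin expR_ge0.
apply: lte_add_pinfty => //.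
have /integrableP[_] : leb.-integrable `[0, T] (EFin \o (fun=> 1 : R)).
  by apply: itg_cont; apply: within_cont; exact: cst_continuous.
apply: le_lt_trans; rewrite le_eqVlt; apply/orP; left; apply/eqP.
by apply: eq_integral => s _ /=; rewrite normr1.
Qed.

(** Duhamel's formula is turned into the integrated equation, where each coordinate of [X] is a
    finite sum and passes through the integral; the intertwining relation rewrites the integrand,
    and [weak_duhamel] leads back. It is applied to [T] and to its inverse. *)
Lemma weak_transform (X : seqC -> seqC) (d d' x0 : seqC) (h g x : R -> seqC) (T : R) :
  (forall n, exists M, forall y, D (-1) y -> X y n = \sum_(k < M) y k * X (unitseq R k) n) ->
  D (-1) x0 -> (forall t, 0 <= t <= T -> D (-1) (x t)) ->
  (forall t, 0 <= t <= T -> D (-1) (fun k => d k * x t k + h t k)) ->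
  (forall n, citg `[0, T] (h^~ n)) -> (forall n, citg `[0, T] (g^~ n)) ->
  (forall t n, 0 <= t <= T -> x t n = duhamel (d n) (x0 n) (h^~ n) t) ->
  (forall t n, 0 <= t <= T ->
    X (fun k => d k * x t k + h t k) n = d' n * X (x t) n + g t n) ->
  forall t n, 0 <= t <= T -> X (x t) n = duhamel (d' n) (X x0 n) (g^~ n) t.
Proof.
move=> row x0D xD yD ih ig xE XE t n /andP[t0 tT].
have T0 := le_trans t0 tT.
have cx k : ccont `[0, T] (x^~ k).
  by apply: eq_ccont (duhamel_cont (d k) (x0 k) T0 (ih k)) => s sT; rewrite xE.
apply: (@weak_duhamel _ _ _ _ (fun s => X (x s) n)) => //.
- exact: citgS (ig n).
- by apply: (citgS _ tT) => //; apply: citg_cont; apply: ccont_row cx xD; exact: row.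
move=> r /andP[r0 rt]; have rT := le_trans rt tT.
have sub s : s \in (`[0, r]%classic : set R) -> 0 <= s <= T.
  by rewrite inE /= in_itv/= => /andP[-> /le_trans ->].
have [M HM] := row n.
have mI : measurable (`[0, r]%classic : set (measurableTypeR R)) by exact: measurable_itv.
have ik k : citg `[0, r] (fun s => d k * x s k + h s k).
  apply: citgD => //; last exact: citgS (ih k).
  by apply: citgZ => //; apply: (citgS _ rT) => //; exact: citg_cont.
have xw k : x r k = x0 k + cint `[0, r] (fun s => d k * x s k + h s k).
  rewrite xE ?r0// duhamel_weak//; last exact: citgS (ih k).
  by congr (_ + _); apply: eq_cint => s sr; rewrite -xE//; exact: sub.
rewrite !HM//; last by apply: xD; rewrite r0.
under eq_bigr do rewrite xw mulrDl.
rewrite big_split /=; congr (_ + _).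
under eq_bigr do rewrite mulrC -cintZ//.
rewrite -cint_sum//; last by move=> k; exact: citgZ.
apply: eq_cint => s /sub sT; rewrite -XE// HM; last exact: yD.
by apply: eq_bigr => k _; rewrite mulrC.
Qed.

End forcing.

(** * Mild solutions of the closed-loop and of the conjugated equation *)

Section mild.
Variables (R : realType) (H : hilbertType R) (A : diagParabolic H).
Variables (l mu : R) (m : nat) (B : 'I_m -> nat -> R[i]).
Variables (T : (nat -> R[i]) -> nat -> R[i]) (K : {linear H -> 'rV[R[i]]_m}).
Local Notation lam := (eigval A).
Local Notation e := (eigvec A).
Local Notation seqC := (nat -> R[i]).
Local Notation D := (spaceD lam).
Local Notation S := (opinv A T).
Local Notation dd := (eigval_mu A l mu).
Hypothesis B_D : forall j, D (-1) (B j).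
Hypothesis Feq : F_equivalence A l B (op_mu A l mu) T K.
Hypothesis mu_generic : forall n k, lam k <> lam n - (mu%:C)%C.

Lemma input_sum N (a : nat -> R[i]) (z : nat -> 'rV[R[i]]_m) n :
  input B (\sum_(k < N) a k *: z k) n = \sum_(k < N) a k * input B (z k) n.
Proof.
rewrite /input fct_sumE; under [RHS]eq_bigr do rewrite fct_sumE mulr_sumr.
rewrite exchange_big /=; apply: eq_bigr => j _.
rewrite (_ : (_ *: _) n = (\sum_(k < N) a k *: z k) 0 j * B j n)// summxE mulr_suml.
by apply: eq_bigr => k _; rewrite mxE mulrA.
Qed.

Lemma input_ccont (u : R -> H) (Tt : R) n :
  (forall k, ccont `[0, Tt] (fun t => hcoord A (u t) k)) ->
  ccont `[0, Tt] (fun t => input B (K (u t)) n).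
Proof.
move=> cu; have [N0 HN] := K_low Feq.
rewrite (_ : (fun t => _) = fun t => \sum_(k < N0) hcoord A (u t) k * input B (K (e k)) n).
  by apply: ccont_sum => k; apply: ccontM => //; exact: ccont_cst.
by apply/funext => t; rewrite HN (input_sum _ (hcoord A (u t)) (fun k => K (e k))).
Qed.

Let D0m y : D 0 y -> D (-1) y. Proof. exact: D0m. Qed.

Lemma citg_row (f : R -> seqC) (Tt : R) n : (forall t, 0 <= t <= Tt -> D (-1) (f t)) ->
  (forall k, citg `[0, Tt] (f^~ k)) -> citg `[0, Tt] (fun t => T (f t) n).
Proof.
move=> fD fi; have [M HM] := T_row Feq mu_generic n.
have mI : measurable (`[0, Tt]%classic : set (measurableTypeR R)) by exact: measurable_itv.
apply: (@eq_citg _ _ (fun t => \sum_(k < M) T (unitseq R k) n * f t k)) => //.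
  move=> t; rewrite inE /= in_itv/= => tT; rewrite HM; last exact: fD.
  by apply: eq_bigr => k _; rewrite mulrC.
by apply: citg_sum => // k; exact: citgZ.
Qed.

(** The feedback [B K v] counts as part of the forcing for [A]; [T] turns [A v + B K v] into
    [D_mu T v], so only [T f] remains as forcing. *)
Lemma mild_conjugate (u0 : H) (v : R -> H) f (Tt : R) :
  {within `[0, +oo[, continuous v} -> bochner_integrable A `[0, Tt] f ->
  (forall t, 0 <= t <= Tt -> hcoord A (v t) = semigroup A t (hcoord A u0) +
    bochner `[0, t] (fun s => semigroup A (t - s) (input B (K (v s)) + f s))) ->
  forall t, 0 <= t <= Tt ->
    T (hcoord A (v t)) = system_duhamel dd (T (hcoord A u0)) (fun s => T (f s)) t.
Proof.
move=> cv fb vE t tT; apply/funext => n.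
have fD s : 0 <= s <= Tt -> D (-1) (f s).
  by case: fb => fD _ _ _ sT; apply: fD; rewrite /= in_itv.
have fi k : citg `[0, Tt] (f^~ k) by exact: citg_bochner fb.
have cv' k : ccont `[0, Tt] (fun t => hcoord A (v t) k) by exact: hcurve_ccont.
have mI : measurable (`[0, Tt]%classic : set (measurableTypeR R)) by exact: measurable_itv.
pose h s k := input B (K (v s)) k + f s k.
have hE s : (fun k => lam k * hcoord A (v s) k + h s k) =
    (op A (hcoord A (v s)) + input B (K (v s))) + f s.
  by apply/funext => k; rewrite /h addrA.
have XD s : D (-1) (op A (hcoord A (v s)) + input B (K (v s))).
  by apply: spaceDD; [apply: op_D; exact: D0_hcoord|exact: input_D].
apply: (@weak_transform _ _ A T lam dd _ h (fun s => T (f s)) (fun s => hcoord A (v s)) Tt) => //.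
- exact: T_row Feq mu_generic.
- by apply: D0m; exact: D0_hcoord.
- by move=> s _; apply: D0m; exact: D0_hcoord.
- by move=> s sT; rewrite hE; apply: spaceDD => //; exact: fD.
- by move=> k; apply: citgD => //; apply: citg_cont; exact: input_ccont.
- by move=> k; exact: citg_row.
- by move=> s k sT; rewrite vE.
move=> s k sT; rewrite hE (blockD (T_lin Feq) (XD s) (fD s sT)) (T_eq Feq).
by [].
Qed.

(** Under [S] the feedback reappears: [S D_mu w = (A + B K) S w]. *)
Lemma conjugate_mild (u0 : H) (w f : R -> seqC) (Tt : R) :
  (forall t, 0 <= t <= Tt -> D 0 (w t)) -> bochner_integrable A `[0, Tt] f ->
  (forall t, 0 <= t <= Tt ->
    w t = system_duhamel dd (T (hcoord A u0)) (fun s => T (f s)) t) ->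
  forall t, 0 <= t <= Tt -> S (w t) = semigroup A t (hcoord A u0) +
    bochner `[0, t] (fun s => semigroup A (t - s) (input B (K (toH A (S (w s)))) + f s)).
Proof.
move=> wD fb wE t tT; apply/funext => n.
have fD s : 0 <= s <= Tt -> D (-1) (f s).
  by case: fb => fD _ _ _ sT; apply: fD; rewrite /= in_itv.
have fi k : citg `[0, Tt] (f^~ k) by exact: citg_bochner fb.
have Tfi k : citg `[0, Tt] (fun s => T (f s) k) by exact: citg_row.
have Tt0 : 0 <= Tt by case/andP: tT; exact: le_trans.
have cw k : ccont `[0, Tt] (w^~ k).
  by apply: eq_ccont (duhamel_cont (dd k) (T (hcoord A u0) k) Tt0 (Tfi k)) => s sT; rewrite wE.
have cS k : ccont `[0, Tt] (fun s => S (w s) k).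
  by apply: (ccont_row (S_row B_D Feq mu_generic k) cw) => s sT; apply: D0m; exact: wD.
have cu k : ccont `[0, Tt] (fun s => hcoord A (toH A (S (w s))) k).
  by apply: eq_ccont (cS k) => s sT; rewrite toHK//; exact/(S_D0 Feq)/wD.
have mI : measurable (`[0, Tt]%classic : set (measurableTypeR R)) by exact: measurable_itv.
pose g s k := input B (K (toH A (S (w s)))) k + f s k.
(* Membership in D(A)' is read off from [D_mu w = T (A + B K) S w]. *)
have ddD s : 0 <= s <= Tt -> D (-1) (fun k => dd k * w s k).
  move=> sT; have := T_eq Feq (toH A (S (w s))).
  rewrite toHK; last exact/(S_D0 Feq)/wD.
  rewrite (TSK Feq) => [<-|]; last exact/D0m/wD.
  apply: (T_Dm Feq); apply: spaceDD; last exact: input_D.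
  by apply: op_D; exact/(S_D0 Feq)/wD.
have hE s : (fun k => dd k * w s k + T (f s) k) = (fun k => dd k * w s k) + T (f s) by [].
have u0D : D (-1) (hcoord A u0) by apply: D0m; exact: D0_hcoord.
have := @weak_transform _ _ A S dd lam (T (hcoord A u0)) (fun s => T (f s)) g w Tt.
rewrite (STK Feq u0D); apply => //.
- exact: (S_row B_D Feq mu_generic).
- exact: (T_Dm Feq).
- by move=> s sT; apply: D0m; exact: wD.
- by move=> s sT; rewrite hE; apply: spaceDD; [exact: ddD|apply: (T_Dm Feq); exact: fD].
- by move=> k; apply: citgD => //; apply: citg_cont; exact: input_ccont.
- by move=> s k sT; rewrite wE.
move=> s k sT; rewrite hE (blockD (S_lin Feq) (ddD s sT) (T_Dm Feq (fD s sT))).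
rewrite (STK Feq (fD s sT)) (S_eq B_D Feq (wD s sT)).
by rewrite /g addrA.
Qed.

End mild.

(** * Well-posedness and decay *)

Section almost_everywhere.
Variable R : realType.

Lemma ae_imp (P Q : R -> Prop) : {ae leb, forall t : R, P t} ->
  (forall t, P t -> Q t) -> {ae leb, forall t : R, Q t}.
Proof.
move=> [N [mN N0 NP]] PQ; exists N; split=> // t /= nQ; apply: NP => /= Pt.
exact/nQ/PQ.
Qed.

Lemma ae_and (P Q : R -> Prop) : {ae leb, forall t : R, P t} ->
  {ae leb, forall t : R, Q t} -> {ae leb, forall t : R, P t /\ Q t}.
Proof.
move=> [N [mN N0 NP]] [M [mM M0 MQ]]; exists (N `|` M); split.
- exact: measurableU.
- exact: null_set_setU.
move=> t /= nPQ; have [Pt|nPt] := pselect (P t); last by left; exact: NP.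
by right; apply: MQ => /= Qt; exact: nPQ.
Qed.

Lemma ae_neq (z : R) : {ae leb, forall t : R, t <> z}.
Proof.
exists [set z]; split; [exact: measurable_set1|exact: lebesgue_measure_set1|].
by move=> t /= /contrapT.
Qed.

End almost_everywhere.

(** * Passing between bounded intervals and the half-line, and almost-everywhere comparison *)

Section halfline.
Variables (R : realType) (lam : nat -> R[i]).
Local Notation seqC := (nat -> R[i]).
Local Notation sq := (sqnormD lam).
Local Notation D := (spaceD lam).

Let F (n : nat) : set (measurableTypeR R) := `]0, n%:R]%classic.

Let FE : \bigcup_n F n = `]0, +oo[%classic.
Proof.
apply/seteqP; split=> [t [n _]|t]; rewrite /F /= !in_itv/= ?andbT.
  by case/andP.
move=> t0; exists (truncn t).+1 => //=; rewrite in_itv/= t0/= ltW//.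
by have /andP[] := truncn_itv (ltW t0).
Qed.

Let mF n : measurable (F n). Proof. exact: measurable_itv. Qed.

Let FS n : F n `<=` `[0, n%:R].
Proof. by move=> t; rewrite /F /= !in_itv/= => /andP[/ltW -> ->]. Qed.

Lemma cmeas_halfline (f : R -> R[i]) : (forall T, 0 <= T -> cmeas `[0, T] f) ->
  cmeas `]0, +oo[ f.
Proof.
move=> mf; rewrite -FE; split; apply/measurable_fun_bigcup => // n.
  by apply: measurable_funS (proj1 (mf n%:R _)) => //; exact: FS.
by apply: measurable_funS (proj2 (mf n%:R _)) => //; exact: FS.
Qed.

Lemma halfline_le l r (h : R -> seqC) (q : R) : 0 <= l ->
  (forall T n, 0 <= T -> cmeas `[0, T] (h^~ n)) ->
  (forall T, 0 <= T -> (wint lam l r T h <= q%:E)%E) ->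
  (\int[leb]_(t in `]0%R, +oo[) sq r (h t) <= q%:E)%E.
Proof.
move=> l0 mh hq; rewrite -FE.
have msq n : measurable_fun (`[0, n%:R]%classic : set (measurableTypeR R)) (fun t => sq r (h t)).
  by apply: measurable_sq => k; exact: mh.
have mono : {homo F : n m / (n <= m)%N >-> (n <= m)%O}.
  move=> n k nk; rewrite subsetEset => t; rewrite /F /= !in_itv/= => /andP[-> /le_trans]; apply.
  by rewrite ler_nat.
have mFsq n : measurable_fun (F n) (fun t => sq r (h t)).
  by apply: measurable_funS (msq n) => //; exact: FS.
have cv := @ge0_nondecreasing_set_cvg_integral _ _ _ F (fun t => sq r (h t)) leb mono mF mFsq
  (fun n t _ => sq_ge0 lam r (h t)).
rewrite -(cvg_lim _ cv)//; apply: lime_le; first by apply/cvg_ex; eexists; exact: cv.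
apply: nearW => n; have n0 : (0 : R) <= n%:R by [].
apply: le_trans (hq n%:R n0).
have mE : measurable (`[0, n%:R]%classic : set (measurableTypeR R)) by exact: measurable_itv.
apply: (@le_trans _ _ (\int[leb]_(t in `[0%R, n%:R]) sq r (h t))%E).
  by apply: ge0_subset_integral => // t _; exact: sq_ge0.
apply: ge0_le_integral => //.
- by move=> t _; exact: sq_ge0.
- by apply: measurable_wint => k; exact: mh.
move=> t; rewrite /= in_itv/= => /andP[t0 _].
exact: sq_le_expR.
Qed.

Lemma wint_halfline l r (h : R -> seqC) T : 0 <= l -> 0 <= T ->
  (forall T n, 0 <= T -> cmeas `[0, T] (h^~ n)) ->
  (\int[leb]_(t in `]0%R, +oo[) sq r (h t) < +oo)%E -> (wint lam l r T h < +oo)%E.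
Proof.
move=> l0 T0 mh hfin.
have mhT n : cmeas `[0, T] (h^~ n) by exact: mh.
have mS : (`]0, T]%classic : set (measurableTypeR R)) `<=` `[0, T].
  by move=> t; rewrite /= !in_itv/= => /andP[/ltW -> ->].
have mI : measurable (`]0, T]%classic : set (measurableTypeR R)) by exact: measurable_itv.
have mJ : measurable (`[0, T]%classic : set (measurableTypeR R)) by exact: measurable_itv.
have mK : measurable (`]0, +oo[%classic : set (measurableTypeR R)) by exact: measurable_itv.
have msq : measurable_fun (`]0, +oo[%classic : set (measurableTypeR R)) (fun t => sq r (h t)).
  by apply: measurable_sq => n; apply: cmeas_halfline => T' T'0; exact: mh.
have ST : (`]0, T]%classic : set (measurableTypeR R)) `<=` `]0, +oo[.
  by move=> t; rewrite /= !in_itv/= => /andP[->].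
rewrite /wint -integral_itv_obnd_cbnd; last first.
  by apply: measurable_funS (measurable_wint lam l r mhT).
apply: (@le_lt_trans _ _ ((expR (2 * l * T))%:E * \int[leb]_(t in `]0%R, T]) sq r (h t))%E).
  rewrite -ge0_integralZl_EFin ?expR_ge0//; first last.
  - exact: measurable_funS msq.
  - by move=> t _; exact: sq_ge0.
  apply: ge0_le_integral => //.
  - by move=> t _; rewrite mule_ge0 ?sq_ge0// lee_fin expR_ge0.
  - by apply: measurable_funS (measurable_wint lam l r mhT).
  - by apply: measurable_funeM; exact: measurable_funS msq.
  move=> t; rewrite /= in_itv/= => /andP[t0 tT]; apply: lee_wpmul2r; first exact: sq_ge0.
  by rewrite lee_fin ler_expR ler_wpM2l// mulr_ge0.
rewrite lte_mul_pinfty//.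
apply: le_lt_trans hfin; apply: ge0_subset_integral => //.
by move=> t _; exact: sq_ge0.
Qed.

Lemma ae_halfline r (h : R -> seqC) : (forall T n, 0 <= T -> cmeas `[0, T] (h^~ n)) ->
  (\int[leb]_(t in `]0%R, +oo[) sq r (h t) < +oo)%E ->
  {ae leb, forall t, 0 < t -> D r (h t)}.
Proof.
move=> mh hfin.
have mK : measurable (`]0, +oo[%classic : set (measurableTypeR R)) by exact: measurable_itv.
have : leb.-integrable (`]0, +oo[%classic : set (measurableTypeR R)) (fun t => sq r (h t)).
  apply/integrableP; split.
    by apply: measurable_sq => n; apply: cmeas_halfline => T' T'0; exact: mh.
  apply: le_lt_trans hfin; rewrite le_eqVlt; apply/orP; left; apply/eqP.
  by apply: eq_integral => t _; rewrite gee0_abs// sq_ge0.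
move=> /(integrable_ae mK); apply: filterS => t + t0.
by rewrite /= in_itv/= t0 => /(_ isT); rewrite ge0_fin_numE ?sq_ge0.
Qed.

Lemma ae_wint l r T (h : R -> seqC) : (forall n, cmeas `[0, T] (h^~ n)) ->
  (wint lam l r T h < +oo)%E -> {ae leb, forall t, 0 <= t <= T -> D r (h t)}.
Proof.
move=> mh hfin.
have mK : measurable (`[0, T]%classic : set (measurableTypeR R)) by exact: measurable_itv.
have : leb.-integrable (`[0, T]%classic : set (measurableTypeR R))
    (fun s => (expR (2 * l * s))%:E * sq r (h s))%E.
  apply/integrableP; split; first exact: measurable_wint.
  apply: le_lt_trans hfin; rewrite le_eqVlt; apply/orP; left; apply/eqP.
  by apply: eq_integral => t _; rewrite gee0_abs// mule_ge0 ?sq_ge0// lee_fin expR_ge0.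
move=> /(integrable_ae mK); apply: filterS => t + tT.
rewrite /= in_itv/= tT => /(_ isT); rewrite ge0_fin_numE; last first.
  by rewrite mule_ge0 ?sq_ge0// lee_fin expR_ge0.
rewrite /spaceD /=; have [->|//] := eqVneq (sq r (h t)) +oo%E.
  by rewrite gt0_muley ?ltxx// lte_fin expR_gt0.
by move=> + _; rewrite ltey.
Qed.

Lemma ae_cint (I : set (measurableTypeR R)) (f g : R -> R[i]) : measurable I ->
  cmeas I f -> cmeas I g -> {ae leb, forall t, I t -> f t = g t} -> cint I f = cint I g.
Proof.
move=> mI [f1 f2] [g1 g2] fg; rewrite /cint /Rintegral; congr (Complex (fine _) (fine _)).
  by apply: ae_eq_integral => //; [exact/measurable_EFinP|exact/measurable_EFinP|];
    apply: filterS fg => t h It; rewrite h.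
by apply: ae_eq_integral => //; [exact/measurable_EFinP|exact/measurable_EFinP|];
  apply: filterS fg => t h It; rewrite h.
Qed.

Lemma ae_wint_le l r r' T (g h : R -> seqC) (C : R) : 0 <= C ->
  (forall n, cmeas `[0, T] (g^~ n)) -> (forall n, cmeas `[0, T] (h^~ n)) ->
  {ae leb, forall t, 0 <= t <= T -> (sq r (g t) <= C%:E * sq r' (h t))%E} ->
  (wint lam l r T g <= C%:E * wint lam l r' T h)%E.
Proof.
move=> C0 mg mh gh.
have mK : measurable (`[0, T]%classic : set (measurableTypeR R)) by exact: measurable_itv.
have mw := measurable_wint lam l r' mh.
rewrite /wint -ge0_integralZl_EFin//; last first.
  by move=> t _; rewrite mule_ge0 ?sq_ge0// lee_fin expR_ge0.
apply: ae_ge0_le_integral => //.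
- by move=> t _; rewrite mule_ge0 ?sq_ge0// lee_fin expR_ge0.
- exact: measurable_wint.
- by move=> t _; rewrite !mule_ge0 ?sq_ge0// lee_fin expR_ge0.
- exact: measurable_funeM.
apply: (ae_imp gh) => t h' tT; rewrite muleCA; apply: lee_wpmul2l; first by rewrite lee_fin expR_ge0.
by apply: h'; move: tT; rewrite /= in_itv.
Qed.

End halfline.

(** * Small-data theory for one equivalence and fixed constants *)

Section wellposed.
Variables (R : realType) (H : hilbertType R) (A : diagParabolic H).
Variables (l mu : R) (m : nat) (B : 'I_m -> nat -> R[i]).
Variables (T : (nat -> R[i]) -> nat -> R[i]) (K : {linear H -> 'rV[R[i]]_m}).
Variables (F : H -> nat -> R[i]) (gam eta k0 ph CT CS r0 c a rho del : R).
Local Notation lam := (eigval A).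
Local Notation seqC := (nat -> R[i]).
Local Notation Re := complex.Re.
Local Notation D := (spaceD lam).
Local Notation sq := (sqnormD lam).
Local Notation S := (opinv A T).
Local Notation dd := (eigval_mu A l mu).
Local Notation s0 := (opnorm_H A S ^+ 2).
Local Notation t0 := (opnorm_H A T ^+ 2).
Local Notation G := (conjG A F T S).
Local Notation L := (CT * (4 * k0 ^+ 2 * (CS * s0))).
Hypothesis B_D : forall j, D (-1) (B j).
Hypothesis Feq : F_equivalence A l B (op_mu A l mu) T K.
Hypothesis mu_generic : forall n k, lam k <> lam n - (mu%:C)%C.
Hypothesis l_ge0 : 0 <= l.
Hypothesis c_gt0 : 0 < c.
Hypothesis dd_le : forall n, Re (dd n) <= - (l + c * wt lam (1 / 2) n).
Hypothesis gam_ge0 : 0 <= gam.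
Hypothesis gam_le : gam <= 1 / 2.
Hypothesis eta_ge0 : 0 <= eta.
Hypothesis k0_ge0 : 0 <= k0.
Hypothesis ph_ge0 : 0 <= ph.
Hypothesis F_map : forall u, D gam (hcoord A u) -> D (- (1 / 2)) (F u).
Hypothesis F_bnd : forall u, D gam (hcoord A u) -> hnorm u <= eta ->
  normD lam (- (1 / 2)) (F u) <= ph * normD lam gam (hcoord A u).
Hypothesis F_lip : forall u v, D gam (hcoord A u) -> D gam (hcoord A v) ->
  hnorm u <= eta -> hnorm v <= eta ->
  normD lam (- (1 / 2)) (F u - F v) <=
    k0 * (normD lam gam (hcoord A u) + normD lam gam (hcoord A v)) * hnorm (u - v)
    + k0 * ph * normD lam gam (hcoord A (u - v)).
Hypothesis CT_ge0 : 0 <= CT.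
Hypothesis CS_gt0 : 0 < CS.
Hypothesis T_bnd : forall y, D (- (1 / 2)) y ->
  (sq (- (1 / 2)) (T y) <= CT%:E * sq (- (1 / 2)) y)%E.
Hypothesis S_bnd : forall y, D gam y -> (sq gam (S y) <= CS%:E * sq gam y)%E.
Hypothesis r0_le : s0 * r0 <= eta ^+ 2.
Hypothesis small_bnd : CT * (ph ^+ 2 * CS) <= c ^+ 2 / 8.
Hypothesis small_lip : CT * (2 * (k0 * ph) ^+ 2 * CS) <= c ^+ 2 / 8.
Hypothesis a_le : a <= r0.
Hypothesis La_le : L * a <= c ^+ 2 / 16.
Hypothesis rho_gt0 : 0 < rho.
Hypothesis rho_eta : rho <= eta.
Hypothesis rho_r0 : t0 * rho ^+ 2 <= r0.
Hypothesis del_a : t0 * del ^+ 2 <= a / 2.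
Hypothesis del_rho : s0 * (t0 * del ^+ 2) <= (rho / 2) ^+ 2.

Let CS_ge0 : 0 <= CS. Proof. exact: ltW. Qed.
Let s0_ge0 : 0 <= s0. Proof. exact: sqr_ge0. Qed.
Let theta_gt0 : 0 < c ^+ 2 / 8. Proof. by rewrite divr_gt0// exprn_gt0. Qed.
Let T0 : T 0 = 0. Proof. exact: block0 (T_lin Feq). Qed.
Let D0m y : D 0 y -> D (-1) y. Proof. exact: D0m. Qed.
Let T_row' := T_row Feq mu_generic.
Let S_row' := S_row B_D Feq mu_generic.

Let L_ge0 : 0 <= L.
Proof. by apply: mulr_ge0 => //; apply: mulr_ge0; apply: mulr_ge0 => //; exact: sqr_ge0. Qed.

Let G_bnd w : D (1 / 2) w -> (sq 0 w <= r0%:E)%E ->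
  (sq (- (1 / 2)) (G w) <= (c ^+ 2 / 8)%:E * sq (1 / 2) w)%E.
Proof.
move=> wD wr; apply: le_trans (conjG_bnd gam_ge0 eta_ge0 ph_ge0 F_map F_bnd gam_le
  CT_ge0 CS_ge0 s0_ge0 T_bnd S_bnd (S_sq0 Feq) r0_le wD wr) _.
by apply: lee_wpmul2r; rewrite ?sq_ge0.
Qed.

Let G_lip w v : D (1 / 2) w -> D (1 / 2) v ->
  (sq 0 w <= r0%:E)%E -> (sq 0 v <= r0%:E)%E ->
  (sq (- (1 / 2)) (G w - G v)%R <= L%:E * ((sq (1 / 2) w + sq (1 / 2) v) * sq 0 (w - v)%R)
     + (c ^+ 2 / 8)%:E * sq (1 / 2) (w - v)%R)%E.
Proof.
move=> wD vD wr vr; apply: le_trans (conjG_lip gam_ge0 eta_ge0 F_map F_lip gam_le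
  (T_lin Feq) (S_lin Feq) CT_ge0 CS_ge0 s0_ge0 T_bnd S_bnd (S_sq0 Feq) r0_le wD vD wr vr) _.
by apply: leeD => //; apply: lee_wpmul2r; rewrite ?sq_ge0.
Qed.

Let F_meas T' (w : R -> seqC) : (forall n, ccont `[0, T'] (w^~ n)) ->
  (forall t, 0 <= t <= T' -> (sq 0 (w t) <= r0%:E)%E) ->
  forall n, cmeas `[0, T'] (fun t => Fcurve A F S w t n).
Proof.
exact: (Fcurve_meas gam_ge0 eta_ge0 k0_ge0 ph_ge0 F_map F_lip gam_le S_row' CS_ge0
  s0_ge0 S_bnd (S_sq0 Feq) r0_le).
Qed.

Let G_meas T' (w : R -> seqC) : 0 <= T' -> (forall n, ccont `[0, T'] (w^~ n)) ->
  (forall t, 0 <= t <= T' -> (sq 0 (w t) <= r0%:E)%E) ->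
  forall n, cmeas `[0, T'] (fun t => Gcurve lam G w t n).
Proof.
exact: (conjG_meas gam_ge0 eta_ge0 k0_ge0 ph_ge0 F_map F_lip gam_le T0 T_row' S_row' CS_ge0
  s0_ge0 S_bnd (S_sq0 Feq) r0_le).
Qed.

Variable u0 : H.
Hypothesis u0_le : hnorm u0 <= del.
Local Notation z := (T (hcoord A u0)).

Let z_D0 : D 0 z. Proof. by apply: (T_D0 Feq); exact: D0_hcoord. Qed.

Let z_le' : (sq 0 z <= (t0 * hnorm u0 ^+ 2)%:E)%E.
Proof. by rewrite EFinM -(parseval A); apply: (T_sq0 Feq); exact: D0_hcoord. Qed.

Let z_del : (sq 0 z <= (t0 * del ^+ 2)%:E)%E.
Proof.
apply: le_trans z_le' _; rewrite lee_fin ler_wpM2l ?sqr_ge0//.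
by rewrite ler_pXn2r// ?nnegrE ?hnorm_ge0// (le_trans _ u0_le)// hnorm_ge0.
Qed.

Let z_le : (sq 0 z <= (a / 2)%:E)%E.
Proof. by apply: le_trans z_del _; rewrite lee_fin. Qed.

(** The class where the contraction gives uniqueness: curves that stay in the energy ball of size
    [a] on every interval. The Picard limit belongs to it, and so does the image under [T] of every
    mild solution. *)
Definition conj_solution (w : R -> seqC) : Prop :=
  [/\ forall Tt, 0 <= Tt -> energy_le lam l c Tt w a,
      forall Tt n, 0 <= Tt -> ccont `[0, Tt] (w^~ n) &
      forall t, 0 <= t -> w t = system_duhamel dd z (Gcurve lam G w) t].

Lemma conj_solution_exists : exists w, conj_solution w.
Proof.
have [w [h1 [h2 h3]]] := semilinear_existence dd_le l_ge0 c_gt0 L_ge0 theta_gt0 (lexx _)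
  G_bnd G_lip G_meas a_le La_le z_le.
by exists w.
Qed.

(** * From the conjugated equation to a mild solution *)

Section from_conjugate.
Variable w : R -> seqC.
Hypothesis w_sol : conj_solution w.
Let u t := toH A (S (w t)).

Let w_a t : 0 <= t -> (sq 0 (w t) <= a%:E)%E.
Proof.
move=> t_ge0; case: w_sol => we _ _; apply: (energy_le_sq l_ge0 (we t t_ge0)).
by rewrite t_ge0 lexx.
Qed.

Let w_r0 t : 0 <= t -> (sq 0 (w t) <= r0%:E)%E.
Proof. by move=> t_ge0; apply: le_trans (w_a t_ge0) _; rewrite lee_fin. Qed.

Let w_D0 t : 0 <= t -> D 0 (w t).
Proof. by move=> t_ge0; apply: le_lt_trans (w_a t_ge0) _; rewrite ltry. Qed.

Let w_cont Tt n : 0 <= Tt -> ccont `[0, Tt] (w^~ n).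
Proof. by case: w_sol => _ + _; exact. Qed.

Let w_meas Tt n : 0 <= Tt -> cmeas `[0, Tt] (w^~ n).
Proof. by move=> Tt0; apply: cmeas_ccont; exact: w_cont. Qed.

Lemma conj_hcoord t : 0 <= t -> hcoord A (u t) = S (w t).
Proof. by move=> t_ge0; rewrite toHK//; exact/(S_D0 Feq)/w_D0. Qed.

Let w_half Tt : 0 <= Tt -> (wint lam l (1 / 2) Tt w <= (c^-1 * a)%:E)%E.
Proof. by move=> Tt0; case: w_sol => we _ _; exact: wint_le_div (we Tt Tt0). Qed.

Let w_half_fin : (\int[leb]_(t in `]0%R, +oo[) sq (1 / 2) (w t) < +oo)%E.
Proof. by apply: le_lt_trans (halfline_le l_ge0 w_meas w_half) _; rewrite ltry. Qed.

Let G_fin Tt : 0 <= Tt -> (wint lam l (- (1 / 2)) Tt (Gcurve lam G w) < +oo)%E.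
Proof.
move=> Tt0; have h := wint_Gcurve l theta_gt0 G_bnd G_meas Tt0 (fun n => w_cont n Tt0).
apply: le_lt_trans (h _) _; first by move=> t /andP[+ _]; exact: w_r0.
rewrite lte_mul_pinfty ?lee_fin ?(ltW theta_gt0)//.
by apply: le_lt_trans (w_half Tt0) _; rewrite ltry.
Qed.

Let u_near (Tt t eps : R) : 0 <= t <= Tt -> 0 < eps ->
  \forall s \near t, 0 <= s <= Tt -> (sq 0 (hcoord A (u t) - hcoord A (u s))%R <= eps%:E)%E.
Proof.
move=> tT eps0; have Tt0 : 0 <= Tt by case/andP: tT; exact: le_trans.
have e1 : 0 < eps / (s0 + 1) by rewrite divr_gt0// ltr_wpDl.
have mG := G_meas Tt0 (fun n => w_cont n Tt0).
have {}mG := mG (fun t tT => w_r0 (proj1 (andP tT))).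
have := system_sq0_cont mG dd_le l_ge0 c_gt0 Tt0 z_D0 (G_fin Tt0) e1 tT.
case: w_sol => _ _ wE; apply: filterS => s hs sT; move: (hs sT).
have /andP[t_ge0 _] := tT; have /andP[s_ge0 _] := sT.
rewrite -!wE// !conj_hcoord// => {}hs.
rewrite -(blockB (S_lin Feq)); [|exact/D0m/w_D0|exact/D0m/w_D0].
have wD := spaceDB (w_D0 t_ge0) (w_D0 s_ge0).
apply: le_trans (S_sq0 Feq wD) _.
apply: (@le_trans _ _ (s0%:E * (eps / (s0 + 1))%:E)%E); first by apply: lee_wpmul2l.
rewrite -EFinM lee_fin mulrA ler_pdivrMr ?ltr_wpDl//.
by rewrite [s0 * eps]mulrC ler_wpM2l ?(ltW eps0)// lerDl ler01.
Qed.

(** Dropping the dissipation in the a priori estimate gives decay of [w] with constant 1; passing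
    from [u0] to [w] and back costs the two operator norms. *)
Lemma conj_decay t : 0 <= t ->
  hnorm (u t) <= opnorm_H A T * opnorm_H A S * expR (- l * t) * hnorm u0.
Proof.
move=> t_ge0; case: w_sol => we _ wE.
have := semilinear_apriori dd_le l_ge0 c_gt0 theta_gt0 (lexx _) G_bnd G_meas
  t_ge0 (fun n => w_cont n t_ge0) (fun t tT => w_r0 (proj1 (andP tT)))
  (le_lt_trans (w_half t_ge0) (ltry _)) (fun t tT => wE t (proj1 (andP tT))).
move=> /(le_trans _) h.
have {h} : ((expR (2 * l * t))%:E * sq 0 (w t) <= sq 0 z)%E.
  by apply: h; rewrite leeDl// mule_ge0 ?wint_ge0// lee_fin divr_ge0// ltW.
have [oT oS] : 0 <= opnorm_H A T /\ 0 <= opnorm_H A S.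
  case: Feq => -[[_ bT] _ _ [_ bS]] _ _ _ _.
  by split; exact: (opnorm_ge0 (A := A)).
have := S_sq0 Feq (w_D0 t_ge0); rewrite -conj_hcoord// parseval.
rewrite -(normD_sqr (w_D0 t_ge0)); set q := normD _ _ _.
rewrite -EFinM lee_fin => h1 h2; have := le_trans h2 z_le'; rewrite -EFinM lee_fin => {}h2.
rewrite -(@ler_pXn2r _ 2)// ?nnegrE ?hnorm_ge0 ?mulr_ge0 ?expR_ge0 ?hnorm_ge0//.
apply: le_trans h1 _; rewrite !exprMn.
have E : expR (- l * t) ^+ 2 = (expR (2 * l * t))^-1.
  by rewrite -expRN expr2 -expRD; congr expR; ring.
rewrite E; move: h2; rewrite mulrC -ler_pdivlMr ?expR_gt0// => h2.
apply: le_trans (ler_wpM2l s0_ge0 h2) _.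
by rewrite le_eqVlt; apply/orP; left; apply/eqP; ring.
Qed.

Lemma conj_Cb : in_Cb u.
Proof.
split; first by apply: (hcurve_continuous (A := A)) => Tt t eps; exact: u_near.
exists (Num.sqrt (s0 * a)) => t t_ge0.
have h : (sq 0 (S (w t)) <= (s0 * a)%:E)%E.
  by apply: le_trans (S_sq0 Feq (w_D0 t_ge0)) _; rewrite (EFinM s0); apply: lee_wpmul2l => //; exact: w_a.
have sa0 : 0 <= s0 * a by rewrite -lee_fin (le_trans _ h)// sq_ge0.
move: h; rewrite -conj_hcoord// parseval lee_fin => h.
by rewrite -(@ler_pXn2r _ 2)// ?nnegrE ?hnorm_ge0 ?sqrtr_ge0// sqr_sqrtr.
Qed.

Let u_meas Tt n : 0 <= Tt -> cmeas `[0, Tt] (fun t => hcoord A (u t) n).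
Proof.
move=> Tt0; apply: cmeas_ccont; apply: hcurve_ccont.
by case: conj_Cb.
Qed.

Lemma conj_L2 : in_L2 A gam u.
Proof.
have mK : measurable (`]0, +oo[%classic : set (measurableTypeR R)) by exact: measurable_itv.
have mu' : measurable_fun (`]0, +oo[%classic : set R) (fun t => sq gam (hcoord A (u t))).
  by apply: measurable_sq => n; apply: cmeas_halfline => Tt Tt0; exact: u_meas.
have mw : measurable_fun (`]0, +oo[%classic : set R) (fun t => sq (1 / 2) (w t)).
  by apply: measurable_sq => n; apply: cmeas_halfline => Tt Tt0; exact: w_meas.
apply: (@le_lt_trans _ _ (CS%:E * \int[leb]_(t in `]0%R, +oo[) sq (1 / 2) (w t))%E); last first.
  by rewrite lte_mul_pinfty.
rewrite -ge0_integralZl_EFin//; last by move=> t _; exact: sq_ge0.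
apply: ge0_le_integral => //.
- by move=> t _; exact: sq_ge0.
- exact: measurable_funeM.
move=> t; rewrite /= in_itv/= andbT => /ltW t_ge0; rewrite conj_hcoord//.
(* The bound on [S] needs a point of D_gam; elsewhere the right-hand side is infinite because
   [CS > 0]. *)
have [->|wfin] := eqVneq (sq (1 / 2) (w t)) +oo%E; first by rewrite gt0_muley ?leey// lte_fin.
have wD : D (1 / 2) (w t) by rewrite /spaceD /= ltey.
apply: le_trans (S_bnd (spaceD_mono gam_le wD)) _; apply: lee_wpmul2l => //.
exact: sq_mono.
Qed.

(** [Fcurve] serves as the representative of the forcing: it agrees with [F (u t)] whenever [w t]
    lies in D_(1/2), hence almost everywhere. *)
Lemma conj_mild : mild_solution A B K gam F u0 u.
Proof.
have [we wc wE] := w_sol.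
have u0D : D (-1) (hcoord A u0) by apply: D0m; exact: D0_hcoord.
have fb t : 0 <= t -> bochner_integrable A `[0, t] (Fcurve A F S w).
  move=> t_ge0; apply: (@bochner_of_wint _ _ _ l (- (1 / 2))) => //; first by lra.
  - by apply: F_meas => [n|s /andP[s_ge0 _]]; [exact: w_cont|exact: w_r0].
  - move=> s _; apply: (@spaceD_mono _ _ _ (- (1 / 2))); first by lra.
    exact: (Fcurve_D gam_ge0 F_map gam_le CS_ge0 S_bnd).
  apply: (@le_lt_trans _ _ ((ph ^+ 2 * CS)%:E * wint lam l (1 / 2) t w)%E).
    apply: ae_wint_le.
    - by rewrite mulr_ge0// sqr_ge0.
    - by apply: F_meas => [n|s /andP[s_ge0 _]]; [exact: w_cont|exact: w_r0].
    - by move=> n; exact: w_meas.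
    apply: aeW => s /andP[s_ge0 _].
    apply: (Fcurve_bnd gam_ge0 eta_ge0 ph_ge0 F_map F_bnd gam_le CS_ge0 s0_ge0 S_bnd (S_sq0 Feq) r0_le).
      exact: w_D0.
    exact: w_r0.
  rewrite lte_mul_pinfty ?lee_fin ?mulr_ge0 ?sqr_ge0//.
  by apply: le_lt_trans (w_half t_ge0) _; rewrite ltry.
split.
  by rewrite /u wE// (_ : system_duhamel _ _ _ 0 = z) ?(STK Feq) ?hcoordK//;
    apply/funext => n; exact: duhamel0.
exists (Fcurve A F S w); split => //.
- apply: (ae_imp (ae_halfline w_meas w_half_fin)) => t wD t_gt0.
  have {}wD := wD t_gt0; rewrite conj_hcoord ?(ltW t_gt0)//; split.
    apply: le_lt_trans (S_bnd (spaceD_mono gam_le wD)) _.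
    by rewrite lte_mul_pinfty//; exact: spaceD_mono wD.
  by rewrite /Fcurve; case: asboolP.
move=> t t_ge0; rewrite conj_hcoord//.
apply: (conjugate_mild B_D Feq mu_generic _ (fb t t_ge0)).
- by move=> s /andP[s_ge0 _]; exact: w_D0.
- move=> s /andP[s_ge0 _]; rewrite wE//; congr system_duhamel.
  by apply/funext => r; exact: Gcurve_conjG.
by rewrite t_ge0 lexx.
Qed.

End from_conjugate.

(** * From a mild solution to the conjugated equation *)

Section to_conjugate.
Variable v : R -> H.
Hypothesis v_Cb : in_Cb v.
Hypothesis v_L2 : in_L2 A gam v.
Hypothesis v_mild : mild_solution A B K gam F u0 v.
Let w t := T (hcoord A (v t)).

Let v_cont Tt n : ccont `[0, Tt] (fun t => hcoord A (v t) n).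
Proof. by apply: hcurve_ccont; case: v_Cb. Qed.

Let w_D0 t : D 0 (w t). Proof. by apply: (T_D0 Feq); exact: D0_hcoord. Qed.

Let Sw t : S (w t) = hcoord A (v t).
Proof. by rewrite /w (STK Feq)//; apply: D0m; exact: D0_hcoord. Qed.

Let w_cont Tt n : ccont `[0, Tt] (w^~ n).
Proof.
by apply: (ccont_row (T_row' n)) => // t _; apply: D0m; exact: D0_hcoord.
Qed.

(** A mild solution is only assumed in L^2 with values in D_gam. While it is small its forcing is in
    L^2 with values in D_(-1/2), and the energy estimate for the linear equation upgrades [w] to
    D_(1/2), where the energy argument takes place. *)
Lemma small_conj Tt : 0 <= Tt -> (forall t, 0 <= t <= Tt -> hnorm (v t) <= rho) ->
  [/\ forall t, 0 <= t <= Tt -> (sq 0 (w t) <= r0%:E)%E,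
      (wint lam l (1 / 2) Tt w < +oo)%E &
      forall t, 0 <= t <= Tt -> w t = system_duhamel dd z (Gcurve lam G w) t].
Proof.
move=> Tt0 v_rho.
have wr t : 0 <= t <= Tt -> (sq 0 (w t) <= r0%:E)%E.
  move=> tT; apply: le_trans (T_sq0 Feq (D0_hcoord A _)) _.
  rewrite parseval -EFinM lee_fin; apply: le_trans rho_r0.
  by rewrite ler_wpM2l ?sqr_ge0// ler_pXn2r ?nnegrE ?hnorm_ge0 ?(ltW rho_gt0)//; exact: v_rho.
case: v_mild => v0 [f [fE fb vE]].
have fD t : 0 <= t <= Tt -> D (-1) (f t).
  by case: (fb Tt Tt0) => fD _ _ _ tT; apply: fD; rewrite /= in_itv.
have Tfm n : cmeas `[0, Tt] (fun t => T (f t) n).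
  have [i1 i2] := citg_row Feq mu_generic n fD (fun k => citg_bochner k (fb Tt Tt0)).
  split; first by have /measurable_int /measurable_EFinP := i1.
  by have /measurable_int /measurable_EFinP := i2.
have Tfi n : citg `[0, Tt] (fun t => T (f t) n).
  exact: (citg_row Feq mu_generic n fD (fun k => citg_bochner k (fb Tt Tt0))).
have vm n : cmeas `[0, Tt] (fun t => hcoord A (v t) n) by apply: cmeas_ccont; exact: v_cont.
have wE t : 0 <= t <= Tt -> w t = system_duhamel dd z (fun s => T (f s)) t.
  move=> tT; apply: (mild_conjugate B_D Feq mu_generic _ (fb Tt Tt0) _ tT).
    by case: v_Cb.
  by move=> s /andP[s_ge0 _]; exact: vE.
have fv : {ae leb, forall t, 0 <= t <= Tt -> D gam (hcoord A (v t)) /\ f t = F (v t)}.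
  apply: (ae_imp (ae_and fE (ae_neq 0))) => t [h t0'] /andP[t_ge0 _]; apply: h.
  by rewrite lt_neqAle t_ge0 andbT eq_sym; exact/eqP.
have vL : (wint lam l gam Tt (fun t => hcoord A (v t)) < +oo)%E.
  by apply: wint_halfline => // T' n _; apply: cmeas_ccont; exact: v_cont.
have gfin : (wint lam l (- (1 / 2)) Tt (fun s => T (f s)) < +oo)%E.
  apply: (@le_lt_trans _ _ ((CT * ph ^+ 2)%:E * wint lam l gam Tt (fun t => hcoord A (v t)))%E).
    apply: ae_wint_le => //; first by rewrite mulr_ge0// sqr_ge0.
    apply: (ae_imp fv) => t h tT; have [vD fvE] := h tT.
    rewrite fvE; apply: le_trans (T_bnd (F_map vD)) _.
    rewrite EFinM -muleA; apply: lee_wpmul2l => //.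
    have := seqF_bnd gam_ge0 eta_ge0 ph_ge0 F_map F_bnd vD; rewrite /seqF hcoordK; apply.
    rewrite parseval lee_fin ler_pXn2r ?nnegrE ?hnorm_ge0//.
    exact: le_trans (v_rho t tT) rho_eta.
  by rewrite lte_mul_pinfty// lee_fin mulr_ge0// sqr_ge0.
(* The regularity gain: the linear estimate is applied to [w] with [T f] as a given forcing. *)
have wfin : (wint lam l (1 / 2) Tt w < +oo)%E.
  rewrite (eq_wint lam l _ wE).
  pose b := fine (wint lam l (- (1 / 2)) Tt (fun s => T (f s))).
  have bE : (wint lam l (- (1 / 2)) Tt (fun s => T (f s)) <= b%:E)%E.
    by rewrite /b fineK// ge0_fin_numE ?wint_ge0.
  have := system_energy_le dd_le l_ge0 c_gt0 Tt0 Tfm z_le bE.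
  by move=> /(wint_le_div c_gt0) /le_lt_trans; apply; rewrite ltry.
split=> // t tT; rewrite wE//; apply/funext => n.
have /andP[t_ge0 tT'] := tT.
have mI : measurable (`[0, t]%classic : set (measurableTypeR R)) by exact: measurable_itv.
have mc d g : cmeas `[0, t] g -> cmeas `[0, t] (fun s => cexp ((t - s)%:C%C * d) * g s).
  move=> mg; rewrite (_ : (fun s => _) =
    fun s => (cexp (t%:C%C * d) * cexp (s%:C%C * - d)) * g s); last first.
    by apply/funext => s; rewrite cexp_rD mulrN.
  apply: cmeasM => //; apply: cmeasM; first exact: cmeas_cst.
  by apply: cmeas_ccont; exact: ccont_cexp.
(* The two forcings agree at almost every time, those where [v] is in D_gam, [f] represents [F v]
   and [w] is in D_(1/2). *)
rewrite /system_duhamel /duhamel; congr (_ + _); apply: ae_cint => //.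
- by apply: mc; apply: (cmeasS tT' Tfm).
- by apply: mc; apply: (cmeasS tT' (G_meas Tt0 (w_cont Tt) wr)).
have wm k : cmeas `[0, Tt] (w^~ k) by apply: cmeas_ccont; exact: w_cont.
apply: (ae_imp (ae_and fv (ae_wint wm wfin))) => s [h1 h2]; rewrite /= in_itv/= => /andP[s_ge0 st].
have sT : 0 <= s <= Tt by rewrite s_ge0 (le_trans st).
have [vD fvE] := h1 sT; have wD := h2 sT.
rewrite Gcurve_conjG// /Fcurve asboolT//.
by rewrite /seqF Sw hcoordK fvE.
Qed.

Lemma small_apriori Tt : 0 <= Tt -> (forall t, 0 <= t <= Tt -> hnorm (v t) <= rho) ->
  ((expR (2 * l * Tt))%:E * sq 0 (w Tt) + (c / 2)%:E * wint lam l (1 / 2) Tt w <= sq 0 z)%E.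
Proof.
move=> Tt0 /(small_conj Tt0) [wr wfin wE].
exact: (semilinear_apriori dd_le l_ge0 c_gt0 theta_gt0 (lexx _) G_bnd G_meas
  Tt0 (w_cont Tt) wr wfin wE).
Qed.

Let sq_w_le Tt : 0 <= Tt -> (forall t, 0 <= t <= Tt -> hnorm (v t) <= rho) ->
  (sq 0 (w Tt) <= sq 0 z)%E.
Proof.
move=> Tt0 /(small_apriori Tt0); apply: le_trans.
apply: (@le_trans _ _ ((expR (2 * l * Tt))%:E * sq 0 (w Tt))%E).
  exact: sq_le_expR.
by rewrite leeDl// mule_ge0 ?wint_ge0// lee_fin divr_ge0// ltW.
Qed.

(** While [v] stays below [rho], the a priori estimate bounds [w] by its initial value, and the
    choice of [del] brings [v] back below [rho / 2]; the continuity method concludes. *)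
Lemma mild_small t : 0 <= t -> hnorm (v t) <= rho.
Proof.
have step Tt : 0 <= Tt -> (forall t, 0 <= t <= Tt -> hnorm (v t) <= rho) ->
    hnorm (v Tt) <= rho / 2.
  move=> Tt0 h; rewrite -(@ler_pXn2r _ 2)// ?nnegrE ?hnorm_ge0 ?(ltW (divr_gt0 _ _))//.
  rewrite -lee_fin -(parseval A) -Sw; apply: le_trans (S_sq0 Feq (w_D0 Tt)) _.
  apply: le_trans _ (_ : ((s0 * (t0 * del ^+ 2))%:E <= _)%E); last by rewrite lee_fin.
  rewrite (EFinM s0); apply: lee_wpmul2l => //.
  exact: le_trans (sq_w_le Tt0 h) z_del.
case: v_Cb => cv _.
have rho2 : rho / 2 < rho by have := rho_gt0; lra.
apply: (hcurve_bootstrap cv rho2) => //.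
case: v_mild => -> _; rewrite -(@ler_pXn2r _ 2)// ?nnegrE ?hnorm_ge0 ?(ltW (divr_gt0 _ _))//.
rewrite -lee_fin -(parseval A) -(STK Feq (D0m (D0_hcoord A u0))).
apply: le_trans (S_sq0 Feq z_D0) _.
apply: le_trans _ (_ : ((s0 * (t0 * del ^+ 2))%:E <= _)%E); last by rewrite lee_fin.
by rewrite (EFinM s0); apply: lee_wpmul2l.
Qed.

Lemma mild_conj_solution : conj_solution w.
Proof.
have small Tt : 0 <= Tt -> forall t, 0 <= t <= Tt -> hnorm (v t) <= rho.
  by move=> _ t /andP[t_ge0 _]; exact: mild_small.
split=> [Tt Tt0|Tt n _|t t_ge0]; last 2 first.
- exact: w_cont.
- by have [_ _] := small_conj t_ge0 (small t t_ge0); apply; rewrite t_ge0 lexx.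
have a0 : 0 <= a / 2 by rewrite -lee_fin (le_trans _ z_le)// sq_ge0.
split=> [t /andP[t_ge0 _]|].
  have := le_trans (small_apriori t_ge0 (small t t_ge0)) z_le.
  move=> /(le_trans _) h; apply: (@le_trans _ _ (a / 2)%:E); last by rewrite lee_fin; lra.
  by apply: h; rewrite leeDl// mule_ge0 ?wint_ge0// lee_fin divr_ge0// ltW.
have := le_trans (small_apriori Tt0 (small Tt Tt0)) z_le.
move=> /(le_trans _) h; have {}h : ((c / 2)%:E * wint lam l (1 / 2) Tt w <= (a / 2)%:E)%E.
  by apply: h; rewrite leeDr// mule_ge0 ?sq_ge0// lee_fin expR_ge0.
rewrite (_ : c%:E = (2%:E * (c / 2)%:E)%E); last by rewrite -EFinM; congr EFin; field.
rewrite (_ : a%:E = (2%:E * (a / 2)%:E)%E); last by rewrite -EFinM; congr EFin; field.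
by rewrite -muleA; apply: lee_wpmul2l.
Qed.

End to_conjugate.

Lemma conj_solution_unique w w' t : conj_solution w -> conj_solution w' -> 0 <= t ->
  w t = w' t.
Proof.
move=> [we wc wE] [we' wc' wE'] t_ge0.
apply: (energy_le_unique dd_le l_ge0 c_gt0 L_ge0 theta_gt0 (lexx _) G_bnd G_lip G_meas t_ge0
  a_le La_le (fun n => wc t n t_ge0) (fun n => wc' t n t_ge0) (we t t_ge0) (we' t t_ge0)).
- by move=> s /andP[+ _]; exact: wE.
- by move=> s /andP[+ _]; exact: wE'.
by rewrite t_ge0 lexx.
Qed.

Lemma wellposed : exists u : R -> H,
  [/\ in_Cb u, in_L2 A gam u, mild_solution A B K gam F u0 u,
      (forall v : R -> H, in_Cb v -> in_L2 A gam v -> mild_solution A B K gam F u0 v ->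
         forall t, 0 <= t -> v t = u t) &
      forall t, 0 <= t -> hnorm (u t) <=
        opnorm_H A T * opnorm_H A S * expR (- l * t) * hnorm u0].
Proof.
have [w w_sol] := conj_solution_exists; exists (fun t => toH A (S (w t))).
split; [exact: conj_Cb|exact: conj_L2|exact: conj_mild| |exact: conj_decay].
move=> v vC vL vm t t_ge0.
rewrite -(conj_solution_unique (mild_conj_solution vC vL vm) w_sol t_ge0).
by rewrite (STK Feq) ?hcoordK//; apply: D0m; exact: D0_hcoord.
Qed.

End wellposed.

(** * Choice of the constants and exceptional values of the shift *)

Section constants.
Variable R : realType.

Lemma small_sqr (M p q : R) : 0 <= M -> 0 < p -> 0 < q ->
  exists x : R, [/\ 0 < x, x <= p & M * x ^+ 2 <= q].
Proof.
move=> M0 p0 q0; have M1 : 0 < M + 1 by rewrite ltr_wpDl.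
pose x := Num.min (Num.min 1 p) (q / (M + 1)).
have x0 : 0 < x by rewrite !lt_min ltr01 p0 divr_gt0.
have x1 : x <= 1 by rewrite /x !ge_min lexx.
have xp : x <= p by rewrite /x !ge_min lexx orbT.
have xq : x <= q / (M + 1) by rewrite /x !ge_min lexx !orbT.
exists x; split=> //; apply: (@le_trans _ _ ((M + 1) * x)).
  by rewrite expr2 mulrA ler_pM ?mulr_ge0 ?(ltW x0)//; nra.
by rewrite mulrC -ler_pdivlMr.
Qed.

(** The factor 2 is for the Lipschitz bound, where [Phi] is taken at a sum of two norms, each at
    most [x]. *)
Lemma small_modulus (Phi : R -> R) (p e : R) : (forall a, 0 <= a -> 0 <= Phi a) ->
  Phi a @[a --> 0^'+] --> Phi 0 -> Phi 0 = 0 -> 0 < p -> 0 < e ->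
  exists x : R, [/\ 0 < x, x <= p & Phi (2 * x) <= e].
Proof.
move=> Phi_ge0 /cvgrPdist_lt + Phi0 p0 e0 => /(_ e e0); rewrite Phi0 => h.
have {h} /nbhs_ballP [d d0 hd] : \forall a \near (0 : R), 0 < a -> `|0 - Phi a| < e := h.
pose x := Num.min p (d / 4).
have x0 : 0 < x by rewrite lt_min p0 divr_gt0.
have xd : x <= d / 4 by rewrite /x ge_min lexx orbT.
exists x; split=> //; first by rewrite /x ge_min lexx.
have x2 : 0 < 2 * x by rewrite mulr_gt0.
have := hd (2 * x); rewrite /ball /= sub0r normrN gtr0_norm// => /(_ _ x2).
rewrite sub0r normrN ger0_norm; last exact/Phi_ge0/ltW.
by move=> /(_ _)/ltW; apply; have : 0 < d by []; lra.
Qed.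

(** A resonance forces [mu] to be a difference of real parts of two eigenvalues, and these form a
    countable set. *)
Lemma ae_nonresonant (lam : nat -> R[i]) :
  {ae leb, forall mu : R, forall n k, lam k <> lam n - (mu%:C)%C}.
Proof.
pose E : set R := range (fun p : nat * nat => complex.Re (lam p.1) - complex.Re (lam p.2)).
have cE : countable E by apply: (sub_countable (card_image_le _ _)); exact: countableP.
exists E; split; [exact: countable_measurable|exact: countable_lebesgue_measure0|].
move=> mu /= nmu; apply: contrapT => muE; apply: nmu => n k eq.
apply: muE; exists (n, k) => //=.
by rewrite eq cReD cReN /=; ring.
Qed.

End constants.

Theorem theorem3p7 (R : realType) (H : hilbertType R) (A : diagParabolic H)
    (m : nat) (s : R) (B : 'I_m -> nat -> R[i])
    (gam : R) (gam_def : gam = Num.min (1 - s) (1 / 2))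
    (F : H -> nat -> R[i]) (eta kappa0 : R) (Phi : R -> R) (lambda : R)
    (s_ge0 : 0 <= s) (s_le1 : s <= 1)
    (B_reg : forall j, D_ A (- s) (B j))
    (F_map : forall u, D_ A gam (hcoord A u) -> D_ A (- (1 / 2)) (F u))
    (eta_gt0 : 0 < eta) (kappa0_gt0 : 0 < kappa0)
    (Phi_ge0 : forall a, 0 <= a -> 0 <= Phi a)
    (Phi_nondecr : forall a b, 0 <= a -> a <= b -> Phi a <= Phi b)
    (Phi_cont0 : Phi a @[a --> 0^'+] --> Phi 0)
    (Phi_0 : Phi 0 = 0)
    (F_bound : forall u,
       D_ A gam (hcoord A u) -> hnorm u <= eta ->
       normD_ A (- (1 / 2)) (F u) <= Phi (hnorm u) * normD_ A gam (hcoord A u))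
    (F_lip : forall u v,
       D_ A gam (hcoord A u) -> D_ A gam (hcoord A v) ->
       hnorm u <= eta -> hnorm v <= eta ->
       normD_ A (- (1 / 2)) (F u - F v) <=
         kappa0 * (normD_ A gam (hcoord A u) + normD_ A gam (hcoord A v))
           * hnorm (u - v)
         + kappa0 * Phi (hnorm u + hnorm v) * normD_ A gam (hcoord A (u - v)))
    (lambda_gt0 : 0 < lambda)
    (B_adm : F_admissible A lambda B) :
  {ae @lebesgue_measure R, forall mu : R, lambda + c_ A <= mu ->
    forall (T : (nat -> R[i]) -> nat -> R[i])
           (K : {linear H -> 'rV[R[i]]_m}),
      F_equivalence A lambda B (op_mu A lambda mu) T K ->
      exists2 delta : R, 0 < delta &
        forall u0 : H, hnorm u0 <= delta ->
          exists u : R -> H,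
            [/\ in_Cb u, in_L2 A gam u, mild_solution A B K gam F u0 u,
                (forall v : R -> H,
                   in_Cb v -> in_L2 A gam v ->
                   mild_solution A B K gam F u0 v ->
                   forall t, 0 <= t -> v t = u t) &
                forall t, 0 <= t ->
                  hnorm (u t) <=
                    opnorm_H A T * opnorm_H A (opinv A T)
                      * expR (- lambda * t) * hnorm u0]}.
Proof.
have gam_ge0 : 0 <= gam by rewrite gam_def le_min subr_ge0 s_le1 divr_ge0.
have gam_half : gam <= 1 / 2 by rewrite gam_def ge_min lexx orbT.
have gam_s : gam <= 1 - s by rewrite gam_def ge_min lexx.
have B_D j : D_ A (-1) (B j) by apply: spaceD_mono (B_reg j); rewrite lerN2.
(* Excluding the single value [lambda + c_A] turns the large inequality on [mu] into the strict one
   needed for the gap. *)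
apply: (ae_imp (ae_and (ae_neq (lambda + c_ A)) (ae_nonresonant (eigval A)))).
move=> mu [mu_neq mu_generic] mu_ge T K Feq.
have mu_gt : lambda + c_ A < mu by rewrite lt_neqAle mu_ge andbT eq_sym; exact/eqP.
have [c c_gt0 dd_le] := spectral_gap lambda_gt0 mu_gt.
have [||CT CT_ge0 T_bnd] := T_bound Feq mu_generic (r := - (1 / 2)); [by lra|by lra|].
have [|CS' CS'_ge0 S_bnd'] := S_bound B_D Feq mu_generic (r := gam) B_reg.
  by rewrite gam_ge0 gam_s.
(* The added 1 makes the constant positive, so that its product with an infinite norm is
   infinite. *)
pose CS := CS' + 1.
have CS_gt0 : 0 < CS by rewrite ltr_wpDl.
have S_bnd y : D_ A gam y ->
    (sqnormD (eigval A) gam (opinv A T y) <= CS%:E * sqnormD (eigval A) gam y)%E.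
  move=> yD; apply: le_trans (S_bnd' y yD) _; apply: lee_wpmul2r; first exact: sq_ge0.
  by rewrite lee_fin lerDl.
have q0 : 0 < c ^+ 2 / 8 by rewrite divr_gt0// exprn_gt0.
(* The factor [1 + 2 kappa0^2] serves both smallness conditions, for the growth bound with 1 and for
   the Lipschitz bound with [2 kappa0^2]. *)
have M0 : 0 <= CT * CS * (1 + 2 * kappa0 ^+ 2).
  by rewrite !mulr_ge0// ?(ltW CS_gt0)// addr_ge0// mulr_ge0// sqr_ge0.
have [e [e_gt0 _ e_le]] := small_sqr M0 ltr01 q0.
have [eta' [eta'_gt0 eta'_le ph_e]] := small_modulus Phi_ge0 Phi_cont0 Phi_0 eta_gt0 e_gt0.
set ph := Phi (2 * eta') in ph_e.
have ph_ge0 : 0 <= ph by apply: Phi_ge0; rewrite mulr_ge0// ltW.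
have ph2 : CT * CS * (1 + 2 * kappa0 ^+ 2) * ph ^+ 2 <= c ^+ 2 / 8.
  apply: le_trans e_le; apply: ler_wpM2l => //.
  by rewrite ler_pXn2r// nnegrE// ltW.
set s0 := opnorm_H A (opinv A T) ^+ 2; set t0 := opnorm_H A T ^+ 2.
have s0_ge0 : 0 <= s0 by exact: sqr_ge0.
have t0_ge0 : 0 <= t0 by exact: sqr_ge0.
(* If [|w|^2 <= r0] then [|S w|^2 <= s0 r0 <= eta'^2], so [F] is controlled at [S w]; the added 1
   avoids a zero denominator. *)
pose r0 := eta' ^+ 2 / (s0 + 1).
have r0_gt0 : 0 < r0 by rewrite divr_gt0 ?exprn_gt0// ltr_wpDl.
pose L := CT * (4 * kappa0 ^+ 2 * (CS * s0)).
have L_ge0 : 0 <= L.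
  by apply: mulr_ge0 => //; apply: mulr_ge0; apply: mulr_ge0 => //; [exact: sqr_ge0|exact: ltW].
(* The first bound keeps the energy ball where the nonlinearity is controlled, the second gives the
   smallness [L a <= c^2 / 16] of the contraction. *)
pose a := Num.min r0 (c ^+ 2 / 16 / (L + 1)).
have a_gt0 : 0 < a by rewrite lt_min r0_gt0 !divr_gt0 ?exprn_gt0// ltr_wpDl.
have [rho [rho_gt0 rho_le rho_r0]] := small_sqr t0_ge0 eta'_gt0 r0_gt0.
(* The first bound puts [T u0] in half of the energy ball, the second makes the continuity method
   start and end below [rho / 2]. *)
have p0 : 0 < Num.min (a / 2) ((rho / 2) ^+ 2 / (s0 + 1)).
  by rewrite lt_min divr_gt0//= divr_gt0 ?exprn_gt0 ?divr_gt0// ltr_wpDl.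
have [del [del_gt0 _]] := small_sqr t0_ge0 ltr01 p0; rewrite le_min => /andP[del_a del_rho].
exists del => // u0 u0_le.
apply: (wellposed (a := a) (r0 := r0) (rho := rho) (del := del) (eta := eta') (k0 := kappa0)
  (ph := ph) B_D Feq mu_generic (ltW lambda_gt0) c_gt0 dd_le gam_ge0 gam_half _ _ ph_ge0 F_map
  _ _ CT_ge0 CS_gt0 T_bnd S_bnd) => //.
- exact: ltW.
- exact: ltW.
- move=> u uD ue; apply: le_trans (F_bound u uD (le_trans ue eta'_le)) _.
  apply: ler_wpM2r; first exact: normD_ge0.
  by apply: Phi_nondecr; [exact: hnorm_ge0|lra].
- move=> u v uD vD ue ve.
  apply: le_trans (F_lip u v uD vD (le_trans ue eta'_le) (le_trans ve eta'_le)) _.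
  apply: lerD => //; apply: ler_wpM2r; first exact: normD_ge0.
  apply: ler_wpM2l; first exact: ltW.
  by apply: Phi_nondecr; [rewrite addr_ge0 ?hnorm_ge0|lra].
- rewrite /r0 mulrA ler_pdivrMr ?ltr_wpDl// mulrC ler_wpM2l ?sqr_ge0//.
  by rewrite lerDl ler01.
- apply: le_trans ph2; rewrite (_ : CT * (ph ^+ 2 * CS) = CT * CS * 1 * ph ^+ 2); last by ring.
  apply: ler_wpM2r; first exact: sqr_ge0.
  apply: ler_wpM2l; first by rewrite mulr_ge0// ltW.
  by rewrite lerDl mulr_ge0// sqr_ge0.
- apply: le_trans ph2.
  rewrite (_ : CT * _ = CT * CS * (2 * kappa0 ^+ 2) * ph ^+ 2); last by ring.
  apply: ler_wpM2r; first exact: sqr_ge0.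
  apply: ler_wpM2l; first by rewrite mulr_ge0// ltW.
  by rewrite lerDr ler01.
- by rewrite /a ge_min lexx.
- have aL : a <= c ^+ 2 / 16 / (L + 1) by rewrite /a ge_min lexx orbT.
  apply: (@le_trans _ _ ((L + 1) * a)).
    by apply: ler_wpM2r; [exact: ltW|rewrite lerDl ler01].
  by rewrite mulrC -ler_pdivlMr// ltr_wpDl.
- move: del_rho; rewrite ler_pdivlMr ?ltr_wpDl// => del_rho; apply: le_trans del_rho.
  have : 0 <= t0 * del ^+ 2 by rewrite mulr_ge0 ?sqr_ge0.
  by rewrite -/s0 -/t0; lra.
Qed.
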